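(* Let $\mathbf{A}_N=\{A_N^k:k\in K\}$ and $\mathbf{B}_N=\{B_N^k:k\in K\}$ ($N\ge 2$) be sequences of families of deterministic $N\times N$ complex matrices, bounded in operator norm uniformly in $N$. Let $(v_N)_{N\ge 2}$ be a sequence of (deterministic) unit vectors $v_N\in\mathbb{C}^N$ and, for each $N\geq 2$, let $U_N$ be a uniform random unitary $N\times N$ matrix leaving $v_N$ invariant. Then, as $N\to\infty$, for any polynomial $P\in\mathbb{C}\langle X_k,Y_k:k\in K\rangle$, $$\psi_{\mathbf{A}_N,U_N\mathbf{B}_NU_N^\star}(P)=(\psi_{\mathbf{A}_N}*\psi_{\mathbf{B}_N})(P)+o(1)\quad\text{almost surely}$$ and $$\varphi^{v_N}_{\mathbf{A}_N,U_N\mathbf{B}_NU_N^\star}(P)=\big(\varphi^{v_N}_{\mathbf{A}_N}\,{}_{\psi_{\mathbf{A}_N}}\!*_{\psi_{\mathbf{B}_N}}\,\varphi^{v_N}_{\mathbf{B}_N}\big)(P)+o(1)\quad\text{almost surely.}$$ In other words, almost surely, $\mathbf{A}_N$ and $U_N\mathbf{B}_NU_N^\star$ are asymptotically conditionally free with respect to $(\mathrm{tr}_N,\varphi^{v_N})$.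
   Context: A uniform random unitary matrix leaving $v$ invariant is a random matrix distributed according to Haar measure on the compact group $\{U\in U(N):Uv=v\}$ (isomorphic to $U(N-1)$ if $v\ne0$). Distributions: $\mathrm{tr}_N=\frac1N\mathrm{Tr}_N$. For a family $\mathbf{A}=\{A^k:k\in K\}$ of $N\times N$ matrices and a vector $v\in\mathbb{C}^N$, define linear functionals on $\mathbb{C}\langle X_k:k\in K\rangle$ by $\psi_{\mathbf{A}}(P)=\mathrm{tr}_N(P(\mathbf{A}))$ and $\varphi^{v}_{\mathbf{A}}(P)=\mathrm{Tr}_N(vv^\star P(\mathbf{A}))$. Similarly, for a pair of families, $\psi_{\mathbf{A},\mathbf{C}}(P)=\mathrm{tr}_N(P(\mathbf{A},\mathbf{C}))$ and $\varphi^v_{\mathbf{A},\mathbf{C}}(P)=\mathrm{Tr}_N(vv^\star P(\mathbf{A},\mathbf{C}))$ for $P\in\mathbb{C}\langle X_k,Y_k:k\in K\rangle$ ($X_k$ evaluated on $\mathbf{A}$, $Y_k$ on $\mathbf{C}$); $U\mathbf{B}U^\star=\{UB^kU^\star\}$. Products: for unital complex algebras $\mathcal{A}_1,\mathcal{A}_2$, $\mathcal{A}_1\star\mathcal{A}_2$ is the free product with identification of units (so $\mathbb{C}\langle X_k\rangle\star\mathbb{C}\langle Y_k\rangle=\mathbb{C}\langle X_k,Y_k\rangle$; the $\mathbf{B}$-functionals are viewed on $\mathbb{C}\langle Y_k\rangle$). A sequence $(a_1,\dots,a_n)$ in $\mathcal{A}_1\cup\mathcal{A}_2$ is alternating if $a_j\in\mathcal{A}_{i_j}$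 with $i_1\ne i_2\neq\cdots\ne i_n$, and centered w.r.t. $\psi$ if $\psi(a_1)=\cdots=\psi(a_n)=0$. For unital linear functionals $\psi_i,\varphi_i:\mathcal{A}_i\to\mathbb{C}$, $\psi_1*\psi_2$ is the unique linear functional on $\mathcal{A}_1\star\mathcal{A}_2$ extending $\psi_1,\psi_2$ and vanishing on $a_1\cdots a_n$ for every alternating sequence centered w.r.t. it; the conditionally free product $\varphi_1\,{}_{\psi_1}\!*_{\psi_2}\,\varphi_2$ is the unique linear functional $\varphi$ on $\mathcal{A}_1\star\mathcal{A}_2$ extending $\varphi_1,\varphi_2$ with $\varphi(a_1\cdots a_n)=\varphi(a_1)\cdots\varphi(a_n)$ for every alternating sequence centered w.r.t. $\psi_1*\psi_2$. Two sequences of families are asymptotically conditionally free w.r.t. a pair of functionals if their joint distributions w.r.t. these functionals coincide with these products of the marginal distributions up to $o(1)$, evaluated on each polynomial. *)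

(* Defs.v *)
From HB Require Import structures.
From mathcomp Require Import all_boot all_order all_algebra.
From mathcomp.real_closed Require Export complex.
From mathcomp.multinomials Require Export monalg.
From mathcomp Require Import all_classical all_reals all_analysis.

Set Implicit Arguments.
Unset Strict Implicit.
Unset Printing Implicit Defensive.

Import Order.TTheory GRing.Theory Num.Theory.
Import numFieldNormedType.Exports.

Local Open Scope classical_set_scope.
Local Open Scope ring_scope.
Local Open Scope sesquilinear_scope.

(* f = g + o(1), with the modulus normc taken in R. *)
Definition eq_o1 (R : realType) (f g : nat -> R[i]) : Prop :=
  Normc.normc (f n - g n) @[n --> \oo] --> (0 : R).

(* The free unital algebra R[i]<X_k : k in K>, as the monoid algebra of the
   free monoid on K. *)
Notation ncpoly R K := {malg (complex R)[{fmonom K}]}.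

Definition ncvar (R : realType) (K : choiceType) (k : K) : ncpoly R K :=
  mkmalgU (fmu k) 1.

Definition nceval (R : realType) (K : choiceType) (S : lalgType R[i])
    (f : K -> S) (P : ncpoly R K) : S :=
  mmap (fun c : R[i] => c%:A) (fun m : {fmonom K} => \prod_(k <- (m : seq K)) f k) P.

(* The free product R[i]<X_k : k in K> * R[i]<Y_k : k in K> is the algebra of
   noncommutative polynomials in letters K + K, with X_k := inl k and
   Y_k := inr k. An element of the disjoint sum of the two factors is a pair
   (index of the factor, element of the factor). *)

Section Products.
Context (R : realType) (K : choiceType).
Local Notation C := (R[i]).
Local Notation NC := (ncpoly R K).
Local Notation NC2 := (ncpoly R (K + K)%type).

Definition embX : NC -> NC2 := nceval (fun k => ncvar R (inl k : (K + K)%type)).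
Definition embY : NC -> NC2 := nceval (fun k => ncvar R (inr k : (K + K)%type)).

Definition factor_val (a : (NC + NC)%type) : NC2 :=
  match a with inl p => embX p | inr q => embY q end.

Definition factor_prod (s : seq (NC + NC)%type) : NC2 :=
  \prod_(a <- s) factor_val a.

Definition alternating (s : seq (NC + NC)%type) : bool :=
  (s != [::]) && sorted (fun a b => is_inl a != is_inl b) s.

Definition centered (psi : NC2 -> C) (s : seq (NC + NC)%type) : Prop :=
  {in s, forall a, psi (factor_val a) = 0}.

Definition is_free_product (psi1 psi2 : NC -> C) (psi : NC2 -> C) : Prop :=
  [/\ scalar psi,
      forall p, psi (embX p) = psi1 p,
      forall q, psi (embY q) = psi2 q &
      forall s, alternating s -> centered psi s -> psi (factor_prod s) = 0].

(* The unique functional with the defining property, selected by choice; it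
   exists when psi1 and psi2 are linear and unital (the default value 0 is
   taken only if there is no such functional). *)
Definition free_product (psi1 psi2 : NC -> C) : NC2 -> C :=
  xget (fun=> 0) [set psi | is_free_product psi1 psi2 psi].

Definition is_cfree_product (psi1 psi2 phi1 phi2 : NC -> C) (phi : NC2 -> C) :
    Prop :=
  [/\ scalar phi,
      forall p, phi (embX p) = phi1 p,
      forall q, phi (embY q) = phi2 q &
      forall s, alternating s -> centered (free_product psi1 psi2) s ->
        phi (factor_prod s) = \prod_(a <- s) phi (factor_val a)].

Definition cfree_product (psi1 psi2 phi1 phi2 : NC -> C) : NC2 -> C :=
  xget (fun=> 0) [set phi | is_cfree_product psi1 psi2 phi1 phi2 phi].

End Products.

Section Matrices.
Context (R : realType).
Local Notation C := (R[i]).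

Definition l2norm (n : nat) (x : 'cV[C]_n) : R :=
  Num.sqrt (\sum_(i < n) Normc.normc (x i 0) ^+ 2).

Definition opnorm (n : nat) (M : 'M[C]_n) : R :=
  sup [set l2norm (M *m x) | x in [set x : 'cV[C]_n | l2norm x <= 1]].

(* The distributions of the family A with respect to the normalized trace and
   to v; the nonzero dimension n.+1 makes the matrices a nontrivial ring. *)
Definition psi_mx (K : choiceType) (n : nat) (A : K -> 'M[C]_n.+1)
    (P : ncpoly R K) : C :=
  n.+1%:R^-1 * \tr (nceval A P).

Definition phi_mx (K : choiceType) (n : nat) (v : 'cV[C]_n.+1)
    (A : K -> 'M[C]_n.+1) (P : ncpoly R K) : C :=
  \tr (v *m v^t* *m nceval A P).

Definition pair_family (K : choiceType) (n : nat) (A D : K -> 'M[C]_n)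
    (z : (K + K)%type) : 'M[C]_n :=
  match z with inl k => A k | inr k => D k end.

Definition conj_family (K : choiceType) (n : nat) (U : 'M[C]_n)
    (B : K -> 'M[C]_n) (k : K) : 'M[C]_n :=
  U *m B k *m U^t*.

(* The index n stands for the dimension N = n + 2. *)
Definition asymp_cfree (K : choiceType) (v : forall n, 'cV[C]_n.+2)
    (A D : forall n, K -> 'M[C]_n.+2) : Prop :=
  forall P : ncpoly R (K + K)%type,
    eq_o1 (fun n => psi_mx (pair_family (A n) (D n)) P)
          (fun n => free_product (psi_mx (A n)) (psi_mx (D n)) P) /\
    eq_o1 (fun n => phi_mx (v n) (pair_family (A n) (D n)) P)
          (fun n => cfree_product (psi_mx (A n)) (psi_mx (D n))
                      (phi_mx (v n) (A n)) (phi_mx (v n) (D n)) P).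

(* The Borel sigma-algebra of the space of n x n complex matrices, i.e. of
   R^(2n^2): it is generated by the real and imaginary parts of the entries. *)
Definition mx_borel (n : nat) : set (set 'M[C]_n) :=
  <<s [set E | exists (i j : 'I_n) (S : set R), measurable S /\
         (E = [set M : 'M[C]_n | S (complex.Re (M i j))] \/
          E = [set M : 'M[C]_n | S (complex.Im (M i j))])] >>.

Definition stabilizer (n : nat) (v : 'cV[C]_n) : set 'M[C]_n :=
  [set V | V \is unitarymx /\ V *m v = v].

(* The law of the random matrix U is the Haar probability measure on the
   compact group G, i.e. the only Borel probability measure which is carried by
   G and invariant under left translations by elements of G. *)
Definition haar_distributed (d : measure_display) (T : measurableType d)
    (Pr : probability T R) (n : nat) (G : set 'M[C]_n) (U : T -> 'M[C]_n) :
    Prop :=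
  [/\ forall E, mx_borel E -> measurable (U @^-1` E),
      {ae Pr, forall w, G (U w)} &
      forall V, G V -> forall E, mx_borel E ->
        Pr [set w | E (V *m U w)] = Pr [set w | E (U w)]].

End Matrices.

(* Main.v *)
Require Import Defs.
From HB Require Import structures.
From mathcomp Require Import all_boot all_order all_algebra.
From mathcomp Require Import all_classical all_reals all_analysis.
From mathcomp Require Import measurable_realfun zify ring lra.

Set Implicit Arguments.
Unset Strict Implicit.
Unset Printing Implicit Defensive.

Import Order.TTheory GRing.Theory Num.Theory.
Import numFieldNormedType.Exports.

Local Open Scope classical_set_scope.
Local Open Scope ring_scope.
Local Open Scope sesquilinear_scope.

(** Write [N = n + 2] for the dimension, [Q = 1 - v v^*], and let [U] be Haar
distributed on the stabilizer of [v].

The law of [U] is invariant under [U -> W U] for every unitary [W] fixing [v].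
Differentiating along the Cayley transforms of the matrices [w w^*], with [w]
orthogonal to [v], shows that the mean of the derivative of a smooth function of
[U] vanishes in these directions, hence by polarization in all the directions
[Q E_ij Q] ([null_direction_rank1]). For the [(i, j)] entry of a word in
deterministic letters [a] and conjugated letters [U b U^*], multiplied by a
scalar function [F], the sum over [i] and [j] is the Schwinger-Dyson equation
([schwinger_dyson]). Its first term is a signed sum, over the cuts of the word
next to a conjugated letter, of the products of the traces of the two pieces;
the term that comes from the derivative of [F] is smaller by a power of [N].

Consider an alternating word in traceless letters and let [Z] be its normalized
trace. One extreme cut gives back the whole word, with the coefficient
[tr_N Q = 1 - 1/N]; at every other cut one piece is a shorter alternating word,
whose trace is small by induction on the length. With [F = Z Zc^2], [Zc] being
the conjugate of [Z], the equation bounds the mean of [|Z|^4] by itself times a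
constant less than one plus [O(N^-2)] ([master]). Hence the traces of such words
have a fourth moment in [O(N^-2)]
([traceless_trace_small]), which is the asymptotic freeness.

For the vector state, [1 = v v^* + Q] is inserted after the first letter [x] of a
word [x s]. The part [v v^*] gives the product of the values of the vector state
on [x] and on [s], as in a conditionally free product. The part [Q] is the
unnormalized trace of [Q s v v^* x]; it is bounded because [v v^*] has rank one,
and the same estimate shows that it is small, since the cuts inside [s] split off
normalized traces that are already known to be small ([vector_step],
[traceless_vstate_small]).

An arbitrary word is brought to alternating centered form by merging adjacent
factors of the same kind and subtracting normalized traces
([reduction_small]). The free and conditionally free products of the marginal
distributions obey the same reduction. They are selected by choice among the
functionals with the defining property, so such functionals have to be
constructed: the product of the centered blocks of a word has that word as its
leading term, and the prescribed values on these products therefore determine a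
functional by recursion on the length ([free_productP], [cfree_productP]).

The fourth moments of the deviations are thus summable over [N] for every word,
so the deviations tend to zero almost surely whatever the joint law of the
matrices ([small_ae]), and so they do for every polynomial, by linearity. *)

(** * Norms of complex numbers, vectors and matrices *)

Notation nc := (@Normc.normc _).

Section Modulus.
Context {R : realType}.
Local Notation C := R[i].
Implicit Types x y z : C.

Lemma nc_norm z : (nc z)%:C%C = `|z|.
Proof. by case: z. Qed.

Lemma nc_ge0 z : 0 <= nc z.
Proof. by rewrite -lecR nc_norm normr_ge0. Qed.

Lemma nc0 : nc (0 : C) = 0.
Proof. exact: Normc.normc0. Qed.

Lemma nc1 : nc (1 : C) = 1.
Proof. exact: Normc.normc1. Qed.

Lemma ncM x y : nc (x * y) = nc x * nc y.
Proof. exact: Normc.normcM. Qed.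

Lemma ncD x y : nc (x + y) <= nc x + nc y.
Proof. exact: le_normcD. Qed.

Lemma ncN x : nc (- x) = nc x.
Proof. exact: normcN. Qed.

Lemma ncB x y : nc (x - y) <= nc x + nc y.
Proof. by rewrite -(ncN y); exact: ncD. Qed.

Lemma nc_conj x : nc (Num.conj x) = nc x.
Proof. by apply: (@complexI R); rewrite !nc_norm norm_conjC. Qed.

Lemma nc_real (r : R) : nc (r%:C)%C = `|r|.
Proof. by rewrite /= expr0n addr0 sqrtr_sqr. Qed.

Lemma nc_nat (n : nat) : nc (n%:R : C) = n%:R.
Proof. by rewrite -(rmorph_nat (real_complex R)) nc_real normr_nat. Qed.

Lemma nc_natV (n : nat) : nc ((n%:R)^-1 : C) = n%:R^-1.
Proof. by rewrite Normc.normcV nc_nat. Qed.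

Lemma nc_Re z : `|complex.Re z| <= nc z.
Proof. by rewrite -lecR nc_norm normc_ge_Re. Qed.

Lemma nc_sum (I : Type) (s : seq I) (P : pred I) (F : I -> C) :
  nc (\sum_(i <- s | P i) F i) <= \sum_(i <- s | P i) nc (F i).
Proof.
elim/big_ind2 : _ => [|x1 x2 y1 y2 h1 h2|//]; first by rewrite nc0.
by apply: le_trans (ncD _ _) _; exact: lerD.
Qed.

Lemma nc_eq0 z : nc z = 0 -> z = 0.
Proof. exact: Normc.eq0_normc. Qed.

Lemma nc_sqr z : ((nc z ^+ 2)%:C)%C = Num.conj z * z.
Proof. by rewrite rmorphXn /= nc_norm normCK mulrC. Qed.

End Modulus.

Section Bounds.
Context {R : realType}.
Local Notation C := R[i].

Lemma sum_Cauchy_Schwarz (n : nat) (a b : 'I_n -> R) :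
  (\sum_i a i * b i) ^+ 2 <= (\sum_i a i ^+ 2) * (\sum_i b i ^+ 2).
Proof.
set S := \sum_i _; set A := \sum_i _; set B := \sum_i b i ^+ 2.
have B0 : 0 <= B by apply: sumr_ge0 => i _; exact: sqr_ge0.
(* the discriminant argument, with the minimizer S / B cleared of its
   denominator *)
have h : 0 <= B * (A * B - S ^+ 2).
  have -> : B * (A * B - S ^+ 2) = \sum_i (B * a i - S * b i) ^+ 2.
    transitivity (\sum_i (B ^+ 2 * a i ^+ 2 - (2 * B * S) * (a i * b i) +
        S ^+ 2 * b i ^+ 2)).
      rewrite big_split /= sumrB -!mulr_sumr -/A -/B -/S; ring.
    by apply: eq_bigr => i _; ring.
  by apply: sumr_ge0 => i _; exact: sqr_ge0.
have [Bp|] := ltP 0 B; first by move: h; rewrite pmulr_rge0 // subr_ge0.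
move=> Bn; have Bz : B = 0 by apply/eqP; rewrite eq_le Bn B0.
have bz i : b i = 0.
  apply/eqP; rewrite -sqrf_eq0; apply/eqP.
  move: Bz => /eqP; rewrite psumr_eq0 => [/allP/(_ i)|j _]; last exact: sqr_ge0.
  by rewrite mem_index_enum => /(_ isT)/eqP.
suff -> : S = 0 by rewrite expr0n /= Bz mulr0.
by apply: big1 => i _; rewrite bz mulr0.
Qed.

Lemma l2norm_ge0 n (x : 'cV[C]_n) : 0 <= l2norm x.
Proof. exact: sqrtr_ge0. Qed.

Lemma l2norm_sqr n (x : 'cV[C]_n) : l2norm x ^+ 2 = \sum_i nc (x i 0) ^+ 2.
Proof. by rewrite sqr_sqrtr // sumr_ge0 // => i _; exact: sqr_ge0. Qed.

Lemma l2norm_sqrC n (x : 'cV[C]_n) :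
  (x^t* *m x) 0 0 = ((l2norm x ^+ 2)%:C)%C.
Proof.
rewrite l2norm_sqr rmorph_sum /= mxE; apply: eq_bigr => i _.
by rewrite nc_sqr !mxE.
Qed.

Lemma dot_le n (x y : 'cV[C]_n) : nc ((x^t* *m y) 0 0) <= l2norm x * l2norm y.
Proof.
rewrite mxE; apply: le_trans (nc_sum _ _ _) _.
under eq_bigr do rewrite ncM !mxE nc_conj.
rewrite -[leLHS]ger0_norm; last first.
  by apply: sumr_ge0 => i _; rewrite mulr_ge0 ?nc_ge0.
rewrite -(ger0_norm (mulr_ge0 (l2norm_ge0 x) (l2norm_ge0 y))) -ler_sqr ?nnegrE//.
by rewrite !real_normK ?num_real // exprMn !l2norm_sqr sum_Cauchy_Schwarz.
Qed.

Lemma l2norm0 n : l2norm (0 : 'cV[C]_n) = 0.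
Proof.
by rewrite /l2norm big1 ?sqrtr0 // => i _; rewrite mxE nc0 expr0n.
Qed.

Lemma l2norm_eq0 n (x : 'cV[C]_n) : l2norm x = 0 -> x = 0.
Proof.
move=> /(congr1 (fun t => t ^+ 2)); rewrite l2norm_sqr expr0n /= => /eqP.
rewrite psumr_eq0 => [/allP h|i _]; last exact: sqr_ge0.
apply/matrixP => i j; rewrite !mxE (ord1 j); apply: nc_eq0.
by move: (h i); rewrite mem_index_enum sqrf_eq0 => /(_ isT)/eqP.
Qed.

Lemma l2normZ n (c : C) (x : 'cV[C]_n) : l2norm (c *: x) = nc c * l2norm x.
Proof.
rewrite /l2norm; under eq_bigr do rewrite mxE ncM exprMn.
by rewrite -mulr_sumr sqrtrM ?sqr_ge0 // sqrtr_sqr ger0_norm ?nc_ge0.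
Qed.

Lemma l2normD n (x y : 'cV[C]_n) : l2norm (x + y) <= l2norm x + l2norm y.
Proof.
rewrite -ler_sqr ?nnegrE ?addr_ge0 ?l2norm_ge0 // -lecR -l2norm_sqrC.
have -> : (x + y)^t* = x^t* + y^t* by rewrite linearD /= map_mxD.
have eD (A B : 'M[C]_1) : (A + B) 0 0 = A 0 0 + B 0 0 by rewrite mxE.
rewrite mulmxDl !mulmxDr !eD !l2norm_sqrC.
set d := (x^t* *m y) 0 0.
have -> : (y^t* *m x) 0 0 = Num.conj d.
  rewrite /d !mxE rmorph_sum; apply: eq_bigr => i _.
  by rewrite !mxE rmorphM /= conjCK mulrC.
have hd : d + Num.conj d <= ((2 * (l2norm x * l2norm y))%:C)%C.
  have -> : d + Num.conj d = ((2 * complex.Re d)%:C)%C.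
    by rewrite rmorphM rmorph_nat; exact: addcJ.
  rewrite lecR ler_pM2l //.
  apply: le_trans (dot_le x y); exact: le_trans (ler_norm _) (nc_Re _).
rewrite sqrrD !rmorphD /= -[leLHS]addrA [X in _ + X]addrA.
rewrite -[leRHS]addrA lerD2l lerD2r //.
by apply: le_trans hd _; rewrite -rmorphD lecR; lra.
Qed.

Lemma l2norm_le_sum n (x : 'cV[C]_n) : l2norm x <= \sum_i nc (x i 0).
Proof.
have S0 : 0 <= \sum_i nc (x i 0) by apply: sumr_ge0 => i _; exact: nc_ge0.
rewrite -ler_sqr ?nnegrE ?l2norm_ge0 // l2norm_sqr expr2 mulr_suml.
apply: ler_sum => i _; rewrite expr2; apply: ler_wpM2l; first exact: nc_ge0.
by rewrite (bigD1 i) //= lerDl sumr_ge0 // => j _; exact: nc_ge0.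
Qed.

Lemma entry_le_l2norm n (x : 'cV[C]_n) i : nc (x i 0) <= l2norm x.
Proof.
rewrite -ler_sqr ?nnegrE ?l2norm_ge0 ?nc_ge0 // l2norm_sqr (bigD1 i) //=.
by rewrite lerDl sumr_ge0 // => j _; exact: sqr_ge0.
Qed.

(** An upper bound on the operator norm. Unlike the supremum [opnorm], it is
stable under sums, products and adjoints without any side condition. *)
Definition bnd n (M : 'M[C]_n) (c : R) : Prop :=
  0 <= c /\ forall x : 'cV[C]_n, l2norm (M *m x) <= c * l2norm x.

Lemma opnorm_bnd n (M : 'M[C]_n) c : opnorm M <= c -> bnd M c.
Proof.
set S := [set l2norm (M *m x) | x in [set x : 'cV[C]_n | l2norm x <= 1]].
move=> Mc; have S0 : S 0 by exists 0; rewrite /= ?mulmx0 l2norm0.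
have Sub : has_sup S.
  split; first by exists 0.
  exists (\sum_i \sum_j nc (M i j)) => _ [x /= x1 <-].
  apply: le_trans (l2norm_le_sum _) _; apply: ler_sum => i _; rewrite mxE.
  apply: le_trans (nc_sum _ _ _) _; apply: ler_sum => j _.
  rewrite ncM ler_piMr ?nc_ge0 //.
  exact: le_trans (entry_le_l2norm _ _) x1.
have S_le y : S y -> y <= c.
  by move=> Sy; apply: le_trans Mc; exact: sup_upper_bound.
split=> [|x]; first exact: S_le.
have [x0|xn0] := eqVneq (l2norm x) 0.
  by rewrite (l2norm_eq0 x0) mulmx0 !l2norm0 mulr0.
have xp : 0 < l2norm x by rewrite lt_def xn0 l2norm_ge0.
have /S_le : S ((l2norm x)^-1 * l2norm (M *m x)).
  exists (((l2norm x)^-1)%:C%C *: x) => /=.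
    rewrite l2normZ nc_real ger0_norm ?invr_ge0 ?(ltW xp) //; by rewrite mulVf.
  by rewrite -scalemxAr l2normZ nc_real ger0_norm ?invr_ge0 ?(ltW xp).
by rewrite mulrC ler_pdivrMr.
Qed.

Lemma bndW n (M : 'M[C]_n) c c' : c <= c' -> bnd M c -> bnd M c'.
Proof.
move=> cc' [c0 h]; split=> [|x]; first exact: le_trans cc'.
by apply: le_trans (h x) _; rewrite ler_wpM2r ?l2norm_ge0.
Qed.

Lemma bnd1 n : bnd (1%:M : 'M[C]_n) 1.
Proof. by split=> // x; rewrite mul1mx mul1r. Qed.

Lemma bndM n (M M' : 'M[C]_n) c c' :
  bnd M c -> bnd M' c' -> bnd (M *m M') (c * c').
Proof.
move=> [c0 h] [c0' h']; split=> [|x]; first exact: mulr_ge0.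
rewrite -mulmxA -mulrA; apply: le_trans (h _) _.
by rewrite ler_wpM2l.
Qed.

Lemma bndD n (M M' : 'M[C]_n) c c' :
  bnd M c -> bnd M' c' -> bnd (M + M') (c + c').
Proof.
move=> [c0 h] [c0' h']; split=> [|x]; first exact: addr_ge0.
rewrite mulmxDl mulrDl; apply: le_trans (l2normD _ _) _; exact: lerD.
Qed.

Lemma bndZ n (M : 'M[C]_n) a c : bnd M c -> bnd (a *: M) (nc a * c).
Proof.
move=> [c0 h]; split=> [|x]; first by rewrite mulr_ge0 ?nc_ge0.
by rewrite -scalemxAl l2normZ -mulrA ler_wpM2l ?nc_ge0.
Qed.

Lemma bndN n (M : 'M[C]_n) c : bnd M c -> bnd (- M) c.
Proof. by move=> /(bndZ (-1)); rewrite ncN nc1 mul1r scaleN1r. Qed.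

Lemma trmxC_mul m n p (M : 'M[C]_(m, n)) (M' : 'M[C]_(n, p)) :
  (M *m M')^t* = M'^t* *m M^t*.
Proof. by rewrite trmx_mul map_mxM. Qed.

(** With [y = M^* x], Cauchy-Schwarz bounds [|y|^2 = <x, M y>] by
[c |x| |y|]. *)
Lemma bnd_adj n (M : 'M[C]_n) c : bnd M c -> bnd (M^t*) c.
Proof.
move=> [c0 h]; split=> // x; set y := _ *m x.
have [->|y0] := eqVneq (l2norm y) 0; first by rewrite mulr_ge0 ?l2norm_ge0.
have yp : 0 < l2norm y by rewrite lt_def y0 l2norm_ge0.
rewrite -(ler_pM2l yp) -expr2.
have -> : l2norm y ^+ 2 = nc ((x^t* *m (M *m y)) 0 0).
  rewrite mulmxA -[x^t* *m M]trmxCK trmxC_mul trmxCK l2norm_sqrC nc_real.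
  by rewrite ger0_norm ?sqr_ge0.
apply: le_trans (dot_le _ _) _.
rewrite (_ : _ * (c * _) = l2norm x * (c * l2norm y)); last by ring.
by rewrite ler_wpM2l ?l2norm_ge0.
Qed.

Lemma unitary_adj_mul n (U : 'M[C]_n) : U \is unitarymx -> U^t* *m U = 1%:M.
Proof. by rewrite -trmxC_unitary => /unitarymxP; rewrite trmxCK. Qed.

Lemma bnd_unitary n (V : 'M[C]_n) : V \is unitarymx -> bnd V 1.
Proof.
move=> hV; split=> // x; rewrite mul1r.
rewrite -ler_sqr ?nnegrE ?l2norm_ge0 // -lecR -!l2norm_sqrC trmxC_mul.
rewrite -[x^t* *m _ *m _]mulmxA (mulmxA (V^t*)).
by rewrite unitary_adj_mul // mul1mx.
Qed.

Lemma nc_entry n (M : 'M[C]_n) c i j : bnd M c -> nc (M i j) <= c.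
Proof.
move=> [c0 h]; have := entry_le_l2norm (M *m delta_mx j 0) i.
have -> : (M *m (delta_mx j 0 : 'cV[C]_n)) i 0 = M i j.
  rewrite mxE (bigD1 j) //= big1 ?addr0 => [|k kj].
    by rewrite mxE !eqxx mulr1.
  by rewrite mxE (negPf kj) mulr0.
move=> /le_trans; apply; apply: le_trans (h _) _.
rewrite /l2norm (bigD1 j) //= big1 ?addr0 => [|k kj].
  by rewrite mxE !eqxx nc1 expr1n sqrtr1 mulr1.
by rewrite mxE (negPf kj) nc0 expr0n.
Qed.

Lemma nc_tr n (M : 'M[C]_n) c : bnd M c -> nc (\tr M) <= n%:R * c.
Proof.
move=> hM; apply: le_trans (nc_sum _ _ _) _.
apply: (@le_trans _ _ (\sum_(i < n) c)); last first.
  by rewrite sumr_const card_ord mulr_natl.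
by apply: ler_sum => i _; exact: nc_entry.
Qed.

Lemma nc_form n (M : 'M[C]_n) c (x y : 'cV[C]_n) :
  bnd M c -> nc ((x^t* *m M *m y) 0 0) <= c * (l2norm x * l2norm y).
Proof.
move=> [c0 h]; rewrite -mulmxA; apply: le_trans (dot_le _ _) _.
by rewrite mulrCA ler_wpM2l ?l2norm_ge0.
Qed.

Lemma tr_rank1 n (M : 'M[C]_n) (x y : 'cV[C]_n) :
  \tr (x *m y^t* *m M) = (y^t* *m M *m x) 0 0.
Proof. by rewrite -mulmxA mxtrace_mulC [\tr _]big_ord1. Qed.

Lemma bnd_rank1 n (x y : 'cV[C]_n) :
  bnd (x *m y^t*) (l2norm x * l2norm y).
Proof.
split=> [|z]; first by rewrite mulr_ge0 ?l2norm_ge0.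
rewrite -mulmxA [_ *m z]mx11_scalar mul_mx_scalar l2normZ -mulrA mulrC.
by apply: ler_wpM2l; [exact: l2norm_ge0 | exact: dot_le].
Qed.

End Bounds.

(** * The free algebra and its functionals *)

Section MalgScale.
Context {K : monomType} {F : comNzRingType}.
Implicit Types (c : F) (p q : {malg F[K]}).

Lemma malg_scaler c p q : p * (c *: q) = c *: (p * q).
Proof.
apply/malgP => k; rewrite mcoeffZ.
rewrite (mcoeffMlw k (finmap.fsubset_refl (msupp p)) (msuppZ_le c q)).
rewrite mcoeffMl mulr_sumr.
apply: eq_bigr => m _; rewrite mulr_sumr; apply: eq_bigr => m' _.
by rewrite mcoeffZ mulrCA mulrnAr.
Qed.

End MalgScale.

(** Locked, so that two products of words are never compared by unfolding the
convolution product of the monoid algebra. *)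
HB.lock Definition mono (R : realType) (L : choiceType) (w : seq L) : ncpoly R L :=
  mkmalgU (FMonom w) 1.

Arguments mono.body {R L} w.

Section FreeAlgebra.
Context {R : realType}.
Local Notation C := R[i].

Section Monomials.
Context {L : choiceType}.
Implicit Types (u w : seq L) (p q : ncpoly R L) (c : C).

Lemma mono0 : mono [::] = 1 :> ncpoly R L.
Proof. by rewrite mono.unlock -fmoneE. Qed.

Lemma mono_cat u w : mono (u ++ w) = mono u * mono w :> ncpoly R L.
Proof.
rewrite mono.unlock [RHS]fgmulUU mulr1; congr mkmalgU.
by apply/eqP; rewrite fmP fmM.
Qed.

Lemma ncvarE (k : L) : ncvar R k = mono [:: k].
Proof. by rewrite mono.unlock /ncvar fmuE. Qed.

Lemma mono_prod w : \prod_(k <- w) ncvar R k = mono w :> ncpoly R L.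
Proof.
elim: w => [|k w IH]; first by rewrite big_nil mono0.
by rewrite big_cons IH ncvarE -mono_cat.
Qed.

Lemma ncpoly_ind (P : ncpoly R L -> Prop) :
  P 0 -> (forall c w p, P p -> P (c *: mono w + p)) -> forall p, P p.
Proof.
move=> P0 PS p; rewrite (monalgE p).
elim/big_rec : _ => // m q _ Pq.
suff -> : mkmalgU m p@_m = p@_m *: mono m by exact: PS.
apply/malgP => k; rewrite mono.unlock mcoeffZ !mcoeffU fmK.
by rewrite mulrnAr mulr1.
Qed.

Lemma ncpoly_scalel c p q : (c *: p) * q = c *: (p * q).
Proof. exact: esym (scalerAl c p q). Qed.

Lemma ncpoly_scaler c p q : p * (c *: q) = c *: (p * q).
Proof. exact: malg_scaler. Qed.

Lemma ncpoly_central c (k : L) : ncvar R k * c%:A = c *: ncvar R k.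
Proof. by rewrite ncpoly_scaler mulr1. Qed.

End Monomials.

Section Evaluation.
Context (L : choiceType) (S : lalgType C) (f : L -> S).
Implicit Types (p q : ncpoly R L).

Lemma nceval_is_linear : linear (nceval f).
Proof.
move=> a p q; rewrite /nceval.
have -> : (fun c : C => c%:A) = GRing.in_alg S by [].
rewrite mmapD; congr (_ + _).
rewrite (mmapEw (msuppZ_le _ _)) mmapE scaler_sumr.
by apply: eq_bigr => k _; rewrite mcoeffZ /= scalerAl scalerA.
Qed.

Lemma nceval_mono w : nceval f (mono w) = \prod_(k <- w) f k.
Proof.
rewrite mono.unlock /nceval.
have -> : (fun c : C => c%:A) = GRing.in_alg S by [].
by rewrite mmapU /= scale1r mul1r.
Qed.

Lemma nceval0 : nceval f 0 = 0.
Proof.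
by have := nceval_is_linear (-1) 0 0; rewrite scaler0 addr0 scaleN1r addNr.
Qed.

Lemma ncevalD p q : nceval f (p + q) = nceval f p + nceval f q.
Proof. by have := nceval_is_linear 1 p q; rewrite !scale1r. Qed.

Lemma ncevalZ a p : nceval f (a *: p) = a *: nceval f p.
Proof. by have := nceval_is_linear a p 0; rewrite !addr0 nceval0 addr0. Qed.

Lemma nceval1 : nceval f 1 = 1.
Proof. by rewrite -mono0 nceval_mono big_nil. Qed.

Lemma nceval_var k : nceval f (ncvar R k) = f k.
Proof. by rewrite ncvarE nceval_mono big_seq1. Qed.

(** The ring [S] need not be an algebra on both sides, hence this hypothesis:
scalars commute with the values of the letters. *)
Hypothesis central : forall (c : C) k, f k * c%:A = c *: f k.

Lemma ncevalM p q : nceval f (p * q) = nceval f p * nceval f q.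
Proof.
move: p ; apply: ncpoly_ind => [|c u p IH]; first by rewrite mul0r nceval0 mul0r.
rewrite mulrDl 2!ncevalD mulrDl; congr (_ + _); last exact: IH.
rewrite ncpoly_scalel.
rewrite [LHS]ncevalZ.
rewrite [in RHS]ncevalZ.
rewrite -[RHS]scalerAl.
congr (_ *: _) => {IH p}.
move: q ; apply: ncpoly_ind => [|d w q IH]; first by rewrite mulr0 nceval0 mulr0.
rewrite mulrDr ncpoly_scaler 2!ncevalD mulrDr; congr (_ + _); last exact: IH.
rewrite [LHS]ncevalZ [in RHS]ncevalZ.
rewrite -mono_cat 3!nceval_mono.
rewrite big_cat /=.
set x := \prod_(k <- u) f k; set y := \prod_(k <- w) f k.
have comm : x * d%:A = d%:A * x.
  rewrite /x; elim: u {x IH} => [|k u IHu]; first by rewrite big_nil mulr1 mul1r.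
  by rewrite big_cons -mulrA IHu mulrA central -scalerAl mulr_algl.
by rewrite -[X in _ = x * X]mulr_algl mulrA comm -mulrA mulr_algl.
Qed.

Lemma nceval_prod (I : Type) (s : seq I) (F : I -> ncpoly R L) :
  nceval f (\prod_(i <- s) F i) = \prod_(i <- s) nceval f (F i).
Proof.
elim: s => [|i s IH]; first by rewrite !big_nil nceval1.
by rewrite !big_cons ncevalM IH.
Qed.

End Evaluation.

Lemma nceval_comp (L M : choiceType) (S : lalgType C) (f : M -> S)
    (g : L -> M) (central : forall (c : C) k, f k * c%:A = c *: f k) p :
  nceval f (nceval (fun k => ncvar R (g k)) p) = nceval (f \o g) p.
Proof.
move: p ; apply: ncpoly_ind => [|c w p IH]; first by rewrite !nceval0.
rewrite [nceval _ (c *: mono w + p)]nceval_is_linear.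
rewrite [LHS]nceval_is_linear [RHS]nceval_is_linear.
congr (_ *: _ + _); last exact: IH.
rewrite (nceval_mono (fun k => ncvar R (g k))) [RHS]nceval_mono nceval_prod //.
by apply: eq_bigr => k _; rewrite nceval_var.
Qed.

Lemma mx_central n (c : C) (M : 'M[C]_n.+1) : M * c%:A = c *: M.
Proof. by rewrite mulr_algr. Qed.

End FreeAlgebra.

Section ScalarTheory.
Context {R : realType} (L : choiceType) (f : ncpoly R L -> R[i]).
Hypothesis fl : scalar f.
Lemma scal0 : f 0 = 0.
Proof. by have := fl (-1) 0 0; rewrite scaler0 addr0 mulN1r addNr. Qed.
Lemma scalD p q : f (p + q) = f p + f q.
Proof. by have := fl 1 p q; rewrite scale1r mul1r. Qed.
Lemma scalZ a p : f (a *: p) = a * f p.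
Proof. by have := fl a p 0; rewrite !addr0 scal0 addr0. Qed.
Lemma scalN p : f (- p) = - f p.
Proof. by rewrite -scaleN1r scalZ mulN1r. Qed.
Lemma scalB p q : f (p - q) = f p - f q.
Proof. by rewrite scalD scalN. Qed.
End ScalarTheory.

Section LinearExtension.
Context {R : realType} {L : choiceType}.
Local Notation C := R[i].
Local Notation NC := (ncpoly R L).

Definition lin_ext (f : seq L -> C) (p : NC) : C :=
  mmap idfun (fun m : {fmonom L} => f m) p.

Lemma lin_ext_scalar f : scalar (lin_ext f).
Proof.
move=> a p q; rewrite /lin_ext mmapD; congr (_ + _).
rewrite (mmapEw (msuppZ_le _ _)) mmapE mulr_sumr.
by apply: eq_bigr => k _; rewrite mcoeffZ /= mulrA.
Qed.

Lemma lin_ext_mono f w : lin_ext f (mono w) = f w.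
Proof. by rewrite mono.unlock /lin_ext mmapU /= mul1r. Qed.

Lemma lin_ext_mulmono f u p :
  lin_ext f (mono u * p) = lin_ext (fun w => f (u ++ w)) p.
Proof.
move: p ; apply: ncpoly_ind => [|c w p IH].
  by rewrite mulr0 !(scal0 (lin_ext_scalar _)).
rewrite mulrDr !(scalD (lin_ext_scalar _)); congr (_ + _); last exact: IH.
rewrite ncpoly_scaler -mono_cat.
by rewrite !(scalZ (lin_ext_scalar _)) !lin_ext_mono.
Qed.

(** Degree less than [d], stated by duality: a functional takes on [p] a value
that only depends on its values on the words of length less than [d]. This is
what makes a recursion on the length of words well founded. *)
Definition deg_lt (d : nat) (p : NC) : Prop :=
  forall f g : seq L -> C, (forall w, (size w < d)%N -> f w = g w) ->
  lin_ext f p = lin_ext g p.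

Lemma deg_ltD d p q : deg_lt d p -> deg_lt d q -> deg_lt d (p + q).
Proof.
move=> hp hq f g fg; rewrite !(scalD (lin_ext_scalar _)).
by rewrite (hp _ _ fg) (hq _ _ fg).
Qed.

Lemma deg_ltZ d a p : deg_lt d p -> deg_lt d (a *: p).
Proof.
by move=> hp f g fg; rewrite !(scalZ (lin_ext_scalar _)) (hp _ _ fg).
Qed.

Lemma deg_lt_mono d w : (size w < d)%N -> deg_lt d (mono w).
Proof. by move=> wd f g fg; rewrite !lin_ext_mono fg. Qed.

Lemma deg_lt_mulmono d u p : deg_lt d p -> deg_lt (size u + d) (mono u * p).
Proof.
move=> hp f g fg; rewrite !lin_ext_mulmono; apply: hp => w wd.
by apply: fg; rewrite size_cat ltn_add2l.
Qed.

Lemma deg_ltW d d' p : (d <= d')%N -> deg_lt d p -> deg_lt d' p.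
Proof. by move=> dd' h f g fg; apply: h => w /leq_trans/(_ dd'); exact: fg. Qed.

End LinearExtension.

(** * Existence of free and conditionally free products *)

(** Every word in the letters of the two factors is uniquely an alternating
product of nonempty words of single factors, its blocks. *)
Section Blocks.
Context {K : Type}.
Local Notation block := (seq K + seq K)%type.

Definition block_word (b : block) : seq (K + K)%type :=
  match b with inl u => map inl u | inr u => map inr u end.

Definition block_cons (z : K + K) (bs : seq block) : seq block :=
  match z, bs with
  | inl k, inl u :: bs' => inl (k :: u) :: bs'
  | inr k, inr u :: bs' => inr (k :: u) :: bs'
  | inl k, _ => inl [:: k] :: bs
  | inr k, _ => inr [:: k] :: bs
  end.

Definition blocks (w : seq (K + K)) : seq block := foldr block_cons [::] w.

Definition block_proper (b : block) : bool := (0 < size (block_word b))%N.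

Lemma blocksK (bs : seq block) : all block_proper bs ->
  sorted (fun a b => is_inl a != is_inl b) bs ->
  blocks (flatten (map block_word bs)) = bs.
Proof.
elim: bs => [//|b bs IH] /= /andP[pb pbs] alt.
have {}IH := IH pbs (path_sorted alt).
rewrite /blocks foldr_cat -/(blocks _) IH {IH pbs}.
case: b pb alt => [] [//|k u] _ alt /=.
- have base k' : block_cons (inl k') bs = inl [:: k'] :: bs.
    by case: bs alt => [|[b|b] bs].
  by elim: u k {alt} => [|k' u IH] k; [exact: base | rewrite /= IH].
- have base k' : block_cons (inr k') bs = inr [:: k'] :: bs.
    by case: bs alt => [|[b|b] bs].
  by elim: u k {alt} => [|k' u IH] k; [exact: base | rewrite /= IH].
Qed.

Lemma block_consK z bs :
  flatten (map block_word (block_cons z bs)) = z :: flatten (map block_word bs).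
Proof. by case: z bs => k [|[u|u] bs]. Qed.

Lemma flatten_blocks w : flatten (map block_word (blocks w)) = w.
Proof. by elim: w => // z w IH; rewrite /= block_consK IH. Qed.

Lemma blocks_proper w : all block_proper (blocks w).
Proof.
elim: w => // z w /=; case: (blocks w) => [|[u|u] bs] /=; case: z => k //=.
by move=> /andP[_ ->].
by move=> /andP[_ ->].
Qed.

End Blocks.

(** The induction step of [block_center_deg]: replacing the last factors [m] by
[q] and centering the first factor [u] only costs terms in which [u] is
multiplied by [m - q] or has disappeared. *)
Lemma mul_center (R : realType) (S : lalgType R[i]) (u m q : S) (c : R[i]) :
  u * m - (u - c%:A) * q = u * (m - q) + (c *: m + (- c) *: (m - q)).
Proof.
rewrite mulrBl mulr_algl mulrBr scaleNr scalerBr !opprB.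
by rewrite (addrC (c *: m)) subrK -addrA (addrC (c *: q)).
Qed.

Section Existence.
Context {R : realType} {K : choiceType}.
Local Notation C := R[i].
Local Notation NC := (ncpoly R K).
Local Notation NC2 := (ncpoly R (K + K)%type).

Definition on_factors (T : Type) (f1 f2 : NC -> T) (a : NC + NC) : T :=
  match a with inl p => f1 p | inr q => f2 q end.

Definition block_val (b : seq K + seq K) : NC + NC :=
  match b with inl u => inl (mono u) | inr u => inr (mono u) end.

Lemma factor_block_val b :
  factor_val (block_val b) = mono (block_word b) :> NC2.
Proof.
by case: b => u; rewrite /= /embX /embY nceval_mono -mono_prod big_map.
Qed.

Variables psi1 psi2 phi1 phi2 : NC -> C.
Hypotheses (psi1l : scalar psi1) (psi2l : scalar psi2).
Hypotheses (phi1l : scalar phi1) (phi2l : scalar phi2).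
Hypotheses (psi11 : psi1 1 = 1) (psi21 : psi2 1 = 1).
Hypotheses (phi11 : phi1 1 = 1) (phi21 : phi2 1 = 1).
Local Notation psi := (on_factors psi1 psi2).
Local Notation phi := (on_factors phi1 phi2).

Definition center (a : NC + NC) : NC2 := factor_val a - (psi a)%:A.

Definition block_center (w : seq (K + K)) : NC2 :=
  \prod_(b <- blocks w) center (block_val b).

Definition block_target (w : seq (K + K)) : C :=
  \prod_(b <- blocks w) (phi (block_val b) - psi (block_val b)).

(** The word [w] and the product of its centered blocks have the same leading
term; a functional is therefore determined, word by word, by its values on the
products of centered blocks. *)
Lemma block_center_deg w : deg_lt (size w) (mono w - block_center w).
Proof.
rewrite /block_center -{1 2}(flatten_blocks w).
elim: (blocks w) (blocks_proper w) => [|b bs IH] /= => [_|/andP[pb pbs]].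
  by rewrite big_nil mono0 subrr => f g _; rewrite !(scal0 (lin_ext_scalar _)).
rewrite big_cons mono_cat {1}/center factor_block_val.
set u := mono (block_word b); set c := psi _.
set Q := \prod_(j <- bs) _; set W := flatten _ in IH *.
have {}IH : deg_lt (size W) (mono W - Q) by exact: IH.
have -> : u * mono W - (u - c%:A) * Q =
    u * (mono W - Q) + (c *: mono W + (- c) *: (mono W - Q)).
  exact: mul_center.
rewrite size_cat; apply: deg_ltD; first exact: deg_lt_mulmono.
apply: deg_ltD; apply: deg_ltZ.
  by apply: deg_lt_mono; rewrite -[ltnLHS]add0n ltn_add2r.
by apply: deg_ltW IH; rewrite leq_addl.
Qed.

(** The functional with the prescribed values [block_target] on products of
centered blocks, computed on words of length less than [n]. With [phi = psi]
all these values vanish except the one on the empty word, which gives the free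
product. *)
Fixpoint cfree_rec (n : nat) (w : seq (K + K)) : C :=
  if n is n'.+1 then
    block_target w + lin_ext (cfree_rec n') (mono w - block_center w)
  else 0.

Lemma cfree_recS n w : (size w < n)%N -> cfree_rec n.+1 w = cfree_rec n w.
Proof.
elim: n w => [//|n IH] w wn; rewrite [LHS]/= [RHS]/=; congr (_ + _).
apply: block_center_deg => w' w'w; apply: IH.
exact: leq_trans w'w _.
Qed.

Definition cfree_word w := cfree_rec (size w).+1 w.

Lemma cfree_recE n w : (size w < n)%N -> cfree_rec n w = cfree_word w.
Proof.
elim: n => // n IH; rewrite ltnS leq_eqVlt => /orP[/eqP <-//|wn].
by rewrite cfree_recS // IH.
Qed.

Definition cfree_fun : NC2 -> C := lin_ext cfree_word.

Lemma cfree_fun_scalar : scalar cfree_fun.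
Proof. exact: lin_ext_scalar. Qed.

Lemma cfree_fun_blocks w : cfree_fun (block_center w) = block_target w.
Proof.
have /eqP := erefl (cfree_word w); rewrite {1}/cfree_word /=.
have -> : lin_ext (cfree_rec (size w)) (mono w - block_center w) =
    cfree_fun (mono w - block_center w).
  by apply: block_center_deg => w' h; rewrite cfree_recE.
rewrite (scalB cfree_fun_scalar) {1}/cfree_fun lin_ext_mono.
by rewrite addrCA -subr_eq0 addrAC subrr add0r subr_eq0 => /eqP.
Qed.

Lemma center_inl0 : center (inl 0) = 0.
Proof. by rewrite /center /= /embX nceval0 (scal0 psi1l) scale0r subrr. Qed.
Lemma center_inr0 : center (inr 0) = 0.
Proof. by rewrite /center /= /embY nceval0 (scal0 psi2l) scale0r subrr. Qed.

Lemma center_inlS c p q :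
  center (inl (c *: p + q)) = c *: center (inl p) + center (inl q).
Proof.
rewrite /center /= /embX ncevalD ncevalZ psi1l scalerDl -scalerA scalerBr.
by rewrite opprD addrACA.
Qed.

Lemma center_inrS c p q :
  center (inr (c *: p + q)) = c *: center (inr p) + center (inr q).
Proof.
rewrite /center /= /embY ncevalD ncevalZ psi2l scalerDl -scalerA scalerBr.
by rewrite opprD addrACA.
Qed.

(** The prescribed values on centered blocks extend to centered alternating
products of arbitrary elements by multilinearity: the factors of [s] are
replaced one at a time by combinations of words. The empty word does not occur
as a block, but its centering vanishes, as does [phi 1 - psi 1]. *)
Lemma cfree_fun_centered s :
  sorted (fun a b : NC + NC => is_inl a != is_inl b) s ->
  cfree_fun (\prod_(a <- s) center a) = \prod_(a <- s) (phi a - psi a).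
Proof.
move=> alt.
(* bs : the factors that are already words *)
suff H (bs : seq (seq K + seq K)) : all block_proper bs ->
    sorted (fun a b => a != b) (map is_inl bs ++ map is_inl s) ->
    cfree_fun ((\prod_(b <- bs) center (block_val b)) * \prod_(a <- s) center a)
    = (\prod_(b <- bs) (phi (block_val b) - psi (block_val b))) *
      \prod_(a <- s) (phi a - psi a).
  have := H [::] isT; rewrite !big_nil !mul1r; apply.
  by rewrite /= sorted_map.
elim: s bs {alt} => [|a s IH] bs pbs.
  rewrite cats0 sorted_map !big_nil !mulr1 => alt.
  have := cfree_fun_blocks (flatten (map block_word bs)).
  by rewrite /block_center /block_target blocksK.
rewrite !big_cons /= -cat_rcons.
set A := \prod_(b <- bs) _; set S := \prod_(b <- s) _.
set A' := \prod_(b <- bs) _; set S' := \prod_(b <- s) _ => alt.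
have step b : is_inl b = is_inl a -> block_proper b ->
    cfree_fun (A * (center (block_val b) * S)) =
    A' * ((phi (block_val b) - psi (block_val b)) * S').
  move=> ba pb; have := IH (rcons bs b); rewrite all_rcons pb pbs map_rcons ba.
  by move=> /(_ isT alt); rewrite -cats1 !big_cat !big_seq1 !mulrA.
case: a alt step => p alt step.
- have {}step b : is_inl b = true -> block_proper b ->
    cfree_fun (A * (center (block_val b) * S)) =
    A' * ((phi (block_val b) - psi (block_val b)) * S') := step b.
  move: p {alt}; apply: ncpoly_ind => [|c w p IHp].
    rewrite center_inl0 mul0r mulr0 (scal0 cfree_fun_scalar).
    by rewrite /= (scal0 psi1l) (scal0 phi1l) subrr mul0r mulr0.
  rewrite center_inlS mulrDl mulrDr (scalD cfree_fun_scalar).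
  rewrite [X in _ + X]IHp ncpoly_scalel ncpoly_scaler.
  rewrite [X in X + _](scalZ cfree_fun_scalar) /= psi1l phi1l.
  case: w => [|k w].
    rewrite mono0 psi11 phi11.
    have -> : center (inl 1) = 0.
      by rewrite /center /= psi11 scale1r /embX nceval1 subrr.
    rewrite mul0r mulr0 (scal0 cfree_fun_scalar); ring.
  by have := step (inl (k :: w)) erefl isT => /= ->; ring.
- have {}step b : is_inl b = false -> block_proper b ->
    cfree_fun (A * (center (block_val b) * S)) =
    A' * ((phi (block_val b) - psi (block_val b)) * S') := step b.
  move: p {alt}; apply: ncpoly_ind => [|c w p IHp].
    rewrite center_inr0 mul0r mulr0 (scal0 cfree_fun_scalar).
    by rewrite /= (scal0 psi2l) (scal0 phi2l) subrr mul0r mulr0.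
  rewrite center_inrS mulrDl mulrDr (scalD cfree_fun_scalar).
  rewrite [X in _ + X]IHp ncpoly_scalel ncpoly_scaler.
  rewrite [X in X + _](scalZ cfree_fun_scalar) /= psi2l phi2l.
  case: w => [|k w].
    rewrite mono0 psi21 phi21.
    have -> : center (inr 1) = 0.
      by rewrite /center /= psi21 scale1r /embY nceval1 subrr.
    rewrite mul0r mulr0 (scal0 cfree_fun_scalar); ring.
  by have := step (inr (k :: w)) erefl isT => /= ->; ring.
Qed.

Lemma cfree_fun1 : cfree_fun 1 = 1.
Proof. by have := @cfree_fun_centered [::] isT; rewrite !big_nil. Qed.

Lemma cfree_fun_factor a : cfree_fun (factor_val a) = phi a.
Proof.
have := @cfree_fun_centered [:: a] isT; rewrite !big_seq1 /center.
rewrite (scalB cfree_fun_scalar) (scalZ cfree_fun_scalar) cfree_fun1 mulr1.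
exact: addIr.
Qed.

End Existence.

Section ExistenceTheorems.
Context {R : realType} {K : choiceType}.
Local Notation C := R[i].
Local Notation NC := (ncpoly R K).
Variables psi1 psi2 phi1 phi2 : NC -> C.
Hypotheses (psi1l : scalar psi1) (psi2l : scalar psi2).
Hypotheses (phi1l : scalar phi1) (phi2l : scalar phi2).
Hypotheses (psi11 : psi1 1 = 1) (psi21 : psi2 1 = 1).
Hypotheses (phi11 : phi1 1 = 1) (phi21 : phi2 1 = 1).

Lemma free_productP :
  is_free_product psi1 psi2 (free_product psi1 psi2).
Proof.
apply: (@xgetPex _ _ [set psi | is_free_product psi1 psi2 psi]).
have H := cfree_fun_factor psi1l psi2l psi1l psi2l psi11 psi21 psi11 psi21.
exists (cfree_fun psi1 psi2 psi1 psi2); split.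
- exact: cfree_fun_scalar.
- by move=> p; exact: (H (inl p)).
- by move=> p; exact: (H (inr p)).
- case=> // a s /andP[_ alt] cent.
  have := cfree_fun_centered psi1l psi2l psi1l psi2l psi11 psi21 psi11 psi21 alt.
  rewrite [RHS]big_cons subrr mul0r => <-; congr (cfree_fun _ _ _ _ _).
  rewrite /factor_prod !big_seq; apply: eq_bigr => b /cent.
  by rewrite H /center => ->; rewrite scale0r subr0.
Qed.

Lemma cfree_productP :
  is_cfree_product psi1 psi2 phi1 phi2 (cfree_product psi1 psi2 phi1 phi2).
Proof.
apply: (@xgetPex _ _ [set phi | is_cfree_product psi1 psi2 phi1 phi2 phi]).
have H := cfree_fun_factor psi1l psi2l phi1l phi2l psi11 psi21 phi11 phi21.
have [_ fX fY _] := free_productP.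
exists (cfree_fun psi1 psi2 phi1 phi2); split.
- exact: cfree_fun_scalar.
- by move=> p; exact: (H (inl p)).
- by move=> p; exact: (H (inr p)).
- move=> s /andP[_ alt] cent.
  have := cfree_fun_centered psi1l psi2l phi1l phi2l psi11 psi21 phi11 phi21 alt.
  have psi0 a : a \in s -> on_factors psi1 psi2 a = 0.
    by case: a => p /cent <-; symmetry; [exact: fX | exact: fY].
  rewrite /factor_prod [in X in X -> _]big_seq [in X in _ = X -> _]big_seq.
  rewrite [in X in _ -> X]big_seq [in X in _ -> _ = X]big_seq.
  under eq_bigr => a sa do rewrite /center psi0 // scale0r subr0.
  move=> ->; apply: eq_bigr => a sa.
  by rewrite H psi0 // subr0.
Qed.

End ExistenceTheorems.

(** * Haar measure on the stabilizer of a vector as an invariant mean *)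

Section Borel.
Context {R : realType} {n : nat}.
Local Notation C := R[i].
Local Notation M := 'M[C]_n.

Definition cmx := M.
HB.instance Definition _ := Choice.on cmx.
HB.instance Definition _ := isPointed.Build cmx 0.

Definition mx_gen : set (set cmx) :=
  [set E | exists (i j : 'I_n) (S : set R), measurable S /\
         (E = [set M : 'M[C]_n | S (complex.Re (M i j))] \/
          E = [set M : 'M[C]_n | S (complex.Im (M i j))])].

(** The matrices with the sigma-algebra of [mx_borel], as a type to which the
theory of measurable functions applies. *)
Definition bmx := g_sigma_algebraType mx_gen.

Definition borel (f : M -> C) : Prop :=
  measurable_fun [set: bmx] (fun U : bmx => complex.Re (f U)) /\
  measurable_fun [set: bmx] (fun U : bmx => complex.Im (f U)).

Lemma borel_cst c : borel (fun=> c).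
Proof. by split; exact: measurable_cst. Qed.

Lemma borel_entry i j : borel (fun U => U i j).
Proof.
by split=> _ S mS; rewrite setTI; apply: sub_sigma_algebra; exists i, j, S;
  split=> //; [left | right].
Qed.

Lemma borelD f g : borel f -> borel g -> borel (fun U => f U + g U).
Proof.
move=> [fr fi] [gr gi]; split.
- under [X in measurable_fun _ X]eq_fun do rewrite raddfD.
  exact: measurable_funD.
- under [X in measurable_fun _ X]eq_fun do rewrite raddfD.
  exact: measurable_funD.
Qed.

Lemma complex_ReM (x y : C) : complex.Re (x * y) =
  complex.Re x * complex.Re y - complex.Im x * complex.Im y.
Proof. by case: x y => a b [c d]. Qed.

Lemma complex_ImM (x y : C) : complex.Im (x * y) =
  complex.Re x * complex.Im y + complex.Im x * complex.Re y.
Proof. by case: x y => a b [c d]. Qed.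

Lemma borelM f g : borel f -> borel g -> borel (fun U => f U * g U).
Proof.
move=> [fr fi] [gr gi]; split.
- under [X in measurable_fun _ X]eq_fun do rewrite complex_ReM.
  by apply: measurable_funB; exact: measurable_funM.
- under [X in measurable_fun _ X]eq_fun do rewrite complex_ImM.
  by apply: measurable_funD; exact: measurable_funM.
Qed.

Lemma borel_conj f : borel f -> borel (fun U => Num.conj (f U)).
Proof.
move=> [fr fi]; split.
- rewrite (_ : (fun _ => _) = (fun U : bmx => complex.Re (f U))) //.
  by apply/funext => U; case: (f U).
- rewrite (_ : (fun _ => _) = (fun U : bmx => - complex.Im (f U))) //.
    exact: measurable_funN.
  by apply/funext => U; case: (f U).
Qed.

(** Admissible functions: bounded and Borel. The bound is only required on
unitary matrices, as the entries of a matrix are unbounded elsewhere. *)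
Definition adm (f : M -> C) : Prop :=
  borel f /\ exists K, forall U, U \is unitarymx -> nc (f U) <= K.

Lemma adm_cst c : adm (fun=> c).
Proof. by split; [exact: borel_cst | exists (nc c)]. Qed.

Lemma adm_entry i j : adm (fun U => U i j).
Proof.
split; first exact: borel_entry.
by exists 1 => U hU; apply: nc_entry; exact: bnd_unitary.
Qed.

Lemma admD f g : adm f -> adm g -> adm (fun U => f U + g U).
Proof.
move=> [bf [K hf]] [bg [K' hg]]; split; first exact: borelD.
exists (K + K') => U hU; apply: le_trans (ncD _ _) _.
by apply: lerD; [exact: hf | exact: hg].
Qed.

Lemma admM f g : adm f -> adm g -> adm (fun U => f U * g U).
Proof.
move=> [bf [K hf]] [bg [K' hg]]; split; first exact: borelM.
exists (K * K') => U hU; rewrite ncM.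
by apply: ler_pM; rewrite ?nc_ge0 //; [exact: hf | exact: hg].
Qed.

Lemma admZ c f : adm f -> adm (fun U => c * f U).
Proof. by move=> hf; apply: admM hf; exact: adm_cst. Qed.

Lemma admN f : adm f -> adm (fun U => - f U).
Proof.
by move=> /(admZ (-1)); under [X in adm X]eq_fun do rewrite mulN1r.
Qed.

Lemma admB f g : adm f -> adm g -> adm (fun U => f U - g U).
Proof. by move=> hf /admN; exact: admD. Qed.

Lemma adm_conj f : adm f -> adm (fun U => Num.conj (f U)).
Proof.
move=> [bf [K hf]]; split; first exact: borel_conj.
by exists K => U hU; rewrite nc_conj; exact: hf.
Qed.

Lemma adm_sum (I : Type) (s : seq I) (P : pred I) (F : I -> M -> C) :
  (forall i, adm (F i)) -> adm (fun U => \sum_(i <- s | P i) F i U).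
Proof.
move=> hF; elim: s => [|i s IH].
  under [X in adm X]eq_fun do rewrite big_nil.
  exact: adm_cst.
under [X in adm X]eq_fun do rewrite big_cons.
by case: (P i) => //; exact: admD.
Qed.

Definition madm (F : M -> M) : Prop := forall i j, adm (fun U => F U i j).

Lemma madm_cst A : madm (fun=> A).
Proof. by move=> i j; exact: adm_cst. Qed.

Lemma madm_id : madm id.
Proof. by move=> i j; exact: adm_entry. Qed.

Lemma madmM F G : madm F -> madm G -> madm (fun U => F U *m G U).
Proof.
move=> hF hG i j; under [X in adm X]eq_fun do rewrite mxE.
by apply: adm_sum => k; exact: admM.
Qed.

Lemma madmD F G : madm F -> madm G -> madm (fun U => F U + G U).
Proof.
move=> hF hG i j; under [X in adm X]eq_fun do rewrite mxE.
exact: admD.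
Qed.

Lemma madm_adj F : madm F -> madm (fun U => (F U)^t*).
Proof.
move=> hF i j; under [X in adm X]eq_fun do rewrite !mxE.
exact: adm_conj.
Qed.

Lemma adm_tr F : madm F -> adm (fun U => \tr (F U)).
Proof. by move=> hF; apply: adm_sum => i; exact: hF. Qed.

Definition radm (f : M -> R) : Prop :=
  measurable_fun [set: bmx] (f : bmx -> R) /\
  exists K, forall U, U \is unitarymx -> `|f U| <= K.

Lemma radm_cst c : radm (fun=> c).
Proof. by split; [exact: measurable_cst | exists `|c|]. Qed.

Lemma radmD f g : radm f -> radm g -> radm (fun U => f U + g U).
Proof.
move=> [bf [K hf]] [bg [K' hg]]; split; first exact: measurable_funD.
exists (K + K') => U hU; apply: le_trans (ler_normD _ _) _.
by apply: lerD; [exact: hf | exact: hg].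
Qed.

Lemma radmM f g : radm f -> radm g -> radm (fun U => f U * g U).
Proof.
move=> [bf [K hf]] [bg [K' hg]]; split; first exact: measurable_funM.
exists (K * K') => U hU; rewrite normrM.
by apply: ler_pM => //; [exact: hf | exact: hg].
Qed.

Lemma radmZ c f : radm f -> radm (fun U => c * f U).
Proof. by move=> hf; apply: radmM hf; exact: radm_cst. Qed.

Lemma radm_Re f : adm f -> radm (fun U => complex.Re (f U)).
Proof.
move=> [[fr _] [K hf]]; split=> //.
by exists K => U /hf; apply: le_trans; exact: nc_Re.
Qed.

Lemma radm_nc4 f : adm f -> radm (fun U => nc (f U) ^+ 4).
Proof.
move=> hf; rewrite (_ : (fun _ => _) =
    (fun U => complex.Re (Num.conj (f U) * f U * (Num.conj (f U) * f U)))).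
  by apply: radm_Re; do 2![apply: admM => //]; do ?[apply: admM => //];
     exact: adm_conj.
apply/funext => U; rewrite -nc_sqr -rmorphM /=.
by rewrite -exprD.
Qed.

Lemma radm_sum (I : Type) (s : seq I) (F : I -> M -> R) :
  (forall i, radm (F i)) -> radm (fun U => \sum_(i <- s) F i U).
Proof.
move=> hF; elim: s => [|i s IH].
  under [X in radm X]eq_fun do rewrite big_nil.
  exact: radm_cst.
under [X in radm X]eq_fun do rewrite big_cons.
exact: radmD.
Qed.

(** Unit mass, linearity, positivity and left invariance: all estimates are
derived from these properties of the integral against Haar measure. *)
Record haar_mean (v : 'cV[C]_n) (E : (M -> R) -> R) : Prop := HaarMean {
  mean_cst : forall c, E (fun=> c) = c;
  meanD : forall f g, radm f -> radm g -> E (fun U => f U + g U) = E f + E g;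
  meanZ : forall c f, radm f -> E (fun U => c * f U) = c * E f;
  mean_le : forall f g, radm f -> radm g ->
    (forall U, stabilizer v U -> f U <= g U) -> E f <= E g;
  mean_shift : forall V f, stabilizer v V -> radm f ->
    E (fun U => f (V *m U)) = E f }.

Lemma mx_shift_measurable (V : M) :
  measurable_fun [set: bmx] ((fun U => V *m U) : bmx -> bmx).
Proof.
apply: (@measurability _ _ bmx bmx setT (fun U => V *m U) mx_gen) => //.
move=> _ [_ [i [j [S [mS [->|->]]]]] <-].
- have /(_ i j)[[h _] _] : madm (fun U => V *m U).
    by apply: madmM; [exact: madm_cst | exact: madm_id].
  exact: h.
- have /(_ i j)[[_ h] _] : madm (fun U => V *m U).
    by apply: madmM; [exact: madm_cst | exact: madm_id].
  exact: h.
Qed.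

Lemma stabilizer1 v : stabilizer v (1%:M : M).
Proof.
split; last by rewrite mul1mx.
by apply/unitarymxP; rewrite mul1mx trmx1 map_mx1.
Qed.

End Borel.
Arguments cmx : clear implicits.
Arguments bmx : clear implicits.

Section HaarMean.
Context {R : realType} {n : nat} {d : measure_display} {T : measurableType d}.
Variables (Pr : probability T R) (v : 'cV[R[i]]_n) (U : T -> 'M[R[i]]_n).
Hypothesis hU : haar_distributed Pr (stabilizer v) U.

(** Off a null set the random matrix lies in the stabilizer; it is replaced by
the identity on that null set, so that the bounds hold everywhere. The law does
not change, hence neither does its invariance. *)
Lemma haar_modification : exists U' : T -> 'M[R[i]]_n,
  [/\ measurable_fun [set: T] (U' : T -> bmx R n),
      forall w, stabilizer v (U' w),
      {ae Pr, forall w, U' w = U w} &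
      forall V, stabilizer v V -> forall E : set (bmx R n), measurable E ->
        Pr [set w | E (V *m U' w)] = Pr [set w | E (U' w)]].
Proof.
have [mU [N [mN N0 GN]] inv] := hU.
have mU' : measurable_fun [set: T] (U : T -> bmx R n).
  by move=> _ E mE; rewrite setTI; exact: mU.
pose U' w := if w \in N then 1%:M else U w.
have mU'' : measurable_fun [set: T] (U' : T -> bmx R n).
  apply: measurable_fun_ifT => //.
  apply: (measurable_fun_bool true); rewrite setTI.
  rewrite [X in measurable X](_ : _ = N) //.
  by apply/seteqP; split=> w /= => [/set_mem|/mem_set].
have GU' w : stabilizer v (U' w).
  rewrite /U'; case: ifPn => [_|/negP wN]; first exact: stabilizer1.
  by apply: contrapT => nG; apply: wN; rewrite inE; exact: GN.
have U'U w : ~ N w -> U' w = U w.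
  by move=> nN; rewrite /U' memNset.
exists U'; split => //.
- exists N; split => // w /= nw; apply: contrapT => /U'U; exact: nw.
- have prE E : measurable (E : set (bmx R n)) ->
      Pr [set w | E (U' w)] = Pr [set w | E (U w)].
    move=> mE.
    have mA : measurable [set w | E (U' w)].
      by rewrite -[X in measurable X]setTI; exact: mU''.
    have mB : measurable [set w | E (U w)].
      by rewrite -[X in measurable X]setTI; exact: mU'.
    have N0' A : measurable A -> Pr A = Pr (A `\` N).
      move=> mC; rewrite (measureDI Pr mC mN) -[RHS]adde0; congr (_ + _)%E.
      by apply: (subset_measure0 _ mN) => //; exact: measurableI.
    rewrite N0' // [RHS]N0' //; congr (Pr _).
    by apply/seteqP; split=> w [/= hw nN]; split=> //=; move: hw;
       rewrite U'U.
  move=> V GV E mE.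
  have mVE : measurable ([set W | E (V *m W)] : set (bmx R n)).
    by rewrite -[X in measurable X]setTI; exact: mx_shift_measurable.
  by rewrite (prE _ mVE) (prE _ mE); exact: inv.
Qed.

Lemma haar_mean_exists : exists U' : T -> 'M[R[i]]_n,
  [/\ measurable_fun [set: T] (U' : T -> bmx R n),
      forall w, stabilizer v (U' w),
      {ae Pr, forall w, U' w = U w} &
      haar_mean v (fun f => \int[Pr]_w f (U' w))].
Proof.
have [U' [mU' GU' U'U inv]] := haar_modification.
have PrT : (Pr [set: T] < +oo)%E by rewrite probability_setT ltry.
have int f : radm f -> Pr.-integrable [set: T] (EFin \o (f \o U')).
  move=> [mf [K hK]]; apply: measurable_bounded_integrable => //.
    by apply: (measurableT_comp (f := (f : bmx R n -> R))).
  exists K; split; rewrite ?num_real // => k Kk w _ /=.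
  by apply: le_trans (ltW Kk); apply: hK; exact: (GU' w).1.
exists U'; split=> //; split.
- by move=> c; rewrite Rintegral_cst //= probability_setT mulr1.
- by move=> f g /int hf /int hg; rewrite -RintegralD.
- by move=> c f /int hf; rewrite -RintegralZl.
- move=> f g /int hf /int hg fg; apply: le_Rintegral => // w _.
  exact: fg.
- move=> V f GV rf.
  have [mf _] := rf.
  have mU'V : measurable_fun [set: T] ((fun w => V *m U' w) : T -> bmx R n).
    apply: (measurableT_comp (f := (fun W => V *m W) : bmx R n -> bmx R n)) => //.
    exact: mx_shift_measurable.
  have mEf : measurable_fun [set: bmx R n] (EFin \o (f : bmx R n -> R)).
    exact/measurable_EFinP.
  have intV : Pr.-integrable [set: T] (EFin \o f \o (fun w => V *m U' w)).
    apply: (int (fun W => f (V *m W))); split.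
      apply: (measurableT_comp (f := (f : bmx R n -> R))) => //.
      exact: mx_shift_measurable.
    have [_ [K hK]] := rf; exists K => W uW; apply: hK.
    exact: (mul_unitarymx GV.1 uW).
  rewrite /Rintegral; congr fine.
  have := @integral_pushforward _ _ _ (bmx R n) R _ mU'V Pr setT _ mEf intV
    measurableT.
  have := @integral_pushforward _ _ _ (bmx R n) R _ mU' Pr setT _ mEf (int _ rf)
    measurableT.
  rewrite !preimage_setT /= => <- <-.
  apply: eq_measure_integral => E mE _; exact: inv.
Qed.

End HaarMean.

(** * First order expansions along one-parameter families *)

Section Jets.
Context {R : realType} {n : nat}.
Local Notation C := R[i].
Local Notation M := 'M[C]_n.

(** [F t = f + t df + O(t^2)] for [t] in [[0, 1]], uniformly over the unitary
matrices. The uniform quadratic error is what allows the expansion to be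
integrated; it replaces differentiability and dominated convergence. *)
Definition jet (F : R -> M -> C) (f df : M -> C) : Prop :=
  [/\ forall t, adm (F t), adm f, adm df &
    exists K, 0 <= K /\ forall U t, U \is unitarymx -> 0 <= t <= 1 ->
      nc (F t U - f U - t%:C%C * df U) <= K * t ^+ 2].

Lemma adm_bound (f : M -> C) : adm f ->
  exists K, 0 <= K /\ forall U, U \is unitarymx -> nc (f U) <= K.
Proof.
move=> [_ [K hK]]; exists `|K|; split=> // U hU.
exact: le_trans (hK _ hU) (ler_norm _).
Qed.

Lemma jet_ext F F' f f' df df' : (forall t U, F t U = F' t U) ->
  f =1 f' -> df =1 df' -> jet F f df -> jet F' f' df'.
Proof.
move=> eF /funext -> /funext ->.
by have -> : F = F' by apply/funext => t; apply/funext => U.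
Qed.

Lemma jet_cst f : adm f -> jet (fun=> f) f (fun=> 0).
Proof.
move=> hf; split=> //; first exact: adm_cst.
by exists 0; split=> // U t _ _; rewrite subrr mulr0 subrr nc0 mul0r.
Qed.

Lemma jetD F f df G g dg : jet F f df -> jet G g dg ->
  jet (fun t U => F t U + G t U) (fun U => f U + g U) (fun U => df U + dg U).
Proof.
move=> [aF af adf [K [K0 hK]]] [aG ag adg [K' [K0' hK']]]; split.
- by move=> t; exact: admD.
- exact: admD.
- exact: admD.
exists (K + K'); split=> [|U t hU ht]; first exact: addr_ge0.
rewrite (_ : _ - _ = (F t U - f U - t%:C%C * df U) +
  (G t U - g U - t%:C%C * dg U)); last by ring.
rewrite mulrDl; apply: le_trans (ncD _ _) _.
by apply: lerD; [exact: hK | exact: hK'].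
Qed.

Lemma jetM F f df G g dg : jet F f df -> jet G g dg ->
  jet (fun t U => F t U * G t U) (fun U => f U * g U)
      (fun U => df U * g U + f U * dg U).
Proof.
move=> [aF af adf [K [K0 hK]]] [aG ag adg [K' [K0' hK']]]; split.
- by move=> t; exact: admM.
- exact: admM.
- by apply: admD; exact: admM.
have [a [a0 ha]] := adm_bound af; have [a' [a0' ha']] := adm_bound adf.
have [b [b0 hb]] := adm_bound ag; have [b' [b0' hb']] := adm_bound adg.
exists (a' * b' + K * (b + b' + K') + (a + a') * K'); split=> [|U t hU ht].
  by rewrite ?(addr_ge0, mulr_ge0).
have {}hK := hK _ _ hU ht; have {}hK' := hK' _ _ hU ht.
have {}ha := ha _ hU; have {}ha' := ha' _ hU.
have {}hb := hb _ hU; have {}hb' := hb' _ hU.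
move: ht => /andP[t0 t1].
set r := F t U - _ - _ in hK; set r' := G t U - _ - _ in hK'.
have nt : nc (t%:C%C : C) = t by rewrite nc_real ger0_norm.
have t21 : t ^+ 2 <= 1 by rewrite expr_le1.
rewrite (_ : _ - _ = (t%:C%C * df U) * (t%:C%C * dg U) +
   r * (g U + t%:C%C * dg U + r') + (f U + t%:C%C * df U) * r'); last first.
  by rewrite /r /r'; ring.
rewrite [leRHS]mulrDl; apply: le_trans (ncD _ _) _; apply: lerD.
  rewrite [leRHS]mulrDl; apply: le_trans (ncD _ _) _; apply: lerD.
    rewrite !ncM nt mulrACA [leRHS]mulrC -expr2; apply: ler_wpM2l; first exact: sqr_ge0.
    by apply: ler_pM; rewrite ?nc_ge0.
  rewrite ncM -mulrA [(_ + _) * _]mulrC mulrA; apply: ler_pM; rewrite ?nc_ge0 //.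
  apply: le_trans (ncD _ _) _; apply: lerD.
    apply: le_trans (ncD _ _) _; apply: lerD => //.
    by rewrite ncM nt; apply: le_trans hb'; rewrite ler_piMl ?nc_ge0.
  by apply: le_trans hK' _; rewrite ler_piMr.
rewrite ncM -mulrA; apply: ler_pM; rewrite ?nc_ge0 //.
apply: le_trans (ncD _ _) _; apply: lerD => //.
by rewrite ncM nt; apply: le_trans ha'; rewrite ler_piMl ?nc_ge0.
Qed.

Lemma jet_sum (I : Type) (s : seq I) F f df :
  (forall i : I, jet (F i) (f i) (df i)) ->
  jet (fun t U => \sum_(i <- s) F i t U) (fun U => \sum_(i <- s) f i U)
      (fun U => \sum_(i <- s) df i U).
Proof.
move=> h; elim: s => [|i s IH].
  apply: (@jet_ext (fun _ _ => 0) _ (fun=> 0) _ (fun=> 0)) => [t U|U|U|];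
    rewrite ?big_nil //; apply: jet_cst; exact: adm_cst.
apply: jet_ext (jetD (h i) IH) => [t U|U|U]; by rewrite big_cons.
Qed.

Lemma jet_conj F f df : jet F f df ->
  jet (fun t U => Num.conj (F t U)) (fun U => Num.conj (f U))
      (fun U => Num.conj (df U)).
Proof.
move=> [aF af adf [K [K0 hK]]]; split.
- by move=> t; exact: adm_conj.
- exact: adm_conj.
- exact: adm_conj.
exists K; split=> // U t hU ht; rewrite -nc_conj !rmorphB rmorphM /= !conjCK.
rewrite (_ : Num.conj (t%:C%C : C) = t%:C%C); first exact: hK.
exact: conjc_real.
Qed.

Definition mjet (F : R -> M -> M) (f df : M -> M) : Prop :=
  forall i j, jet (fun t U => F t U i j) (fun U => f U i j) (fun U => df U i j).

Lemma mjet_cst f : madm f -> mjet (fun=> f) f (fun=> 0).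
Proof.
move=> hf i j; apply: jet_ext (jet_cst (hf i j)) => [//|//|U].
by rewrite mxE.
Qed.

Lemma mjetM F f df G g dg : mjet F f df -> mjet G g dg ->
  mjet (fun t U => F t U *m G t U) (fun U => f U *m g U)
      (fun U => df U *m g U + f U *m dg U).
Proof.
move=> hF hG i j.
apply: jet_ext (jet_sum (index_enum 'I_n) (fun k => jetM (hF i k) (hG k j)))
  => [t U|U|U] /=; first by rewrite mxE.
- by rewrite mxE.
- by rewrite big_split /= !mxE.
Qed.

Lemma mjet_adj F f df : mjet F f df ->
  mjet (fun t U => (F t U)^t*) (fun U => (f U)^t*) (fun U => (df U)^t*).
Proof.
by move=> hF i j; apply: jet_ext (jet_conj (hF j i)) => [t U|U|U]; rewrite !mxE.
Qed.

(** With [q = |w|^2], this is [((1 + i t q) / (1 - i t q) - 1) / q], written so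
that [q = 0] is not excluded. It makes [1 + s w w^*] the Cayley transform of
[i t w w^*]: a unitary matrix depending rationally on [t], whose derivative at
[t = 0] is [2 i w w^*]. *)
Definition cayley_coef (q t : R) : C :=
  Complex (- (2 * t * (t * q)) / (1 + (t * q) ^+ 2))
          (2 * t / (1 + (t * q) ^+ 2)).

Definition cayley (w : 'cV[C]_n) (t : R) : M :=
  1%:M + cayley_coef (l2norm w ^+ 2) t *: (w *m w^t*).

Lemma cayley_coefP q t : 
  cayley_coef q t + Num.conj (cayley_coef q t) +
  cayley_coef q t * Num.conj (cayley_coef q t) * q%:C%C = 0.
Proof.
have h : 1 + (t * q) ^+ 2 != 0.
  by apply: lt0r_neq0; rewrite ltr_wpDr // sqr_ge0.
apply/eqP; rewrite eq_complex /=; apply/andP; split; apply/eqP; last by ring.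
field; exact: h.
Qed.

Lemma cayley_coef_jet q t : 0 <= q -> 0 <= t <= 1 ->
  nc (cayley_coef q t - t%:C%C * (2 * 'i)%C) <= (2 * q + 2 * q ^+ 2) * t ^+ 2.
Proof.
move=> q0 /andP[t0 t1].
have h0 : 0 < 1 + (t * q) ^+ 2 by rewrite ltr_wpDr // sqr_ge0.
have h : 1 + (t * q) ^+ 2 != 0 by exact: lt0r_neq0.
have eqz : cayley_coef q t - t%:C%C * (2 * 'i)%C =
    - (2 * t * (t * q) / (1 + (t * q) ^+ 2))%:C%C -
    (2 * t * (t * q) ^+ 2 / (1 + (t * q) ^+ 2))%:C%C * 'i%C.
  apply/eqP; rewrite eq_complex /=; apply/andP; split; apply/eqP; field; exact: h.
have nci : nc ('i%C : C) = 1 by rewrite /= expr0n add0r expr1n sqrtr1.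
rewrite eqz; apply: le_trans (ncB _ _) _; rewrite ncN ncM nci mulr1 !nc_real.
have le1 x : 0 <= x -> `|x / (1 + (t * q) ^+ 2)| <= x.
  move=> x0; rewrite ger0_norm ?divr_ge0 ?(ltW h0) // ler_pdivrMr //.
  by rewrite ler_peMr // lerDl sqr_ge0.
rewrite [leRHS]mulrDl; apply: lerD.
  apply: le_trans (le1 _ _) _; first by rewrite !mulr_ge0.
  by rewrite (_ : 2 * t * _ = 2 * q * t ^+ 2) //; ring.
apply: le_trans (le1 _ _) _; first by rewrite !mulr_ge0 ?sqr_ge0.
rewrite (_ : 2 * t * _ = 2 * q ^+ 2 * t ^+ 2 * t); last by ring.
by rewrite ler_piMr // !mulr_ge0 ?sqr_ge0.
Qed.

Lemma conjTD m p (A B : 'M[C]_(m, p)) : (A + B)^t* = A^t* + B^t*.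
Proof. by rewrite linearD /= map_mxD. Qed.

Lemma conjTZ m p c (A : 'M[C]_(m, p)) : (c *: A)^t* = Num.conj c *: A^t*.
Proof. by rewrite linearZ /= map_mxZ. Qed.

Lemma conjT1 : (1%:M : M)^t* = 1%:M.
Proof. by rewrite trmx1 map_mx1. Qed.

Lemma rank1_adj (w : 'cV[C]_n) : (w *m w^t*)^t* = w *m w^t*.
Proof. by rewrite trmxC_mul trmxCK. Qed.

Lemma rank1_sqr (w : 'cV[C]_n) :
  (w *m w^t*) *m (w *m w^t*) = (l2norm w ^+ 2)%:C%C *: (w *m w^t*).
Proof.
rewrite mulmxA -(mulmxA w) [w^t* *m w]mx11_scalar l2norm_sqrC.
by rewrite mul_mx_scalar -scalemxAl.
Qed.

Lemma cayley_stabilizer (v w : 'cV[C]_n) t :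
  w^t* *m v = 0 -> stabilizer v (cayley w t).
Proof.
move=> wv; split; last first.
  by rewrite mulmxDl mul1mx -scalemxAl -mulmxA wv mulmx0 scaler0 addr0.
apply/unitarymxP; rewrite /cayley conjTD conjT1 conjTZ rank1_adj.
set c := cayley_coef _ _; set H := w *m w^t*.
rewrite mulmxDl !mulmxDr !mul1mx mulmx1 -scalemxAl -scalemxAr rank1_sqr -/H.
rewrite !scalerA -!addrA -2!scalerDl (addrCA (Num.conj c)) addrA.
have -> : c + Num.conj c + c * Num.conj c * (l2norm w ^+ 2)%:C%C = 0.
  exact: cayley_coefP.
by rewrite scale0r addr0.
Qed.

Lemma cayley_jet (w : 'cV[C]_n) :
  mjet (fun t _ => cayley w t) (fun=> 1%:M)
       (fun=> (2 * 'i)%C *: (w *m w^t*)).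
Proof.
move=> i j; split; [move=> t| | |]; try exact: adm_cst.
set q := l2norm w ^+ 2; have q0 : 0 <= q by exact: sqr_ge0.
exists ((2 * q + 2 * q ^+ 2) * nc ((w *m w^t*) i j)); split.
  apply: mulr_ge0 (nc_ge0 _); apply: addr_ge0; apply: mulr_ge0 => //.
  exact: sqr_ge0.
move=> U t _ ht; rewrite /cayley.
have eD (A B : M) : (A + B) i j = A i j + B i j by rewrite mxE.
have eZ c (A : M) : (c *: A) i j = c * A i j by rewrite mxE.
rewrite eD !eZ -/q [X in nc X](_ : _ =
  (cayley_coef q t - t%:C%C * (2 * 'i)%C) * (w *m w^t*) i j); last by ring.
rewrite ncM mulrAC.
by apply: ler_wpM2r; [exact: nc_ge0 | exact: cayley_coef_jet].
Qed.

End Jets.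

(** * Vanishing means of derivatives *)

Section Smooth.
Context {R : realType} {n : nat}.
Local Notation C := R[i].
Local Notation M := 'M[C]_n.
Variable v : 'cV[C]_n.

(** [df X U] is the derivative of [f (exp (t X) U)] at [t = 0]. It is only
required to be so for the generators [2 i w w^*], where [w] is orthogonal to
[v], and to be complex linear in [X]; the latter gives a meaning to directions
that are not tangent to the unitary group. *)
Definition smooth (f : M -> C) (df : M -> M -> C) : Prop :=
  (forall U a X Y, df (a *: X + Y) U = a * df X U + df Y U) /\
  forall w : 'cV[C]_n, w^t* *m v = 0 ->
    jet (fun t U => f (cayley w t *m U)) f (df ((2 * 'i)%C *: (w *m w^t*))).

Lemma smoothD f df g dg : smooth f df -> smooth g dg ->
  smooth (fun U => f U + g U) (fun X U => df X U + dg X U).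
Proof.
move=> [lf jf] [lg jg]; split=> [U a X Y|w wv].
  by rewrite lf lg mulrDr addrACA.
exact: jetD (jf w wv) (jg w wv).
Qed.

Lemma smoothM f df g dg : smooth f df -> smooth g dg ->
  smooth (fun U => f U * g U) (fun X U => df X U * g U + f U * dg X U).
Proof.
move=> [lf jf] [lg jg]; split=> [U a X Y|w wv].
  by rewrite lf lg; ring.
exact: jetM (jf w wv) (jg w wv).
Qed.

Lemma smooth_cst c : smooth (fun=> c) (fun _ _ => 0).
Proof.
split=> [U a X Y|w wv]; first by rewrite mulr0 addr0.
by apply: jet_cst; exact: adm_cst.
Qed.

Lemma smooth_ext f f' df df' : f =1 f' -> (forall X U, df X U = df' X U) ->
  smooth f df -> smooth f' df'.
Proof.
move=> /funext -> e; suff -> : df = df' by [].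
by apply/funext => X; apply/funext => U.
Qed.

Lemma smoothZ c f df : smooth f df ->
  smooth (fun U => c * f U) (fun X U => c * df X U).
Proof.
move=> /(smoothM (smooth_cst c)); apply: smooth_ext => // X U.
by rewrite mul0r add0r.
Qed.

Lemma smooth_sum (I : Type) (s : seq I) (f : I -> M -> C) df :
  (forall i, smooth (f i) (df i)) ->
  smooth (fun U => \sum_(i <- s) f i U) (fun X U => \sum_(i <- s) df i X U).
Proof.
move=> h; elim: s => [|i s IH].
  by apply: smooth_ext (smooth_cst 0) => [U|X U]; rewrite big_nil.
by apply: smooth_ext (smoothD (h i) IH) => [U|X U]; rewrite big_cons.
Qed.

Definition msmooth (F : M -> M) (dF : M -> M -> M) : Prop :=
  forall i j, smooth (fun U => F U i j) (fun X U => dF X U i j).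

Lemma msmoothM F dF G dG : msmooth F dF -> msmooth G dG ->
  msmooth (fun U => F U *m G U) (fun X U => dF X U *m G U + F U *m dG X U).
Proof.
move=> hF hG i j.
apply: smooth_ext (smooth_sum (index_enum 'I_n)
    (fun k => smoothM (hF i k) (hG k j))) => [U|X U] /=.
  by rewrite mxE.
by rewrite big_split /= !mxE.
Qed.

Lemma msmooth_cst A : msmooth (fun=> A) (fun _ _ => 0).
Proof.
by move=> i j; apply: smooth_ext (smooth_cst (A i j)) => // X U; rewrite mxE.
Qed.

Lemma smooth_tr F dF : msmooth F dF ->
  smooth (fun U => \tr (F U)) (fun X U => \tr (dF X U)).
Proof. by move=> h; apply: smooth_sum => i; exact: h. Qed.

Variable E : (M -> R) -> R.
Hypothesis hE : haar_mean v E.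

Lemma mean_sum (I : Type) (s : seq I) (f : I -> M -> R) :
  (forall i, radm (f i)) ->
  E (fun U => \sum_(i <- s) f i U) = \sum_(i <- s) E (f i).
Proof.
move=> h; elim: s => [|i s IH].
  by rewrite big_nil -[RHS](mean_cst hE); congr E; apply/funext => U; rewrite big_nil.
rewrite big_cons -IH -(meanD hE) //; last exact: radm_sum.
by congr E; apply/funext => U; rewrite big_cons.
Qed.

(** By invariance the means of [f] and of its translate agree, so [t] times the
mean of the derivative is [O(t^2)] for every small [t]. *)
Lemma mean_jet0 f df (w : 'cV[C]_n) : w^t* *m v = 0 ->
  jet (fun t U => f (cayley w t *m U)) f df ->
  E (fun U => complex.Re (df U)) = 0.
Proof.
move=> wv [aF af adf [K [K0 hK]]].
set e := E _.
have le_t t : 0 < t -> t <= 1 -> `|e| <= K * t.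
  move=> t0 t1.
  pose r U := f (cayley w t *m U) - f U - t%:C%C * df U.
  have ar : adm r.
    apply: admB; first exact: admB.
    exact: admZ.
  have sh : E (fun U => complex.Re (f (cayley w t *m U))) =
      E (fun U => complex.Re (f U)).
    apply: (mean_shift hE (f := fun U => complex.Re (f U))).
      exact: cayley_stabilizer.
    exact: radm_Re.
  have eq1 : E (fun U => complex.Re (f (cayley w t *m U))) =
      E (fun U => complex.Re (f U)) + (t * e + E (fun U => complex.Re (r U))).
    rewrite -(meanZ hE); last exact: radm_Re.
    rewrite -(meanD hE); [|by apply: radmZ; exact: radm_Re|exact: radm_Re].
    rewrite -(meanD hE); [|exact: radm_Re|]; last first.
      by apply: radmD; [apply: radmZ|]; exact: radm_Re.
    congr E; apply/funext => U; rewrite /r.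
    have ReZ (x : C) : t * complex.Re x = complex.Re (t%:C%C * x).
      by rewrite complex_ReM /= mul0r subr0.
    rewrite ReZ -!raddfD /=; congr complex.Re.
    by ring.
  have te : t * e = - E (fun U => complex.Re (r U)).
    by move: eq1; rewrite sh => /eqP; rewrite addrC -subr_eq subrr eq_sym;
      rewrite addr_eq0 => /eqP.
  have : `|t * e| <= K * t ^+ 2.
    rewrite te normrN ler_norml; apply/andP; split.
      rewrite -(mean_cst hE (- _)); apply: (mean_le hE) => [||U [uU _]].
      - exact: radm_cst.
      - exact: radm_Re.
      - rewrite lerNl; apply: le_trans (hK U t uU _); last by rewrite ltW.
        by apply: le_trans (nc_Re _); rewrite -normrN ler_norm.
    rewrite -[leRHS](mean_cst hE); apply: (mean_le hE) => [||U [uU _]].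
    - exact: radm_Re.
    - exact: radm_cst.
    - apply: le_trans (hK U t uU _); last by rewrite ltW.
      exact: le_trans (ler_norm _) (nc_Re _).
  by rewrite normrM gtr0_norm // expr2 mulrA mulrAC [leRHS]mulrC ler_pM2l.
apply/eqP; rewrite -normr_le0; apply/ler_addgt0Pl => eps eps0.
rewrite addr0; set t := Num.min 1 (eps / (K + 1)).
have K1 : 0 < K + 1 by rewrite ltr_wpDl.
have t0 : 0 < t by rewrite lt_min ltr01 divr_gt0.
have t1 : t <= 1 by rewrite ge_min lexx.
apply: le_trans (le_t t t0 t1) _.
apply: (@le_trans _ _ ((K + 1) * (eps / (K + 1)))).
  apply: ler_pM => //; [exact: ltW | by rewrite lerDl | ].
  by rewrite ge_min lexx orbT.
by rewrite mulrC divfK // lt0r_neq0.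
Qed.

(** Quantifying over the constant [c] turns the vanishing of the real part into
that of the whole complex mean, and makes the null directions a complex vector
space. *)
Definition null_direction (df : M -> M -> C) (X : M) : Prop :=
  adm (df X) /\ forall c, E (fun U => complex.Re (c * df X U)) = 0.

Lemma null_direction_cayley f df (w : 'cV[C]_n) : smooth f df -> w^t* *m v = 0 ->
  null_direction df (w *m w^t*).
Proof.
move=> sf wv; have [lf jf] := sf.
have [_ _ a _] := jf w wv.
have i2 : (2 * 'i)%C != 0 :> C.
  by apply: mulf_neq0; rewrite ?pnatr_eq0 // eq_complex /= oner_eq0 andbF.
have dfZ c X U : df (c *: X) U = c * df X U.
  have d0 : df 0 U = 0.
    by have := lf U (-1) 0 0; rewrite scaler0 addr0 mulN1r addNr.
  by have := lf U c X 0; rewrite !addr0 d0 addr0.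
split.
  have := admZ (2 * 'i)%C^-1 a; under [X in adm X]eq_fun do rewrite dfZ mulKf //.
  by [].
move=> c; have [_ /(_ w wv) j] := smoothZ (c / (2 * 'i)%C) sf.
rewrite -[RHS](mean_jet0 wv j); congr E; apply/funext => U.
by rewrite dfZ mulrA divfK.
Qed.

Lemma null_directionD f df a X Y : smooth f df ->
  null_direction df X -> null_direction df Y -> null_direction df (a *: X + Y).
Proof.
move=> [lf _] [aX eX] [aY eY].
have e : df (a *: X + Y) = fun U => a * df X U + df Y U.
  by apply/funext => U; exact: lf.
rewrite /null_direction e; split; first by apply: admD => //; exact: admZ.
move=> c; transitivity (E (fun U => complex.Re (c * a * df X U)) +
    E (fun U => complex.Re (c * df Y U))); last by rewrite eX eY addr0.
rewrite -(meanD hE).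
- by congr E; apply/funext => U; rewrite mulrDr mulrA raddfD.
- by apply: radm_Re; exact: admZ.
- by apply: radm_Re; exact: admZ.
Qed.

Lemma rank1_expand (a b : C) (w w' : 'cV[C]_n) :
  (a *: w + b *: w') *m (a *: w + b *: w')^t* =
  (a * Num.conj a) *: (w *m w^t*) + (a * Num.conj b) *: (w *m w'^t*) +
  ((b * Num.conj a) *: (w' *m w^t*) + (b * Num.conj b) *: (w' *m w'^t*)).
Proof.
rewrite conjTD (conjTZ a) (conjTZ b).
have e x y (p q : 'cV[C]_n) :
    (x *: p) *m (Num.conj y *: q^t*) = (x * Num.conj y) *: (p *m q^t*).
  by rewrite -scalemxAl -scalemxAr scalerA.
by rewrite [LHS]mulmxDl 2!mulmxDr !e.
Qed.

(** Polarization: [w w'^*] is a complex combination of the Hermitian rank one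
matrices built on [w + w'], [w + i w'], [w] and [w']. *)
Lemma null_direction_rank1 f df (w w' : 'cV[C]_n) : smooth f df ->
  w^t* *m v = 0 -> w'^t* *m v = 0 -> null_direction df (w *m w'^t*).
Proof.
move=> sf wv wv'.
(* S is kept abstract: only its expansion and its null directions matter *)
have [S SE rk] : exists2 S : C -> C -> M,
    forall a b, S a b = (a * Num.conj a) *: (w *m w^t*) +
      (a * Num.conj b) *: (w *m w'^t*) + ((b * Num.conj a) *: (w' *m w^t*) +
      (b * Num.conj b) *: (w' *m w'^t*)) &
    forall a b, null_direction df (S a b).
  exists (fun a b => (a *: w + b *: w') *m (a *: w + b *: w')^t*) => a b.
    exact: rank1_expand.
  apply: (null_direction_cayley sf).
  by rewrite conjTD !conjTZ mulmxDl -!scalemxAl wv wv' !scaler0 addr0.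
have e0 : null_direction df 0.
  by have := null_directionD (-1) sf (rk 0 0) (rk 0 0);
     rewrite scaleN1r addNr.
have -> : w *m w'^t* = (2^-1 : C) *: S 1 1 + ((2^-1 * 'i%C : C) *: S 1 'i%C +
   ((- (2^-1 * (1 + 'i%C)) : C) *: S 1 0 +
    ((- (2^-1 * (1 + 'i%C)) : C) *: S 0 1 + 0))).
  have ci : Num.conj ('i%C : C) = - 'i%C.
    by apply/eqP; rewrite eq_complex /= oppr0 !eqxx.
  have ii : 'i%C * 'i%C = -1 :> C by rewrite -expr2 sqr_i.
  rewrite !SE rmorph1 rmorph0 ci.
  move: (w *m w^t*) (w *m w'^t*) (w' *m w^t*) (w' *m w'^t*) => a b c d.
  have half : (2^-1 : C) * 2 = 1 by rewrite mulVf // pnatr_eq0.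
  move: (2^-1 : C) ('i%C : C) half ii => h k hh kk.
  apply/matrixP => i j; rewrite !mxE.
  move: (a i j) (b i j) (c i j) (d i j) => x y z u.
  rewrite -[LHS]mul1r -[in LHS]hh.
  ring: kk.
by do 4![apply: (null_directionD _ sf); first exact: rk].
Qed.

End Smooth.

(** * Words in the random matrix and the Schwinger-Dyson equation *)

Section Words.
Context {R : realType} {n : nat}.
Local Notation C := R[i].
Local Notation M := 'M[C]_n.

(** A letter [(true, b)] stands for [U b U^*], and [(false, a)] for [a]. *)
Definition letter := (bool * M)%type.
Implicit Types (t s : seq letter) (U X : M).

Definition lval U (l : letter) : M := if l.1 then U *m l.2 *m U^t* else l.2.

Definition word t U : M := foldr (fun l acc => lval U l *m acc) 1%:M t.

Lemma word_cat t s U : word (t ++ s) U = word t U *m word s U.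
Proof. by elim: t => [|l t IH] /=; rewrite ?mul1mx // IH mulmxA. Qed.

Lemma word1 l U : word [:: l] U = lval U l.
Proof. exact: mulmx1. Qed.

Definition adj_word t : seq letter := rev [seq (l.1, l.2^t*) | l <- t].

Lemma lval_adj U l : lval U (l.1, l.2^t*) = (lval U l)^t*.
Proof. by case: l => [[] b] //=; rewrite /lval /= !trmxC_mul trmxCK mulmxA. Qed.

Lemma word_adj t U : word (adj_word t) U = (word t U)^t*.
Proof.
elim: t => [|l t IH] /=; first by rewrite conjT1.
by rewrite /adj_word /= rev_cons -cats1 word_cat IH word1 lval_adj trmxC_mul.
Qed.

Lemma madm_lval l : madm (lval ^~ l).
Proof.
case: l => [[] b]; rewrite /lval /=; last exact: madm_cst.
apply: madmM; last exact: madm_adj madm_id.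
by apply: madmM; [exact: madm_id | exact: madm_cst].
Qed.

Lemma madm_word t : madm (word t).
Proof.
elim: t => [|l t IH] /=; first exact: madm_cst.
by apply: madmM => //; exact: madm_lval.
Qed.

(** The free difference quotient: the derivative of [U b U^*] in the direction
[X] is [X U b U^* - U b U^* X], so each conjugated letter contributes a cut of
the word before it and, with the opposite sign, a cut after it. The two pieces
are contracted by [g]. *)
Definition del (g : M -> M -> C) t U : C :=
  \sum_(i < size t) if (nth (false, 0) t i).1 then
     g (word (take i t) U) (word (drop i t) U) -
     g (word (take i.+1 t) U) (word (drop i.+1 t) U) else 0.

Lemma del_cons (g : M -> M -> C) l t U : del g (l :: t) U =
  (if l.1 then g 1%:M (word (l :: t) U) - g (lval U l) (word t U) else 0) +
  del (fun A B => g (lval U l *m A) B) t U.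
Proof. by rewrite /del /= big_ord_recl /= take0 drop0 mulmx1. Qed.

Lemma eq_del (g g' : M -> M -> C) t U : (forall A B, g A B = g' A B) ->
  del g t U = del g' t U.
Proof. by move=> e; apply: eq_bigr => i _; rewrite !e. Qed.

Lemma del_sum (I : Type) (r : seq I) (g : I -> M -> M -> C) t U :
  \sum_(k <- r) del (g k) t U = del (fun A B => \sum_(k <- r) g k A B) t U.
Proof.
rewrite /del exchange_big; apply: eq_bigr => i _ /=.
by case: ifP => _; rewrite ?sumrB // big1.
Qed.

Lemma delZ (c : C) (g : M -> M -> C) t U :
  c * del g t U = del (fun A B => c * g A B) t U.
Proof.
rewrite /del mulr_sumr; apply: eq_bigr => k _; case: ifP => _.
  by rewrite mulrBr.
by rewrite mulr0.
Qed.

Definition dlval X U (l : letter) : M :=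
  if l.1 then X *m lval U l - lval U l *m X else 0.

Fixpoint dword t X U : M :=
  if t is l :: t' then dlval X U l *m word t' U + lval U l *m dword t' X U else 0.

(** The Leibniz rule. *)
Lemma del_dword (phi : M -> C) t X U : (forall A B, phi (A - B) = phi A - phi B) ->
  phi (dword t X U) = del (fun A B => phi (A *m X *m B)) t U.
Proof.
elim: t phi => [|l t IH] phi phiB.
  by rewrite /del big_ord0 /= -[X in phi X](subrr 0) phiB subrr.
have phi0 : phi 0 = 0 by rewrite -[X in phi X](subrr 0) phiB subrr.
have phiD A B : phi (A + B) = phi A + phi B.
  by rewrite -{1}(opprK B) phiB -(sub0r B) phiB phi0 sub0r opprK.
rewrite del_cons /= phiD; congr (_ + _).
  rewrite /dlval; case: l.1; last by rewrite mul0mx.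
  by rewrite mulmxBl phiB mul1mx !mulmxA.
rewrite (IH (fun A => phi (lval U l *m A))) => [|A B]; last first.
  by rewrite mulmxBr phiB.
by apply: eq_bigr => i _; rewrite !mulmxA.
Qed.

Lemma mxtrace_adj (A : M) : \tr (A^t*) = Num.conj (\tr A).
Proof. by rewrite /mxtrace rmorph_sum; apply: eq_bigr => i _; rewrite !mxE. Qed.

Lemma mxtrace_sub (A B : M) : \tr (A - B) = \tr A - \tr B.
Proof. exact: raddfB. Qed.

Variable v : 'cV[C]_n.

(** The generators are anti-Hermitian, which is why the derivative of [U^*]
contributes the second term of the commutator [dlval]. *)
Lemma smooth_lval l : msmooth v (lval ^~ l) (fun X U => dlval X U l).
Proof.
case: l => [[] b]; rewrite /lval /dlval /=; last exact: msmooth_cst.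
have mD : madm (fun U : M => U *m b *m U^t*) := madm_lval (true, b).
move=> i j; split=> [U a X Y|w wv].
  rewrite mulmxDl mulmxDr -scalemxAl -scalemxAr.
  by rewrite !mxE; ring.
set H := (2 * 'i)%C *: (w *m w^t*).
have Hadj : H^t* = - H.
  rewrite /H conjTZ rank1_adj -scaleNr; congr (_ *: _).
  apply/eqP; rewrite eq_complex /=; apply/andP; split; apply/eqP; ring.
have := mjetM (mjetM (cayley_jet w) (mjet_cst mD)) (mjet_adj (cayley_jet w)).
move=> /(_ i j); apply: jet_ext => [t U|U|U].
- by rewrite !trmxC_mul !mulmxA.
- by rewrite conjT1 mul1mx mulmx1.
- rewrite conjT1 -/H Hadj !mulmx1 mulmx0 addr0 mul1mx mulmxN.
  by [].
Qed.

Lemma smooth_word t : msmooth v (word t) (dword t).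
Proof.
elim: t => [|l t IH] /=; first exact: msmooth_cst.
exact: msmoothM (smooth_lval l) IH.
Qed.

Lemma adm_del (g : M -> M -> M -> C) t :
  (forall F G, madm F -> madm G -> adm (fun U => g U (F U) (G U))) ->
  adm (fun U => del (g U) t U).
Proof.
move=> hg; apply: adm_sum => i.
case: (nth (false, 0) t i).1; last exact: adm_cst.
by apply: admB; apply: hg; exact: madm_word.
Qed.

Definition perp_mx : M := 1%:M - v *m v^t*.
Local Notation Q := perp_mx.

Hypothesis hv : l2norm v = 1.

Lemma vv1 : v^t* *m v = 1%:M.
Proof. by rewrite [LHS]mx11_scalar l2norm_sqrC hv expr1n. Qed.

Lemma perp_adj : Q^t* = Q.
Proof.
rewrite /perp_mx conjTD conjT1 -scaleN1r conjTZ rank1_adj; congr (_ + _ *: _).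
by rewrite rmorphN rmorph1.
Qed.

Lemma perp_v : Q *m v = 0.
Proof. by rewrite mulmxBl mul1mx -mulmxA vv1 mulmx1 subrr. Qed.

Lemma v_perp : v^t* *m Q = 0.
Proof. by rewrite mulmxBr mulmx1 mulmxA vv1 mul1mx subrr. Qed.

Lemma tr_perp : \tr Q = n%:R - 1.
Proof.
rewrite /perp_mx mxtrace_sub mxtrace1 mxtrace_mulC vv1 mxtrace1.
by [].
Qed.

Variable E : (M -> R) -> R.
Hypothesis hE : haar_mean v E.

(** [Q E_ij Q] is the rank one matrix built on [Q e_i] and [Q e_j], both of
which are orthogonal to [v]. *)
Lemma schwinger_dyson_entry f df i j : smooth v f df ->
  adm (df (Q *m delta_mx i j *m Q)) /\
  E (fun U => complex.Re (df (Q *m delta_mx i j *m Q) U)) = 0.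
Proof.
move=> sf; have -> : Q *m delta_mx i j *m Q =
    (Q *m (delta_mx i 0 : 'cV[C]_n)) *m (Q *m (delta_mx j 0 : 'cV[C]_n))^t*.
  rewrite trmxC_mul perp_adj !mulmxA; congr (_ *m _).
  rewrite -mulmxA; congr (_ *m _).
  apply/matrixP => k l; rewrite !mxE big_ord1 !mxE.
  by rewrite andbT; case: (k == i); case: (l == j);
    rewrite /= ?(rmorph1, rmorph0, mul1r, mul0r).
have Qv k : (Q *m (delta_mx k 0 : 'cV[C]_n))^t* *m v = 0.
  by rewrite trmxC_mul perp_adj -mulmxA perp_v mulmx0.
have [a e] := null_direction_rank1 hE sf (Qv i) (Qv j).
split=> //; rewrite -[RHS](e 1); congr E; apply/funext => U.
by rewrite mul1r.
Qed.

Lemma delta_sandwich (A B : M) i j k l :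
  (A *m delta_mx i j *m B) k l = A k i * B j l.
Proof.
rewrite mxE (bigD1 j) //= big1 ?addr0 => [|m mj].
  rewrite mxE (bigD1 i) //= big1 ?addr0 => [|m mi].
    by rewrite !mxE !eqxx mulr1.
  by rewrite !mxE (negPf mi) mulr0.
rewrite mxE big1 ?mul0r // => p _.
by rewrite !mxE (negPf mj) andbF mulr0.
Qed.

(** Summing the [(i, j)] entry of [A Q E_ij Q B] over [i] and [j] splits a word
into a product of two traces. *)
Lemma contract_del s U :
  \sum_i \sum_j dword s (Q *m delta_mx i j *m Q) U i j =
  del (fun A B => \tr (A *m Q) * \tr (Q *m B)) s U.
Proof.
have mxB i j (A B : M) : (A - B) i j = A i j - B i j by rewrite !mxE.
under eq_bigr => i _.
  under eq_bigr => j _ do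
    rewrite (del_dword (phi := fun A => A i j) s _ U (mxB i j)).
  rewrite del_sum; over.
rewrite del_sum; apply: eq_del => A B.
rewrite /mxtrace mulr_suml; apply: eq_bigr => i _.
rewrite mulr_sumr; apply: eq_bigr => j _.
by rewrite !mulmxA -(mulmxA _ Q B) delta_sandwich.
Qed.

(** When the direction [Q E_ij Q] meets a trace instead, the sum over [i] and
[j] merges two traces into one: no power of the dimension is gained, which makes
this term negligible against that of [contract_del]. *)
Lemma contract_trace (A : M) t U :
  \sum_i \sum_j A i j * \tr (dword t (Q *m delta_mx i j *m Q) U) =
  del (fun L L' => \tr (A *m (Q *m L' *m L *m Q))) t U.
Proof.
have trB (X Y : M) : \tr (X - Y) = \tr X - \tr Y by exact: mxtrace_sub.
under eq_bigr => i _.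
  under eq_bigr => j _ do rewrite (del_dword t _ U trB) delZ.
  rewrite del_sum; over.
rewrite del_sum; apply: eq_del => L L'.
rewrite [RHS]/mxtrace; apply: eq_bigr => i _.
rewrite mxE; apply: eq_bigr => j _; congr (_ * _).
rewrite !mulmxA -(mulmxA _ Q L') mxtrace_mulC !mulmxA.
have one k : (1%:M : M) j k = (j == k)%:R by rewrite mxE.
rewrite /mxtrace (bigD1 j) //= big1 ?addr0 => [|k kj].
  by rewrite -[_ *m delta_mx i j]mulmx1 delta_sandwich one eqxx mulr1.
by rewrite -[_ *m delta_mx i j]mulmx1 delta_sandwich one eq_sym (negPf kj) mulr0.
Qed.

(** Integration by parts: the product of [F] with the [(i, j)] entry of
[word s] is differentiated in the direction [Q E_ij Q], and the vanishing means
are summed over [i] and [j]. *)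
Lemma schwinger_dyson s F dF : smooth v F dF ->
  E (fun U => complex.Re
      (F U * del (fun A B => \tr (A *m Q) * \tr (Q *m B)) s U +
       \sum_i \sum_j word s U i j * dF (Q *m delta_mx i j *m Q) U)) = 0.
Proof.
move=> sF.
pose df i j X U := dword s X U i j * F U + word s U i j * dF X U.
have sf i j : smooth v (fun U => word s U i j * F U) (df i j).
  exact: smoothM (smooth_word s i j) sF.
have H i j := schwinger_dyson_entry i j (sf i j).
pose Re_df i j U := complex.Re (df i j (Q *m delta_mx i j *m Q) U).
have rdf i j : radm (Re_df i j) by apply: radm_Re; exact: (H i j).1.
transitivity (E (fun U => \sum_i \sum_j Re_df i j U)); last first.
  rewrite (mean_sum hE) => [|i]; last exact: radm_sum.
  by apply: big1 => i _; rewrite (mean_sum hE) //; apply: big1 => j _; exact: (H i j).2.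
congr E; apply/funext => U; rewrite /Re_df.
transitivity (complex.Re (\sum_i \sum_j df i j (Q *m delta_mx i j *m Q) U));
  last by rewrite raddf_sum; apply: eq_bigr => i _; rewrite raddf_sum.
congr complex.Re; rewrite /df.
under [RHS]eq_bigr do rewrite big_split /=.
rewrite [RHS]big_split /=; congr (_ + _).
rewrite mulrC -contract_del mulr_suml; apply: eq_bigr => i _.
by rewrite mulr_suml.
Qed.

End Words.

(** * Fourth moment estimates *)

Section Small.
Context {R : realType}.
Local Notation C := R[i].
Local Notation M n := 'M[C]_n.+2.

Definition mxseq := forall n, M n.
Definition sletter := (bool * mxseq)%type.
Implicit Types (s : seq sletter) (l : sletter).

Definition inst n l : letter := (l.1, l.2 n) : @letter R n.+2.
Definition sword s n (U : M n) : M n := word (map (inst n) s) U.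

Definition mx_bounded (A : mxseq) : Prop := exists c, forall n, bnd (A n) c.
Definition sbounded s : Prop := {in s, forall l, mx_bounded l.2}.

Lemma sword_cat s s' n U : sword (s ++ s') U = sword s U *m sword s' U :> M n.
Proof. by rewrite /sword map_cat word_cat. Qed.

Lemma lval_bnd n (U : M n) (l : letter) c : U \is unitarymx ->
  bnd l.2 c -> bnd (lval U l) c.
Proof.
move=> uU hl; rewrite /lval; case: l.1 => //.
have := bndM (bndM (bnd_unitary uU) hl) (bnd_adj (bnd_unitary uU)).
by rewrite mul1r mulr1.
Qed.

Lemma sword_bnd s : sbounded s ->
  exists c, forall n (U : M n), U \is unitarymx -> bnd (sword s U) c.
Proof.
elim: s => [_|l s IH hs].
  by exists 1 => n U _; exact: bnd1.
have [c hc] := IH (fun l' h => hs l' (mem_behead (s := l :: s) h)).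
have [c' hc'] := hs l (mem_head _ _).
exists (c' * c) => n U uU; apply: bndM; last exact: hc.
by apply: lval_bnd => //; exact: hc'.
Qed.

Lemma sbounded_cat s s' : sbounded s -> sbounded s' -> sbounded (s ++ s').
Proof. by move=> h h' l; rewrite mem_cat => /orP[/h|/h']. Qed.

Lemma sbounded_take i s : sbounded s -> sbounded (take i s).
Proof. by move=> h l /mem_take; exact: h. Qed.

Lemma sbounded_drop i s : sbounded s -> sbounded (drop i s).
Proof. by move=> h l /mem_drop; exact: h. Qed.

Lemma sbounded_cons l s : mx_bounded l.2 -> sbounded s -> sbounded (l :: s).
Proof. by move=> h hs l'; rewrite inE => /predU1P[->|/hs]. Qed.

Definition adj_sword s : seq sletter :=
  rev [seq (l.1, fun n => (l.2 n)^t*) | l <- s].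

Lemma adj_swordE s n : map (inst n) (adj_sword s) = adj_word (map (inst n) s).
Proof. by rewrite /adj_sword /adj_word map_rev -!map_comp. Qed.

Lemma sbounded_adj s : sbounded s -> sbounded (adj_sword s).
Proof.
move=> hs l; rewrite mem_rev => /mapP[l' /hs[c hc] ->] /=.
by exists c => n; exact: bnd_adj.
Qed.

Lemma sdelE n (g : M n -> M n -> C) s U :
  del g (map (inst n) s) U =
  \sum_(i < size s) if (nth (false, fun=> 0) s i).1 then
     g (sword (take i s) U) (sword (drop i s) U) -
     g (sword (take i.+1 s) U) (sword (drop i.+1 s) U) else 0.
Proof.
rewrite /del size_map; apply: eq_bigr => i _.
rewrite (nth_map (false, fun=> 0)) // -!map_take -!map_drop.
by [].
Qed.

Variables (v : forall n, 'cV[C]_n.+2) (E : forall n, (M n -> R) -> R).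
Hypothesis hv : forall n, l2norm (v n) = 1.
Hypothesis hE : forall n, haar_mean (v n) (@E n).

Lemma sdel_bound (g : forall n, M n -> M n -> M n -> C) s K : 0 <= K ->
  sbounded s ->
  (forall n U A B a b, stabilizer (v n) U -> bnd A a -> bnd B b ->
     nc (g n U A B) <= K * (a * b)) ->
  exists c, 0 <= c /\ forall n (U : M n), stabilizer (v n) U ->
    nc (del (g n U) (map (inst n) s) U) <= c.
Proof.
move=> K0 hs hg.
have H (i : nat) : exists c, 0 <= c /\ forall n (U : M n), stabilizer (v n) U ->
    nc (g n U (sword (take i s) U) (sword (drop i s) U)) <= c.
  have [a ha] := sword_bnd (sbounded_take (i := i) hs).
  have [b hb] := sword_bnd (sbounded_drop (i := i) hs).
  exists `|K * (a * b)|; split=> // n U GU; apply: le_trans (ler_norm _).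
  by apply: hg => //; [exact: ha GU.1 | exact: hb GU.1].
have /choice[c hc] := H.
exists (\sum_(i < size s) (c i + c i.+1)); split.
  by apply: sumr_ge0 => i _; apply: addr_ge0; exact: (hc _).1.
move=> n U GU; rewrite sdelE; apply: le_trans (nc_sum _ _ _) _.
apply: ler_sum => i _; case: ifP => _.
  apply: le_trans (ncB _ _) _.
  by apply: lerD; exact: (hc _).2.
by rewrite nc0; apply: addr_ge0; exact: (hc _).1.
Qed.

Definition fseq := forall n, M n -> C.

(** [E |Z|^4 = O(N^-2)]. The second moments of the vector state are in general
of order [1/N], which is not summable; fourth moments give a summable bound. *)
Definition small (Z : fseq) : Prop :=
  (forall n, adm (Z n)) /\ exists K, 0 <= K /\ forall n,
    E (fun U => nc (Z n U) ^+ 4) <= K / n.+2%:R ^+ 2.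

Definition fbounded (Z : fseq) : Prop :=
  (forall n, adm (Z n)) /\ exists K, 0 <= K /\ forall n U,
    stabilizer (v n) U -> nc (Z n U) <= K.

Let N2 n : 0 < (n.+2%:R : R) ^+ 2. Proof. by rewrite exprn_gt0. Qed.

Lemma small_ext (Z Z' : fseq) : (forall n U, stabilizer (v n) U -> Z n U = Z' n U) ->
  (forall n, adm (Z' n)) -> small Z -> small Z'.
Proof.
move=> e aZ' [aZ [K [K0 hK]]]; split=> //; exists K; split=> // n.
apply: le_trans (hK n); apply: (mean_le (hE n)); try exact: radm_nc4.
by move=> U GU; rewrite e.
Qed.

Lemma smallD Z Z' : small Z -> small Z' -> small (fun n U => Z n U + Z' n U).
Proof.
move=> [aZ [K [K0 hK]]] [aZ' [K' [K0' hK']]]; split=> [n|]; first exact: admD.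
exists (8 * K + 8 * K'); split=> [|n]; first by rewrite addr_ge0 // mulr_ge0.
apply: (@le_trans _ _ (8 * E (fun U => nc (Z n U) ^+ 4) +
    8 * E (fun U => nc (Z' n U) ^+ 4))).
  rewrite -!(meanZ (hE n)); try exact: radm_nc4.
  rewrite -(meanD (hE n)); try by apply: radmZ; exact: radm_nc4.
  apply: (mean_le (hE n)).
  - by apply: radm_nc4; exact: admD.
  - by apply: radmD; apply: radmZ; exact: radm_nc4.
  move=> U _; set x := nc (Z n U); set y := nc (Z' n U).
  have x0 : 0 <= x by exact: nc_ge0.
  have y0 : 0 <= y by exact: nc_ge0.
  apply: (@le_trans _ _ ((x + y) ^+ 4)).
    by rewrite lerXn2r ?nnegrE ?nc_ge0 ?addr_ge0 // ncD.
  have h1 : (x + y) ^+ 2 <= 2 * x ^+ 2 + 2 * y ^+ 2.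
    by rewrite -subr_ge0 (_ : _ - _ = (x - y) ^+ 2) ?sqr_ge0 //; ring.
  have h2 : (2 * x ^+ 2 + 2 * y ^+ 2) ^+ 2 <= 8 * x ^+ 4 + 8 * y ^+ 4.
    rewrite -subr_ge0 (_ : _ - _ = (2 * x ^+ 2 - 2 * y ^+ 2) ^+ 2) ?sqr_ge0 //.
    by ring.
  apply: le_trans h2; rewrite (exprM _ 2 2) lerXn2r ?nnegrE ?sqr_ge0 //.
  by rewrite addr_ge0 // mulr_ge0 ?sqr_ge0.
rewrite [leRHS]mulrDl; apply: lerD; rewrite -mulrA; exact: ler_wpM2l.
Qed.

Lemma smallM B Z : fbounded B -> small Z -> small (fun n U => B n U * Z n U).
Proof.
move=> [aB [b [b0 hb]]] [aZ [K [K0 hK]]]; split=> [n|]; first exact: admM.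
exists (b ^+ 4 * K); split=> [|n]; first by rewrite mulr_ge0 // exprn_ge0.
apply: (@le_trans _ _ (b ^+ 4 * E (fun U => nc (Z n U) ^+ 4))); last first.
  by rewrite -[leRHS]mulrA; apply: ler_wpM2l (hK n); exact: exprn_ge0.
rewrite -(meanZ (hE n)); last exact: radm_nc4.
apply: (mean_le (hE n)).
- by apply: radm_nc4; exact: admM.
- by apply: radmZ; exact: radm_nc4.
move=> U GU; rewrite ncM exprMn ler_wpM2r ?exprn_ge0 ?nc_ge0 //.
by rewrite lerXn2r ?nnegrE ?nc_ge0 // hb.
Qed.

Lemma small_rate (Z : fseq) K : 0 <= K -> (forall n, adm (Z n)) ->
  (forall n U, stabilizer (v n) U -> nc (Z n U) <= K / n.+2%:R) -> small Z.
Proof.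
move=> K0 aZ h; split=> //; exists (K ^+ 4); split=> [|n]; first exact: exprn_ge0.
rewrite -[leRHS](mean_cst (hE n)); apply: (mean_le (hE n)).
- exact: radm_nc4.
- exact: radm_cst.
move=> U GU; apply: (@le_trans _ _ ((K / n.+2%:R) ^+ 4)).
  by rewrite lerXn2r ?nnegrE ?nc_ge0 ?divr_ge0 // h.
rewrite exprMn; apply: ler_wpM2l; first exact: exprn_ge0.
rewrite exprVn lef_pV2 ?posrE ?exprn_gt0 //.
by rewrite ler_weXn2l // ler1n.
Qed.

Lemma small0 : small (fun _ _ => 0).
Proof.
apply: (@small_rate _ 0) => // [n|n U _]; first exact: adm_cst.
by rewrite nc0 mul0r.
Qed.

Lemma small_sum (I : Type) (r : seq I) (Z : I -> fseq) :
  (forall i, small (Z i)) -> small (fun n U => \sum_(i <- r) Z i n U).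
Proof.
move=> h; elim: r => [|i r IH].
  rewrite (_ : (fun _ _ => _) = fun _ _ => 0); first exact: small0.
  by apply/functional_extensionality_dep => n; apply/funext => U; rewrite big_nil.
rewrite (_ : (fun _ _ => _) =
    fun n U => Z i n U + \sum_(j <- r) Z j n U); first exact: smallD.
by apply/functional_extensionality_dep => n; apply/funext => U; rewrite big_cons.
Qed.

Lemma fbounded_cst (c : nat -> C) K : (forall n, nc (c n) <= K) ->
  fbounded (fun n _ => c n).
Proof.
move=> h; split=> [n|]; first exact: adm_cst.
exists K; split=> //; apply: le_trans (h 0%N); exact: nc_ge0.
Qed.

Lemma smallN Z : small Z -> small (fun n U => - Z n U).
Proof.
move=> hZ; have /smallM/(_ hZ) : fbounded (fun _ _ => -1).
  by apply: (@fbounded_cst (fun=> -1) 1) => n; rewrite ncN nc1.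
apply: small_ext => [n U _|n]; first by rewrite mulN1r.
by apply: admN; exact: hZ.1.
Qed.

Lemma smallB Z Z' : small Z -> small Z' -> small (fun n U => Z n U - Z' n U).
Proof. by move=> hZ /smallN; exact: smallD. Qed.

Local Notation Q n := (perp_mx (v n)).

Lemma perp_bnd n : bnd (Q n) 2.
Proof.
have := bndD (bnd1 n.+2) (bndN (bnd_rank1 (v n) (v n))).
by rewrite hv mulr1.
Qed.

Definition Qletter : sletter := (false, fun n => Q n).

Lemma Qletter_bounded : mx_bounded Qletter.2.
Proof. by exists 2 => n; exact: perp_bnd. Qed.

(** Young's inequality; the weight [1/8] leaves room for absorbing the term in
[z] on the left-hand side in [master], where it competes with [1/2]. *)
Lemma young3 (z h : R) : 0 <= z -> 0 <= h ->
  z ^+ 3 * h <= z ^+ 4 / 8 + 512%:R * h ^+ 4.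
Proof.
move=> z0 h0; have [hz|zh] := leP h (z / 8).
  apply: (@le_trans _ _ (z ^+ 3 * (z / 8))).
    by apply: ler_wpM2l hz; exact: exprn_ge0.
  have -> : z ^+ 3 * (z / 8) = z ^+ 4 / 8 by ring.
  rewrite lerDl; apply: mulr_ge0; [exact: ler0n | exact: exprn_ge0].
apply: (@le_trans _ _ (512%:R * h ^+ 4)); last first.
  by rewrite lerDr; apply: divr_ge0; [exact: exprn_ge0 | exact: ler0n].
have -> : 512%:R * h ^+ 4 = (8 * h) ^+ 3 * h by ring.
apply: ler_wpM2r => //; rewrite lerXn2r ?nnegrE ?mulr_ge0 //; lra.
Qed.

Lemma young2 (z c : R) : c * z ^+ 2 <= z ^+ 4 / 8 + 2 * c ^+ 2.
Proof.
rewrite -subr_ge0 (_ : _ - _ = 8^-1 * (z ^+ 2 - 4 * c) ^+ 2); last by field.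
by rewrite mulr_ge0 ?sqr_ge0 // invr_ge0.
Qed.

Lemma nc_cubic (z zc h : C) : nc zc = nc z ->
  nc (z * (zc * zc) * h) = nc z ^+ 3 * nc h.
Proof. by move=> e; rewrite !ncM e; ring. Qed.

Lemma nc_quadratic (z zc a b : C) : nc zc = nc z ->
  nc (zc * zc * a + 2 * (z * zc) * b) <= (nc a + 2 * nc b) * nc z ^+ 2.
Proof.
move=> e; apply: le_trans (ncD _ _) _; rewrite !ncM e (nc_nat 2).
rewrite [leLHS](_ : _ = (nc a + 2 * nc b) * nc z ^+ 2) //; ring.
Qed.

(** The estimate that closes on itself. Suppose that the first term of the
Schwinger-Dyson equation of [s], divided by the dimension, is
[+- (1 - 1/N) Z + H] with [H] small, where [Z] is the trace under study. With
the scalar function [Z Zc^2], [Zc] the conjugate of [Z], the equation reads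
[(1 - 1/N) E |Z|^4 = - (+-) E (Z Zc^2 H) + O(1/N) E |Z|^2], because the
derivatives of [Z] and [Zc] contract to single bounded traces. Young's
inequality absorbs the powers of [|Z|] on the right into the left-hand side,
leaving [E |Z|^4 <= C (E |H|^4 + N^-2)].

The weight [alpha] is [1/N] for a normalized trace and [1] for the trace of a
word containing a matrix of rank one; the hypothesis on [Y] says that the
trace is bounded in either case. *)
Lemma master (s : seq sletter) (alpha : nat -> R) (sigma : bool) (H : fseq) K :
  sbounded s -> (forall n, 0 <= alpha n <= 1) -> 0 <= K ->
  (forall n (U : M n) Y c, stabilizer (v n) U -> bnd Y c ->
     nc ((alpha n)%:C%C * \tr (sword s U *m Y)) <= K * c) ->
  small H ->
  (forall n U, stabilizer (v n) U ->
     ((alpha n)%:C%C / n.+2%:R) *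
       del (fun A B => \tr (A *m Q n) * \tr (Q n *m B)) (map (inst n) s) U =
     (-1) ^+ sigma * ((n.+1%:R / n.+2%:R) *
       ((alpha n)%:C%C * \tr (Q n *m sword s U))) + H n U) ->
  small (fun n U => (alpha n)%:C%C * \tr (Q n *m sword s U)).
Proof.
move=> hs ha K0 hK [aH [KH [KH0 hH]]] main.
set Z : fseq := fun n U => _.
have aZ n : adm (Z n).
  apply: admZ; apply: adm_tr; apply: madmM; first exact: madm_cst.
  exact: madm_word.
(* Z and its conjugate as traces of words *)
pose t1 := Qletter :: s; pose t2 := adj_sword s ++ [:: Qletter].
have h1 : sbounded t1 by apply: sbounded_cons => //; exact: Qletter_bounded.
have h2 : sbounded t2.
  apply: sbounded_cat; first exact: sbounded_adj.
  by apply: sbounded_cons => //; exact: Qletter_bounded.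
pose D (t : seq sletter) n U : C :=
  ((alpha n)%:C%C * (alpha n)%:C%C) * del (fun L L' =>
      \tr (sword s U *m (Q n *m L' *m L *m Q n))) (map (inst n) t) U.
have hD t : sbounded t -> exists c, 0 <= c /\ forall n U, stabilizer (v n) U ->
    nc (D t n U) <= c.
  move=> ht.
  pose g n (U A B : M n) : C := ((alpha n)%:C%C * (alpha n)%:C%C) *
    \tr (sword s U *m (Q n *m B *m A *m Q n)).
  have [||c [c0 hc]] := @sdel_bound g t (K * 4) _ ht.
  - by apply: mulr_ge0 => //; exact: ler0n.
  - move=> n U A B x y GU hA hB; rewrite /g -mulrA ncM nc_real.
    have /andP[a0 a1] := ha n; rewrite ger0_norm //.
    have hY := bndM (bndM (bndM (perp_bnd n) hB) hA) (perp_bnd n).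
    have [Y0 _] := hY.
    apply: le_trans (ler_wpM2l a0 (hK n U _ _ GU hY)) _.
    apply: (@le_trans _ _ (K * (2 * y * x * 2))).
      by rewrite ler_piMl // mulr_ge0.
    by rewrite (_ : K * _ = K * 4 * (x * y)) //; ring.
  exists c; split=> // n U GU; rewrite /D delZ; exact: hc.
have [c1 [c10 hc1]] := hD _ h1; have [c2 [c20 hc2]] := hD _ h2.
pose c := c1 + 2 * c2.
split=> //; exists (4 * (512%:R * KH + 2 * c ^+ 2)); split.
  apply: mulr_ge0; first exact: ler0n.
  apply: addr_ge0; apply: mulr_ge0; first exact: ler0n.
  - exact: KH0.
  - exact: ler0n.
  - exact: sqr_ge0.
move=> n.
pose a := (alpha n)%:C%C : C.
pose Zc U := a * \tr (word (map (inst n) t2) U).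
have ZcE U : Zc U = Num.conj (Z n U).
  rewrite /Zc /Z rmorphM /= -mxtrace_adj trmxC_mul perp_adj.
  rewrite (_ : Num.conj ((alpha n)%:C%C : C) = a); last exact: conjc_real.
  by rewrite /t2 map_cat word_cat adj_swordE word_adj word1.
have ZE U : Z n U = a * \tr (word (map (inst n) t1) U) by [].
pose dZ X U := a * \tr (dword (map (inst n) t1) X U).
pose dZc X U := a * \tr (dword (map (inst n) t2) X U).
have sZ : smooth (v n) (Z n) dZ.
  by apply: smoothZ; apply: smooth_tr; exact: smooth_word.
have sZc : smooth (v n) Zc dZc.
  by apply: smoothZ; apply: smooth_tr; exact: smooth_word.
have sF := smoothZ (a / n.+2%:R) (smoothM sZ (smoothM sZc sZc)).
have SD := schwinger_dyson (hv n) (hE n) (map (inst n) s) sF.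
pose G U := n.+2%:R^-1 * (Zc U * Zc U * D t1 n U + 2 * (Z n U * Zc U) * D t2 n U).
have {}SD : E (fun U => complex.Re (Z n U * (Zc U * Zc U) *
   (a / n.+2%:R * del (fun A B => \tr (A *m Q n) * \tr (Q n *m B))
     (map (inst n) s) U) + G U)) = 0.
  rewrite -[RHS]SD; congr E; apply/funext => U; congr (complex.Re (_ + _)).
    by ring.
  rewrite /G /D -2!(contract_trace (v n)).
  pose S1 i j := word (map (inst n) s) U i j *
    \tr (dword (map (inst n) t1) (Q n *m delta_mx i j *m Q n) U).
  pose S2 i j := word (map (inst n) s) U i j *
    \tr (dword (map (inst n) t2) (Q n *m delta_mx i j *m Q n) U).
  transitivity (\sum_i \sum_j (n.+2%:R^-1 * (Zc U * Zc U * (a * a)) * S1 i j +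
      n.+2%:R^-1 * (2 * (Z n U * Zc U) * (a * a)) * S2 i j)).
    have sumZ (x : C) S : \sum_i \sum_j x * S i j =
        x * (\sum_(i < n.+2) \sum_(j < n.+2) S i j).
      by rewrite mulr_sumr; apply: eq_bigr => i _; rewrite mulr_sumr.
    transitivity (\sum_i \sum_j n.+2%:R^-1 * (Zc U * Zc U * (a * a)) * S1 i j +
        \sum_i \sum_j n.+2%:R^-1 * (2 * (Z n U * Zc U) * (a * a)) * S2 i j).
      rewrite !sumZ -/a /S1 /S2.
      set T1 := \sum_i _; set T2 := \sum_i _; ring.
    rewrite -big_split; apply: eq_bigr => i _ /=.
    by rewrite -big_split.
  apply: eq_bigr => i _; apply: eq_bigr => j _.
  by rewrite /dZ /dZc /S1 /S2; ring.
have aZc : adm Zc.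
  by apply: admZ; apply: adm_tr; exact: madm_word.
have aD t : adm (D t n).
  apply: admZ; apply: (@adm_del _ _ (fun U L L' =>
    \tr (sword s U *m (Q n *m L' *m L *m Q n)))) => A B mA mB; apply: adm_tr.
  apply: madmM; first exact: madm_word.
  apply: madmM; last exact: madm_cst.
  apply: madmM => //; apply: madmM => //; exact: madm_cst.
have aG : adm G.
  apply: admZ; apply: admD; first by apply: admM => //; exact: admM.
  by apply: admM => //; apply: admZ; exact: admM.
set phi := fun U => complex.Re _ in SD.
have rphi : radm phi.
  apply: radm_Re; apply: admD => //; apply: admM.
    by apply: admM => //; exact: admM.
  apply: admZ; apply: (@adm_del _ _ (fun U A B =>
    \tr (A *m Q n) * \tr (Q n *m B))) => A B mA mB.
  by apply: admM; apply: adm_tr;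
    apply: madmM => //; exact: madm_cst.
pose e : R := (-1) ^+ sigma.
have H1 : E (fun U => 4^-1 * nc (Z n U) ^+ 4) <=
    E (fun U => e * phi U + (512%:R * nc (H n U) ^+ 4 + 2 * (c / n.+2%:R) ^+ 2)).
  apply: (mean_le (hE n)).
  - by apply: radmZ; exact: radm_nc4.
  - apply: radmD; first exact: radmZ.
    by apply: radmD; [apply: radmZ; exact: radm_nc4 | exact: radm_cst].
  (* the pointwise inequality behind the estimate; q is 1 - 1/N >= 1/2 *)
  move=> U GU; rewrite /phi main //.
  set rho := n.+1%:R / n.+2%:R; set z := nc (Z n U); set h := nc (H n U).
  have z0 : 0 <= z by exact: nc_ge0.
  have h0 : 0 <= h by exact: nc_ge0.
  have nZc : nc (Zc U) = z by rewrite ZcE nc_conj.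
  pose q : R := n.+1%:R / n.+2%:R.
  have rhoE : rho = (q%:C)%C.
    by rewrite rmorphM fmorphV !rmorph_nat.
  have rho2 : 2^-1 <= q.
    rewrite /q ler_pdivlMr ?ltr0Sn // ler_pdivrMl // -natrM ler_nat; lia.
  clearbody q.
  have z4 : Z n U * (Zc U * Zc U) * Z n U = ((z ^+ 4)%:C)%C.
    rewrite ZcE (_ : _ * _ = (Num.conj (Z n U) * Z n U) ^+ 2); last by ring.
    by rewrite -nc_sqr -rmorphXn /= -exprM.
  have eE : ((-1) ^+ sigma : C) = (e%:C)%C by rewrite /e rmorphXn rmorphN1.
  have e2 : e * e = 1 by rewrite /e -expr2 sqrr_sign.
  set Y := Z n U * (Zc U * Zc U) * H n U + G U.
  have phiE : complex.Re (Z n U * (Zc U * Zc U) *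
      ((-1) ^+ sigma * (rho * Z n U) + H n U) + G U) =
      e * (q * z ^+ 4) + complex.Re Y.
    rewrite (_ : _ + G U = ((-1) ^+ sigma * rho) * (Z n U * (Zc U * Zc U) * Z n U)
       + Y); last by rewrite /Y; ring.
    rewrite z4 eE rhoE.
    have -> (x y w : R) : (x%:C * y%:C * w%:C)%C = ((x * (y * w))%:C)%C :> C.
      by rewrite !rmorphM mulrA.
    by rewrite raddfD.
  rewrite [X in e * X]phiE mulrDr mulrA e2 mul1r.
  have Yle : nc Y <= z ^+ 3 * h + c / n.+2%:R * z ^+ 2.
    apply: le_trans (ncD _ _) _; apply: lerD.
      by rewrite (nc_cubic _ nZc).
    rewrite /G ncM nc_natV [leLHS]mulrC [leRHS]mulrAC; apply: ler_wpM2r.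
      by rewrite invr_ge0 ler0n.
    apply: le_trans (nc_quadratic _ _ nZc) _; apply: ler_wpM2r.
      exact: sqr_ge0.
    rewrite /c; apply: lerD; first exact: hc1.
    by apply: ler_wpM2l; [exact: ler0n | exact: hc2].
  have eY : - nc Y <= e * complex.Re Y.
    rewrite lerNl; apply: le_trans (nc_Re Y).
    rewrite -mulNr; apply: le_trans (ler_norm _) _.
    by rewrite normrM normrN /e normrX normrN1 expr1n mul1r.
  have y3 := young3 z0 h0; have y2 := young2 z (c / n.+2%:R).
  have rz : 2^-1 * z ^+ 4 <= q * z ^+ 4.
    by apply: ler_wpM2r rho2; exact: exprn_ge0.
  move: rz y3 y2 Yle eY.
  move: (q * z ^+ 4) (z ^+ 3 * h) (512%:R * h ^+ 4)
    (c / n.+2%:R * z ^+ 2) (2 * (c / n.+2%:R) ^+ 2) (z ^+ 4) (nc Y)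
    (e * complex.Re Y) => r1 r2 r3 r4 r5 r6 r7 r8.
  move=> *; lra.
move: H1; rewrite (meanZ (hE n)); last exact: radm_nc4.
rewrite (meanD (hE n)); [|exact: radmZ|]; last first.
  by apply: radmD; [apply: radmZ; exact: radm_nc4 | exact: radm_cst].
rewrite (meanZ (hE n)) // SD mulr0 add0r.
rewrite (meanD (hE n)); [| by apply: radmZ; exact: radm_nc4 | exact: radm_cst].
rewrite (meanZ (hE n)); last exact: radm_nc4.
rewrite (mean_cst (hE n)) => H1.
have := hH n; move: H1; rewrite exprMn exprVn mulrA.
set x := E _; set y := E _; rewrite -/x => H1 H2.
have N0 := N2 n.
rewrite -mulrA -ler_pdivrMl // mulrDl.
apply: le_trans H1 _; rewrite -!mulrA; apply: lerD; last by [].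
by apply: ler_wpM2l H2; exact: ler0n.
Qed.

End Small.

(** * Traces of alternating words in traceless letters *)

Section Alternating.
Context {R : realType}.
Local Notation C := R[i].
Local Notation M n := 'M[C]_n.+2.
Variables (v : forall n, 'cV[C]_n.+2) (E : forall n, (M n -> R) -> R).
Hypothesis hv : forall n, l2norm (v n) = 1.
Hypothesis hE : forall n, haar_mean (v n) (@E n).
Local Notation small := (small E).
Local Notation fbounded := (fbounded v).
Local Notation Q n := (perp_mx (v n)).
Local Notation sletter := (@sletter R).
Implicit Types (s t : seq sletter) (l x y : sletter).

(** The terms of the Schwinger-Dyson equation: [s] is cut after its first [k]
letters and each piece is closed into a trace. *)
Definition split_term (alpha : nat -> R) s k : fseq := fun n U =>
  (n.+2%:R^-1 * \tr (sword (take k s) U *m Q n)) *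
  ((alpha n)%:C%C * \tr (Q n *m sword (drop k s) U)).

Definition conjugated_at s i : bool := (nth (false, fun=> 0) s i).1.

Definition trace_controlled (alpha : nat -> R) s : Prop :=
  exists2 K, 0 <= K & forall n (U : M n) Y c, stabilizer (v n) U -> bnd Y c ->
     nc ((alpha n)%:C%C * \tr (sword s U *m Y)) <= K * c.

Lemma tr_perp_rho n : n.+2%:R^-1 * \tr (Q n) = n.+1%:R / n.+2%:R :> C.
Proof. by rewrite tr_perp // mulrC -[X in (X - 1) * _]natr1 addrK. Qed.

Lemma adm_split_term alpha s k n : adm (split_term alpha s k (n := n)).
Proof.
by apply: admM; apply: admZ; apply: adm_tr; apply: madmM => //;
  do ?[exact: madm_cst]; exact: madm_word.
Qed.

Lemma scaled_del alpha s n U :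
  ((alpha n)%:C%C / n.+2%:R) *
       del (fun A B => \tr (A *m Q n) * \tr (Q n *m B)) (map (inst n) s) U =
  \sum_(i < size s) if conjugated_at s i then split_term alpha s i U -
     split_term alpha s i.+1 U else 0.
Proof.
rewrite sdelE mulr_sumr; apply: eq_bigr => i _; rewrite -/(conjugated_at s i).
by case: (conjugated_at s i); rewrite ?mulr0 // /split_term; ring.
Qed.

(** If the first letter is conjugated, the cut before it splits off
[tr_N Q = 1 - 1/N] and leaves the whole word: this is the main term, with sign
[+]. *)
Lemma master_head alpha x s : x.1 ->
  sbounded (x :: s) -> (forall n, 0 <= alpha n <= 1) ->
  trace_controlled alpha (x :: s) ->
  (forall i, (i < size (x :: s))%N -> conjugated_at (x :: s) i ->
     ((0 < i)%N -> small (split_term alpha (x :: s) i)) /\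
     small (split_term alpha (x :: s) i.+1)) ->
  small (fun n U => (alpha n)%:C%C * \tr (Q n *m sword (x :: s) U)).
Proof.
move=> xD bs ha [K K0 hK] h.
pose H : fseq := fun n U => \sum_(i < size (x :: s))
  if conjugated_at (x :: s) i then
   (if i == 0%N :> nat then 0 else split_term alpha (x :: s) i U) -
   split_term alpha (x :: s) i.+1 U else 0.
apply: (@master _ v E hv hE (x :: s) alpha false H K) => //.
  apply: (small_sum hE) => i; have := h i (ltn_ord i).
  case: (conjugated_at _ _) => [/(_ isT)[h1 h2]|_]; last exact: small0.
  apply: (smallB hE) => //; case: eqVneq h1 => [->|]; first by move=> _; exact: small0.
  by rewrite -lt0n => i0 /(_ i0).
move=> n U GU; rewrite scaled_del /H !big_ord_recl /= expr0 mul1r.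
rewrite {1 3}/conjugated_at /= xD sub0r addrA; congr (_ - _ + _).
rewrite /split_term take0 drop0 (_ : sword [::] U = 1%:M) //.
by rewrite mul1mx tr_perp_rho.
Qed.

(** If the last letter is conjugated, the cut after it yields the main term,
with sign [-]. *)
Lemma master_last alpha x s : x.1 ->
  sbounded (rcons s x) -> (forall n, 0 <= alpha n <= 1) ->
  trace_controlled alpha (rcons s x) ->
  (forall i, (i < size (rcons s x))%N -> conjugated_at (rcons s x) i ->
     small (split_term alpha (rcons s x) i) /\
     ((i.+1 < size (rcons s x))%N -> small (split_term alpha (rcons s x) i.+1))) ->
  small (fun n U => (alpha n)%:C%C * \tr (Q n *m sword (rcons s x) U)).
Proof.
move=> xD bs ha [K K0 hK] h.
pose H : fseq := fun n U => \sum_(i < size (rcons s x))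
  if conjugated_at (rcons s x) i then
   split_term alpha (rcons s x) i U -
   (if i.+1 == size (rcons s x) :> nat then 0 else
    split_term alpha (rcons s x) i.+1 U) else 0.
apply: (@master _ v E hv hE (rcons s x) alpha true H K) => //.
  apply: (small_sum hE) => i; have := h i (ltn_ord i).
  case: (conjugated_at _ _) => [/(_ isT)[h1 h2]|_]; last exact: small0.
  apply: (smallB hE) => //.
  case: eqVneq h2 => [_ _|ne h2]; first exact: small0.
  by apply: h2; rewrite ltn_neqAle ne; exact: ltn_ord.
move=> n U GU; rewrite scaled_del /H expr1 mulN1r.
have sz : size (rcons s x) = (size s).+1 by rewrite size_rcons.
move: (size (rcons s x)) sz => m sz; subst m.
rewrite !big_ord_recr /= eqxx subr0.
have -> : conjugated_at (rcons s x) (size s).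
  by rewrite /conjugated_at nth_rcons ltnn eqxx.
have last_term : split_term alpha (rcons s x) (size s).+1 U =
    n.+1%:R / n.+2%:R * ((alpha n)%:C%C * \tr (Q n *m sword (rcons s x) U)).
  rewrite /split_term -(size_rcons s x) take_size drop_size mulmx1 -tr_perp_rho.
  by rewrite [\tr (_ *m Q n)]mxtrace_mulC; ring.
rewrite last_term addrA addrC; congr (_ + (_ + _)).
apply: eq_bigr => i _; rewrite eqSS ltn_eqF ?(ltn_ord i) //.
Qed.

Lemma sword_bounded_trace s : sbounded s ->
  trace_controlled (fun n => n.+2%:R^-1) s.
Proof.
move=> /sword_bnd[c hc]; exists `|c| => // n U Y c' [uU _] hY.
rewrite ncM nc_real ger0_norm ?invr_ge0 ?ler0n //.
rewrite ler_pdivrMl ?ltr0Sn //.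
exact: nc_tr (bndM (bndW (ler_norm c) (hc n U uU)) hY).
Qed.

Lemma perp_vec n (A : M n) :
  \tr (A *m Q n) = \tr A - ((v n)^t* *m A *m v n) 0 0.
Proof.
rewrite /perp_mx mulmxBr mulmx1 mxtrace_sub; congr (_ - _).
by rewrite mxtrace_mulC tr_rank1.
Qed.

(** A vector state is bounded, so dividing it by the dimension makes it small:
traces can be replaced by traces on the range of [Q]. *)
Lemma small_vec s : sbounded s ->
  small (fun n U => n.+2%:R^-1 * ((v n)^t* *m sword s U *m v n) 0 0).
Proof.
move=> /sword_bnd[c hc]; apply: (small_rate hE (K := `|c|)) => // [n|n U [uU _]].
  have e U : ((v n)^t* *m sword s U *m v n) 0 0 = \tr (v n *m (v n)^t* *m sword s U).
    by rewrite tr_rank1.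
  under [X in adm X]eq_fun do rewrite e.
  by apply: admZ; apply: adm_tr; apply: madmM; [exact: madm_cst|exact: madm_word].
rewrite ncM nc_natV mulrC; apply: ler_wpM2r; first by rewrite invr_ge0 ler0n.
apply: le_trans (nc_form _ _ (hc n U uU)) _.
by rewrite hv !mulr1 ler_norm.
Qed.

Lemma adm_trace_perp s n : adm (fun U : M n => n.+2%:R^-1 * \tr (sword s U *m Q n)).
Proof.
by apply: admZ; apply: adm_tr; apply: madmM; [exact: madm_word|exact: madm_cst].
Qed.

Lemma small_trace_perp s : sbounded s ->
  small (fun n U => n.+2%:R^-1 * \tr (sword s U)) ->
  small (fun n U => n.+2%:R^-1 * \tr (sword s U *m Q n)).
Proof.
move=> bs hs; have := smallB hE hs (small_vec bs).
apply: (small_ext hE) => [n U _|n]; first by rewrite perp_vec mulrBr.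
exact: adm_trace_perp.
Qed.

Lemma fbounded_perp alpha t t' : (forall n, 0 <= alpha n <= 1) ->
  sbounded t -> trace_controlled alpha t' ->
  fbounded (fun n U => (alpha n)%:C%C * \tr (Q n *m sword (t ++ t') U)).
Proof.
move=> ha bt [K K0 hK]; split=> [n|].
  by apply: admZ; apply: adm_tr; apply: madmM; [exact: madm_cst|exact: madm_word].
have [c hc] := sword_bnd bt.
exists (K * (2 * `|c|)); split=> [|n U GU]; first by rewrite !mulr_ge0.
rewrite sword_cat mulmxA mxtrace_mulC; apply: hK => //.
apply: bndM; first exact: perp_bnd.
exact: bndW (ler_norm c) (hc n U GU.1).
Qed.

Definition alternating_letters s : bool := sorted (fun l l' => l.1 != l'.1) s.
Definition traceless s : Prop := {in s, forall l n, \tr (l.2 n) = 0}.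

Lemma alternating_take k s :
  alternating_letters s -> alternating_letters (take k s).
Proof. exact: take_sorted. Qed.

Lemma conjugated_before_last s x i : ~~ x.1 -> conjugated_at (rcons s x) i ->
  (i.+1 < size (rcons s x))%N.
Proof.
move=> nx; rewrite /conjugated_at size_rcons ltnS nth_rcons.
by case: ltnP => // si; case: eqP => // _; rewrite (negPf nx).
Qed.

(** The word begins with a conjugated letter and ends with a deterministic one,
so every cut but the first leaves a proper nonempty prefix, whose trace is small
by induction, times a bounded factor. *)
Lemma trace_small_step s x y : x.1 -> ~~ y.1 ->
  let w := x :: rcons s y in
  alternating_letters w -> sbounded w -> traceless w ->
  (forall t, (0 < size t < size w)%N ->
     alternating_letters t -> sbounded t -> traceless t ->
     small (fun n U => n.+2%:R^-1 * \tr (sword t U))) ->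
  small (fun n U => n.+2%:R^-1 * \tr (sword w U)).
Proof.
move=> xD yA w aw bw tw IH.
have ha n : 0 <= (n.+2%:R^-1 : R) <= 1.
  by rewrite invr_ge0 ler0n /= invf_le1 ?ltr0Sn // ler1n.
have cw := sword_bounded_trace bw.
have cN : forall n, ((n.+2%:R^-1 : R)%:C)%C = n.+2%:R^-1 :> C.
  by move=> n; rewrite fmorphV rmorph_nat.
have st k : (0 < k < size w)%N -> small (split_term (fun n => n.+2%:R^-1) w k).
  move=> hk.
  apply: (small_ext hE (Z := fun n U =>
     ((n.+2%:R^-1 : R)%:C%C * \tr (Q n *m sword (drop k w ++ [::]) U)) *
     (n.+2%:R^-1 * \tr (sword (take k w) U *m Q n)))).
  - by move=> n U _; rewrite /split_term cats0 mulrC.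
  - by move=> n; exact: adm_split_term.
  apply: (smallM hE).
    apply: fbounded_perp => //; first exact: sbounded_drop.
    by apply: sword_bounded_trace.
  apply: small_trace_perp; first exact: sbounded_take.
  apply: IH => //.
  - by rewrite size_take_min; move: hk; lia.
  - exact: alternating_take.
  - exact: sbounded_take.
  - by move=> l /mem_take; exact: tw.
have hZ : small (fun n U => (n.+2%:R^-1 : R)%:C%C * \tr (Q n *m sword w U)).
  apply: master_head => // i iw iD.
  have i1 : (i.+1 < size w)%N by apply: (@conjugated_before_last (x :: s) y i).
  by split=> [i0|]; apply: st; lia.
have := smallD hE hZ (small_vec bw).
apply: (small_ext hE) => [n U _|n].
  by rewrite mxtrace_mulC perp_vec cN mulrBr subrK.
by apply: admZ; apply: adm_tr; exact: madm_word.
Qed.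

Lemma mxtrace_lval n (U : M n) (l : letter) : U \is unitarymx ->
  \tr (lval U l) = \tr l.2.
Proof.
move=> uU; rewrite /lval; case: l.1 => //; rewrite mxtrace_mulC mulmxA.
by rewrite unitary_adj_mul // mul1mx.
Qed.

(** Only meaningful for letters of the same kind. *)
Definition letter_mul x y : sletter := (x.1, fun n => x.2 n *m y.2 n).

Lemma lval_letter_mul x y n (U : M n) : U \is unitarymx -> x.1 = y.1 ->
  lval U (inst n (letter_mul x y)) = lval U (inst n x) *m lval U (inst n y).
Proof.
move=> uU; rewrite /lval /inst /= => ->; case: y.1 => //.
by rewrite !mulmxA -(mulmxA _ _ U) (unitary_adj_mul uU) mulmx1.
Qed.

Lemma letter_mul_bounded x y : mx_bounded x.2 -> mx_bounded y.2 ->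
  mx_bounded (letter_mul x y).2.
Proof. by move=> [c hc] [c' hc']; exists (c * c') => n; exact: bndM. Qed.

Definition letter_trace x n : C := n.+2%:R^-1 * \tr (x.2 n).

Definition letter_center x : sletter := (x.1, fun n => x.2 n - (letter_trace x n)%:M).

Lemma letter_trace_bounded x : mx_bounded x.2 ->
  exists K, forall n, nc (letter_trace x n) <= K.
Proof.
move=> [c hc]; exists c => n; rewrite ncM nc_natV ler_pdivrMl ?ltr0Sn //.
exact: nc_tr.
Qed.

Lemma letter_center_bounded x : mx_bounded x.2 -> mx_bounded (letter_center x).2.
Proof.
move=> bx; have [K hK] := letter_trace_bounded bx; have [c hc] := bx.
exists (c + K) => n; apply: bndD => //; apply: bndN.
have := bndZ (letter_trace x n) (bnd1 n.+2); rewrite scalemx1 mulr1.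
by apply: bndW; exact: hK.
Qed.

Lemma letter_center_traceless x n : \tr ((letter_center x).2 n) = 0.
Proof.
rewrite /= mxtrace_sub mxtrace_scalar /letter_trace -[X in _ - X]mulr_natl.
by rewrite [X in _ - X]mulrA mulfV ?pnatr_eq0 // mul1r subrr.
Qed.

Lemma lval_letter_center x n (U : M n) : U \is unitarymx ->
  lval U (inst n x) = lval U (inst n (letter_center x)) + (letter_trace x n)%:M.
Proof.
rewrite /lval /inst /=; case: x.1 => [uU|_]; last by rewrite subrK.
rewrite mulmxBr mulmxBl -scalemx1 -scalemxAr -scalemxAl mulmx1.
by move/unitarymxP: uU => ->; rewrite subrK.
Qed.

(** Induction on the length. Traces are cyclic: if the two ends are of the same
kind, they are multiplied together, and centering the product leaves two shorter
alternating words; otherwise a rotation brings the word into the form required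
by [trace_small_step]. *)
Lemma traceless_trace_small s : (0 < size s)%N -> alternating_letters s ->
  sbounded s -> traceless s -> small (fun n U => n.+2%:R^-1 * \tr (sword s U)).
Proof.
have [m] := ubnP (size s); elim: m s => // m IH [//|x s] /=.
rewrite ltnS => sm _ ax bx tx.
have adm0 t n : adm (fun U : M n => n.+2%:R^-1 * \tr (sword t U)).
  by apply: admZ; apply: adm_tr; exact: madm_word.
case/lastP: s sm ax bx tx => [|s y] sm ax bx tx.
  apply: (small_ext hE _ (adm0 _) (small0 hE)) => n U [uU _].
  rewrite /sword /= mulmx1 mxtrace_lval //= tx ?mulr0 //.
  exact: mem_head.
have bxl : mx_bounded x.2 by apply: bx; exact: mem_head.
have byl : mx_bounded y.2.
  by apply: bx; rewrite inE mem_rcons mem_head orbT.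
have [xy|xy] := eqVneq x.1 y.1.
  pose z := letter_mul y x; have bz : mx_bounded z.2 by exact: letter_mul_bounded.
  have bs : sbounded s.
    by move=> l ls; apply: bx; rewrite inE mem_rcons inE ls !orbT.
  have ts : traceless s.
    by move=> l ls; apply: tx; rewrite inE mem_rcons inE ls !orbT.
  have axs : alternating_letters (x :: s).
    have := @alternating_take (size (x :: s)) (x :: rcons s y) ax.
    by rewrite -cats1 -cat_cons take_size_cat.
  have s0 : (0 < size s)%N.
    by move: ax; case: (s) => //=; rewrite xy eqxx.
  have h1 : small (fun n U => n.+2%:R^-1 * \tr (sword (letter_center z :: s) U)).
    apply: IH => //.
    - by move: sm; rewrite size_rcons /=; lia.
    - by move: axs; rewrite /alternating_letters /=; case: (s) => //= a s'; rewrite xy.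
    - exact: (sbounded_cons (letter_center_bounded bz) bs).
    - move=> l; rewrite inE => /predU1P[-> n|/ts //].
      exact: letter_center_traceless.
  have h2 : small (fun n U => n.+2%:R^-1 * \tr (sword s U)).
    apply: IH => //.
    - by move: sm; rewrite size_rcons /=; lia.
    - exact: path_sorted axs.
  have [K hK] := letter_trace_bounded bz.
  have := smallD hE h1 (smallM hE (fbounded_cst v hK) h2).
  apply: (small_ext hE) => [n U [uU _]|n]; last exact: adm0.
  have W : sword (x :: rcons s y) U =
      lval U (inst n x) *m (sword s U *m lval U (inst n y)).
    by rewrite /sword /= -cats1 map_cat word_cat word1.
  symmetry; rewrite W mxtrace_mulC -mulmxA -(lval_letter_mul uU (esym xy)).
  rewrite mxtrace_mulC -/z.
  rewrite (lval_letter_center z uU) mulmxDl mul_scalar_mx mxtraceD mxtraceZ mulrDr.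
  by congr (_ + _); rewrite mulrCA.
have [xD|xA] := boolP x.1.
  apply: trace_small_step => //.
    by move: xy; rewrite xD; case: y.1.
  move=> t /andP[t0 tw]; apply: IH => //.
  by move: sm tw; rewrite /= !size_rcons; lia.
have yD : y.1 by move: xy; rewrite (negPf xA); case: y.1.
have rc0 : rcons s y != [::] by case: (s).
case Er : (rcons s y) rc0 sm ax bx tx => [//|h t] _ sm ax bx tx.
have lt : last h t = y by rewrite -(last_rcons h s y) Er.
have mem l : (l \in h :: rcons t x) = (l \in [:: x, h & t]).
  by rewrite !inE mem_rcons inE orbCA.
have hx : h.1.
  by move: ax; rewrite /alternating_letters /= => /andP[]; rewrite (negPf xA);
    case: h.1.
have : small (fun n U => n.+2%:R^-1 * \tr (sword (h :: rcons t x) U)).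
  apply: trace_small_step => //.
  - move: ax; rewrite /alternating_letters /= rcons_path => /andP[_ ->].
    by rewrite lt yD; case: x.1 xA.
  - by move=> l; rewrite mem; exact: bx.
  - by move=> l; rewrite mem; exact: tx.
  - move=> u /andP[u0 uw]; apply: IH => //.
    by move: sm uw; rewrite /= size_rcons; lia.
apply: (small_ext hE) => [n U _|n]; last exact: adm0.
rewrite -rcons_cons -cats1 sword_cat mxtrace_mulC -sword_cat.
by [].
Qed.

End Alternating.

(** * The vector state on alternating words in traceless letters *)

Section VectorState.
Context {R : realType}.
Local Notation C := R[i].
Local Notation M n := 'M[C]_n.+2.
Variables (v : forall n, 'cV[C]_n.+2) (E : forall n, (M n -> R) -> R).
Hypothesis hv : forall n, l2norm (v n) = 1.
Hypothesis hE : forall n, haar_mean (v n) (@E n).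
Local Notation small := (small E).
Local Notation fbounded := (fbounded v).
Local Notation Q n := (perp_mx (v n)).
Local Notation sletter := (@sletter R).
Implicit Types (s t : seq sletter) (l x y : sletter).

Definition vstate n (A : M n) : C := ((v n)^t* *m A *m v n) 0 0.

(** The deterministic letter that turns a vector state into a trace. *)
Definition vv_letter : sletter := (false, fun n => v n *m (v n)^t*).

Lemma vstateE n (A : M n) : vstate A = \tr (v n *m (v n)^t* *m A).
Proof. by rewrite tr_rank1. Qed.

Lemma vstateD n (A B : M n) : vstate (A + B) = vstate A + vstate B.
Proof. by rewrite /vstate mulmxDr mulmxDl mxE. Qed.

Lemma vstate_bound n (A : M n) c : bnd A c -> nc (vstate A) <= c.
Proof. by move=> /nc_form h; apply: le_trans (h _ _) _; rewrite hv !mulr1. Qed.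

(** The identity [1 = v v^* + Q] is inserted between the two factors. *)
Lemma vstateM n (A B : M n) :
  vstate (A *m B) = vstate A * vstate B + vstate (A *m Q n *m B).
Proof.
have -> : A *m B = A *m (v n *m (v n)^t*) *m B + A *m Q n *m B.
  by rewrite -mulmxDl -mulmxDr addrC subrK mulmx1.
rewrite vstateD; congr (_ + _); rewrite /vstate.
rewrite !mulmxA -(mulmxA _ _ B) -(mulmxA _ _ (v n)).
by rewrite [in LHS]mxE big_ord1.
Qed.

Lemma adm_vstate n (F : M n -> M n) : madm F -> adm (fun U => vstate (F U)).
Proof.
move=> mF; under [X in adm X]eq_fun do rewrite vstateE.
by apply: adm_tr; apply: madmM => //; exact: madm_cst.
Qed.

Lemma fbounded_vstate s : sbounded s -> fbounded (fun n U => vstate (sword s U)).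
Proof.
move=> /sword_bnd[c hc]; split=> [n|]; first by apply: adm_vstate; exact: madm_word.
exists `|c|; split=> // n U [uU _].
by apply: vstate_bound; exact: bndW (ler_norm c) (hc n U uU).
Qed.

Lemma vv_letter_bounded : mx_bounded vv_letter.2.
Proof.
by exists 1 => n; have := bnd_rank1 (v n) (v n); rewrite hv mulr1.
Qed.

Lemma sword_vv_letter s x n (U : M n) : sword (s ++ [:: vv_letter; x]) U =
  sword s U *m (v n *m (v n)^t*) *m lval U (inst n x).
Proof. by rewrite sword_cat /sword /= mulmx1 mulmxA. Qed.

Lemma tr_vv_letter s x n (U Y : M n) :
  \tr (sword (s ++ [:: vv_letter; x]) U *m Y) =
  vstate (lval U (inst n x) *m Y *m sword s U).
Proof.
rewrite sword_vv_letter -!(mulmxA (sword s U)) mxtrace_mulC -!mulmxA.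
by rewrite mulmxA -vstateE !mulmxA.
Qed.

Lemma trace_controlled_vv_letter s x : sbounded s -> mx_bounded x.2 ->
  trace_controlled v (fun=> 1) (s ++ [:: vv_letter; x]).
Proof.
move=> /sword_bnd[c hc] [c' hc'].
have [c'0 _] := hc' 0%N.
exists (c' * `|c|) => [|n U Y d [uU _] hY]; first by rewrite mulr_ge0.
rewrite mul1r tr_vv_letter; apply: vstate_bound.
rewrite mulrAC; apply: bndM; last exact: bndW (ler_norm c) (hc n U uU).
by apply: bndM => //; apply: lval_bnd => //; exact: hc'.
Qed.

(** The quantity is the unnormalized trace of [Q s v v^* x], to which the
estimate of traces applies with weight [1]: every cut inside [s] splits off the
normalized trace of an alternating word in traceless letters, which is small.
The main term comes from the first letter of [s] or from [x], whichever is
conjugated; [Q v = 0] kills the remaining boundary term. *)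
Lemma vector_step x s : (0 < size s)%N -> alternating_letters (x :: s) ->
  sbounded (x :: s) -> traceless (x :: s) ->
  small (fun n U => vstate (lval U (inst n x) *m Q n *m sword s U)).
Proof.
move=> s0 axs bxs txs.
have as_ : alternating_letters s := path_sorted axs.
have bx : mx_bounded x.2 by apply: bxs; exact: mem_head.
have bs : sbounded s by move=> l ls; apply: bxs; rewrite inE ls orbT.
have ts : traceless s by move=> l ls; apply: txs; rewrite inE ls orbT.
set w := s ++ [:: vv_letter; x].
have bw : sbounded w.
  apply: sbounded_cat => //; apply: sbounded_cons; first exact: vv_letter_bounded.
  by apply: sbounded_cons.
have cw : trace_controlled v (fun=> 1) w by exact: trace_controlled_vv_letter.
have c0 : trace_controlled v (fun=> 1) [:: vv_letter; x].
  exact: (@trace_controlled_vv_letter [::]).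
have one (n : nat) : 0 <= (1 : R) <= 1 by rewrite ler01 lexx.
have st k : (0 < k <= size s)%N -> small (split_term v (fun=> 1) w k).
  move=> /andP[k0 ks].
  have tk : take k w = take k s by rewrite takel_cat.
  have dk : drop k w = drop k s ++ [:: vv_letter; x].
    by rewrite drop_cat ltn_neqAle ks andbT; case: eqVneq => // ->;
       rewrite subnn drop0 drop_size.
  apply: (small_ext hE (Z := fun n U =>
     ((1 : R)%:C%C * \tr (Q n *m sword (drop k s ++ [:: vv_letter; x]) U)) *
     (n.+2%:R^-1 * \tr (sword (take k s) U *m Q n)))).
  - by move=> n U _; rewrite /split_term tk dk mulrC.
  - by move=> n; exact: adm_split_term.
  apply: (smallM hE).
    by apply: (fbounded_perp hv (alpha := fun=> 1) one _ c0); exact: sbounded_drop.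
  apply: (small_trace_perp hv hE); first exact: sbounded_take.
  apply: (traceless_trace_small hv hE).
  - by rewrite size_takel.
  - exact: alternating_take.
  - exact: sbounded_take.
  - by move=> l /mem_take; exact: ts.
have wD i : conjugated_at w i -> (i < size s)%N \/ (i = (size s).+1 /\ x.1).
  rewrite /conjugated_at nth_cat; case: ltnP => [|si]; first by left.
  case: (i - size s)%N (subnKC si) => [|[|j]] e //=; last by rewrite nth_nil.
  by move=> xD; right; split=> //; rewrite -e addn1.
suff : small (fun n U => (1 : R)%:C%C * \tr (Q n *m sword w U)).
  apply: (small_ext hE) => [n U _|n].
    by rewrite mul1r mxtrace_mulC tr_vv_letter.
  apply: adm_vstate; apply: madmM; last exact: madm_word.
  by apply: madmM; [exact: madm_lval | exact: madm_cst].
have [xD|xA] := boolP x.1; last first.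
  (* the first letter of s is conjugated *)
  case: s s0 axs @w as_ bs ts bxs txs bw cw st wD =>
    // h t _ axs w as_ bs ts bxs txs bw cw st wD.
  have hD : h.1.
    by move: axs; rewrite /alternating_letters /= => /andP[];
      rewrite (negPf xA); case: h.1.
  apply: (master_head hv hE (alpha := fun=> 1) hD bw) => // i _ iD.
  have [ih|[_]] := wD _ iD; last by rewrite (negPf xA).
  by split=> [i0|]; apply: st; rewrite ?i0 ?ih ?(ltnW ih).
have we : w = rcons (s ++ [:: vv_letter]) x by rewrite -cats1 -catA.
rewrite we; rewrite we in bw cw st wD.
apply: (master_last hv hE (alpha := fun=> 1) xD bw) => // i _ iD.
have [ih|[-> _]] := wD _ iD.
  have i0 : (0 < i)%N.
    case: i iD ih => // iD _; move: axs iD; rewrite -we /conjugated_at /w.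
    by case: (s) s0 => //= h t _ /andP[]; rewrite xD; case: h.1.
  by split=> [|_]; apply: st; rewrite ?i0 ?ih ?(ltnW ih).
(* the cut just before x leaves a prefix that ends with v v^* and is closed
   with Q *)
split; last by rewrite size_rcons size_cat addn1 ltnn.
apply: (small_ext hE _ _ (small0 hE)) => [n U _|n]; last exact: adm_split_term.
rewrite /split_term -cats1 take_size_cat ?size_cat ?addn1 //.
rewrite sword_cat /sword /= mulmx1 -!mulmxA v_perp // !mulmx0 mxtrace0.
by rewrite mulr0 mul0r.
Qed.

(** Peeling off the first letter with [vstateM] leaves, besides the product of
the values, only terms controlled by [vector_step]. *)
Lemma traceless_vstate_small s : alternating_letters s -> sbounded s -> traceless s ->
  small (fun n U => vstate (sword s U) -
    \prod_(l <- s) vstate (lval U (inst n l))).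
Proof.
have adm_prod s' n : adm (fun U : M n => \prod_(l <- s') vstate (lval U (inst n l))).
  elim: s' => [|l s' IH].
    under [X in adm X]eq_fun do rewrite big_nil.
    exact: adm_cst.
  under [X in adm X]eq_fun do rewrite big_cons.
  by apply: admM => //; apply: adm_vstate; exact: madm_lval.
have adm_s s' n : adm (fun U : M n => vstate (sword s' U) -
    \prod_(l <- s') vstate (lval U (inst n l))).
  by apply: admB => //; apply: adm_vstate; exact: madm_word.
elim: s => [_ _ _|x s IH axs bxs txs].
  apply: (small_ext hE _ _ (small0 hE)) => [n U _|n]; last exact: adm_s.
  rewrite big_nil /vstate /sword /= mulmx1 vv1 // mxE.
  by rewrite subrr.
have bs : sbounded s by move=> l ls; apply: bxs; rewrite inE ls orbT.
have ts : traceless s by move=> l ls; apply: txs; rewrite inE ls orbT.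
have bx : sbounded [:: x].
  by apply: sbounded_cons => //; apply: bxs; exact: mem_head.
have h1 := smallM hE (fbounded_vstate bx) (IH (path_sorted axs) bs ts).
have h2 : small (fun n U => vstate (lval U (inst n x) *m Q n *m sword s U)).
  case: s axs bxs txs {IH bs ts h1} => [|h t] axs bxs txs.
    apply: (small_ext hE _ _ (small0 hE)) => [n U _|n].
      rewrite /sword /= mulmx1 /vstate -!mulmxA perp_v // !mulmx0.
      by rewrite mxE.
    apply: adm_vstate; apply: madmM; last exact: madm_word.
    by apply: madmM; [exact: madm_lval | exact: madm_cst].
  exact: vector_step.
have := smallD hE h1 h2.
apply: (small_ext hE) => [n U _|n]; last exact: adm_s.
have e1 : sword [:: x] U = lval U (inst n x) by exact: mulmx1.
have e2 : sword (x :: s) U = lval U (inst n x) *m sword s U by [].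
rewrite big_cons e1 e2 (vstateM (lval U (inst n x)) (sword s U)) mulrBr.
by rewrite addrAC.
Qed.

End VectorState.

(** * Reduction to alternating centered products *)

Section Reduction.
Context {R : realType} {K : choiceType}.
Local Notation C := R[i].
Local Notation M n := 'M[C]_n.+2.
Local Notation NC := (ncpoly R K).
Local Notation NC2 := (ncpoly R (K + K)%type).
Variables (v : forall n, 'cV[C]_n.+2) (E : forall n, (M n -> R) -> R).
Hypothesis hv : forall n, l2norm (v n) = 1.
Hypothesis hE : forall n, haar_mean (v n) (@E n).
Local Notation small := (small E).
Variables A B : forall n, K -> M n.
Hypothesis hA : forall k, mx_bounded (fun n => A n k).
Hypothesis hB : forall k, mx_bounded (fun n => B n k).

(** A factor of a product in the free algebra: [(false, p)] stands for
[p (X_k)] and [(true, p)] for [p (Y_k)]. The polynomial depends on the dimension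
because centering subtracts its normalized trace in that dimension. *)
Definition pfactor := (bool * (nat -> NC))%type.
Implicit Types (s t : seq pfactor) (x y : pfactor).

Definition poly_factor n x : NC + NC := if x.1 then inr (x.2 n) else inl (x.2 n).
Definition pval n x : NC2 := factor_val (poly_factor n x).
Definition pprod n s : NC2 := \prod_(x <- s) pval n x.
Definition pmx x : @sletter R :=
  (x.1, fun n => nceval (if x.1 then B n else A n) (x.2 n)).
Definition pbounded s : Prop := {in s, forall x, mx_bounded (pmx x).2}.

Definition pmul x y : pfactor := (x.1, fun n => x.2 n * y.2 n).
Definition pcenter x : pfactor := (x.1, fun n => x.2 n - (letter_trace (pmx x) n)%:A).

Lemma embXM (p q : NC) : embX (p * q) = embX p * embX q.
Proof. by apply: ncevalM => c k; exact: ncpoly_central. Qed.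

Lemma embYM (p q : NC) : embY (p * q) = embY p * embY q.
Proof. by apply: ncevalM => c k; exact: ncpoly_central. Qed.

Lemma pval_pmul n x y : x.1 = y.1 -> pval n (pmul x y) = pval n x * pval n y.
Proof.
rewrite /pval /poly_factor /= => <-; case: x.1; [exact: embYM | exact: embXM].
Qed.

Lemma pmx_pmul x y : x.1 = y.1 -> pmx (pmul x y) = letter_mul (pmx x) (pmx y).
Proof.
move=> e; rewrite /pmx /letter_mul /= -e; congr (_, _).
apply/functional_extensionality_dep => n.
by apply: ncevalM => c k; exact: mx_central.
Qed.

Lemma nceval_alg n (f : K -> M n) (c : C) : nceval f c%:A = c%:M.
Proof. by rewrite ncevalZ nceval1 scalemx1. Qed.

Lemma pmx_pcenter x : pmx (pcenter x) = letter_center (pmx x).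
Proof.
rewrite /pmx /letter_center /=; congr (_, _).
apply/functional_extensionality_dep => n.
by rewrite -scaleN1r ncevalD ncevalZ nceval_alg scaleN1r.
Qed.

Lemma pval_pcenter n x : pval n x = pval n (pcenter x) + (letter_trace (pmx x) n)%:A.
Proof.
rewrite /pval /poly_factor /=; set c := letter_trace _ _.
have e (f : K -> NC2) (p : NC) : nceval f p = nceval f (p - c%:A) + c%:A.
  by rewrite -scaleN1r ncevalD !ncevalZ nceval1 scaleN1r subrK.
by case: x.1; exact: e.
Qed.

Lemma not_alternating s :
  ~~ sorted (fun x y => x.1 != y.1) s ->
  exists s1 x y s2, s = s1 ++ x :: y :: s2 /\ x.1 = y.1.
Proof.
elim: s => // x [|y s] IH //=; rewrite negb_and => /orP[/negPn/eqP e|/IH].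
  by exists [::], x, y, s.
by move=> [s1 [x' [y' [s2 [-> e]]]]]; exists (x :: s1), x', y', s2.
Qed.

Lemma pprod_cat n s t : pprod n (s ++ t) = pprod n s * pprod n t.
Proof. by rewrite /pprod big_cat. Qed.

Lemma pprod_cons n x s : pprod n (x :: s) = pval n x * pprod n s.
Proof. by rewrite /pprod big_cons. Qed.

Lemma pprod_center n s1 x s2 : pprod n (s1 ++ x :: s2) =
  letter_trace (pmx x) n *: pprod n (s1 ++ s2) + pprod n (rcons s1 (pcenter x) ++ s2).
Proof.
rewrite cat_rcons 3!pprod_cat 2!pprod_cons [pval n x]pval_pcenter.
rewrite [(_ + _%:A) * _]mulrDl mulr_algl [LHS]mulrDr addrC; congr (_ + _).
exact: ncpoly_scaler.
Qed.

Lemma pprod_merge n s1 x y s2 : x.1 = y.1 ->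
  pprod n (s1 ++ pmul x y :: s2) = pprod n (s1 ++ x :: y :: s2).
Proof.
move=> exy; rewrite [LHS]pprod_cat [RHS]pprod_cat; congr (_ * _).
rewrite [LHS]pprod_cons [RHS]pprod_cons (pval_pmul n exy) [X in _ = _ * X]pprod_cons.
exact: (esym (mulrA _ _ _)).
Qed.

Lemma sorted_fst s : sorted (fun x y => x.1 != y.1) s =
  sorted (fun a b => a != b) (map fst s).
Proof. by rewrite sorted_map. Qed.

Definition pcentered s : Prop := {in s, forall x n, letter_trace (pmx x) n = 0}.

Variable Lam : forall n, NC2 -> M n -> C.
Hypothesis Lam_lin : forall n U, scalar (fun p => Lam (n := n) p U).
Hypothesis Lam1 : forall n (U : M n), stabilizer (v n) U -> Lam 1 U = 0.
Hypothesis Lam_adm : forall n p, adm (Lam (n := n) p).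
Hypothesis Lam_alt : forall s, (0 < size s)%N ->
  sorted (fun x y => x.1 != y.1) s -> pbounded s -> pcentered s ->
  small (fun n U => Lam (pprod n s) U).

(** Linear functionals that vanish at [1] and are small on alternating centered
products are small everywhere. By induction on the number of factors: adjacent
factors from the same algebra are merged, and then, from left to right, each
factor is replaced by its centering plus a scalar, which deletes the factor. *)
Lemma reduction_small s : pbounded s -> small (fun n U => Lam (pprod n s) U).
Proof.
have [m] := ubnP (size s); elim: m s => // m IH s sm bs.
have [salt|] := boolP (sorted (fun x y => x.1 != y.1) s); last first.
  move=> /not_alternating[s1 [x [y [s2 [es exy]]]]].
  have : small (fun n U => Lam (pprod n (s1 ++ pmul x y :: s2)) U).
    apply: IH.
      by move: sm; rewrite es !size_cat /=; lia.
    move=> z; rewrite mem_cat inE => /or3P[zs|/eqP ->|zs].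
    - by apply: bs; rewrite es mem_cat zs.
    - rewrite pmx_pmul //; apply: letter_mul_bounded; apply: bs;
        by rewrite es mem_cat !inE eqxx !orbT.
    - by apply: bs; rewrite es mem_cat !inE zs !orbT.
  apply: (small_ext hE) => [n U _|n]; last exact: Lam_adm.
  by rewrite es pprod_merge.
(* s1 : the factors that are already centered *)
suff H s2 s1 : (size (s1 ++ s2) < m.+1)%N ->
    sorted (fun x y => x.1 != y.1) (s1 ++ s2) -> pbounded (s1 ++ s2) ->
    pcentered s1 -> small (fun n U => Lam (pprod n (s1 ++ s2)) U).
  exact: (H s [::]).
elim: s2 s1 => [|x s2 IH2] s1 sz alt12 b12 c1.
  rewrite cats0 in alt12 b12 *; case: s1 {sz} alt12 b12 c1 => [|y s1] a1 b1 c1.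
    apply: (small_ext hE _ _ (small0 hE)) => [n U GU|n]; last exact: Lam_adm.
    by rewrite /pprod big_nil Lam1.
  exact: Lam_alt.
have bx : mx_bounded (pmx x).2.
  by apply: b12; rewrite mem_cat inE eqxx orbT.
have h1 : small (fun n U => Lam (pprod n (s1 ++ s2)) U).
  apply: IH.
    by move: sz; rewrite !size_cat /=; lia.
  move=> z; rewrite mem_cat => zs; apply: b12; rewrite mem_cat inE.
  by case/orP: zs => ->; rewrite ?orbT.
have h2 : small (fun n U => Lam (pprod n (rcons s1 (pcenter x) ++ s2)) U).
  apply: IH2.
  - by move: sz; rewrite !size_cat size_rcons /=; lia.
  - move: alt12; rewrite cat_rcons.
    by rewrite !sorted_fst !map_cat.
  - move=> z; rewrite mem_cat mem_rcons inE -orbA => /or3P[/eqP ->|zs|zs].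
    + by rewrite pmx_pcenter; exact: letter_center_bounded.
    + by apply: b12; rewrite mem_cat zs.
    + by apply: b12; rewrite mem_cat inE zs !orbT.
  - move=> z; rewrite mem_rcons inE => /predU1P[-> n|/c1 //].
    by rewrite pmx_pcenter /letter_trace letter_center_traceless mulr0.
have [k hk] := letter_trace_bounded bx.
have := smallD hE (smallM hE (fbounded_cst v hk) h1) h2.
apply: (small_ext hE) => [n U _|n]; last exact: Lam_adm.
by rewrite pprod_center Lam_lin.
Qed.

End Reduction.

(** * Evaluation at random matrices *)

Section Evaluation.
Context {R : realType} {K : choiceType}.
Local Notation C := R[i].
Local Notation M n := 'M[C]_n.+2.
Local Notation NC := (ncpoly R K).
Local Notation NC2 := (ncpoly R (K + K)%type).

Lemma nceval_conj n (U : M n) (B : K -> M n) (p : NC) : U \is unitarymx ->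
  nceval (conj_family U B) p = U *m nceval B p *m U^t*.
Proof.
move=> uU; move: p; apply: ncpoly_ind => [|c w p IH].
  by rewrite !nceval0 mulmx0 mul0mx.
rewrite 2!ncevalD 2!ncevalZ IH mulmxDr mulmxDl; congr (_ + _).
rewrite -scalemxAr -scalemxAl; congr (_ *: _); rewrite 2!nceval_mono.
elim: w => [|k w IHw].
  by rewrite !big_nil mulmx1; symmetry; apply/unitarymxP.
rewrite !big_cons IHw /conj_family -!mulmxE !mulmxA.
by rewrite -(mulmxA _ _ U) unitary_adj_mul // mulmx1.
Qed.

Lemma psi_mx_scalar (L : choiceType) n (A : L -> M n) : scalar (psi_mx A).
Proof.
move=> a p q; rewrite /psi_mx ncevalD ncevalZ mxtraceD mxtraceZ.
by rewrite mulrDr mulrCA.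
Qed.

Lemma psi_mx1 (L : choiceType) n (A : L -> M n) : psi_mx A 1 = 1.
Proof. by rewrite /psi_mx nceval1 mxtrace1 mulVf // pnatr_eq0. Qed.

Variable v : forall n, 'cV[C]_n.+2.
Hypothesis hv : forall n, l2norm (v n) = 1.

Lemma phi_mxE (L : choiceType) n (A : L -> M n) p :
  phi_mx (v n) A p = vstate v (nceval A p).
Proof. by rewrite vstateE. Qed.

Lemma vstateZ n a (A : M n) : vstate v (a *: A) = a * vstate v A.
Proof. by rewrite /vstate -scalemxAr -scalemxAl mxE. Qed.

Lemma phi_mx_scalar (L : choiceType) n (A : L -> M n) : scalar (phi_mx (v n) A).
Proof. by move=> a p q; rewrite !phi_mxE ncevalD ncevalZ vstateD vstateZ. Qed.

Lemma phi_mx1 (L : choiceType) n (A : L -> M n) : phi_mx (v n) A 1 = 1.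
Proof. by rewrite phi_mxE nceval1 /vstate mulmx1 vv1 // mxE. Qed.

Variables A B : forall n, K -> M n.

Definition pair_eval n (U : M n) : NC2 -> M n :=
  nceval (pair_family (A n) (conj_family U (B n))).

Lemma madm_pair_eval n P : madm (fun U : M n => pair_eval U P).
Proof.
move: P; apply: ncpoly_ind => [|c w p IH].
  by rewrite /pair_eval; under [X in madm X]eq_fun do rewrite nceval0;
    exact: madm_cst.
rewrite /pair_eval; under [X in madm X]eq_fun do
  rewrite ncevalD ncevalZ nceval_mono -mul_scalar_mx.
apply: madmD => //; apply: madmM; first exact: madm_cst.
elim: w => [|z w IHw].
  by under [X in madm X]eq_fun do rewrite big_nil; exact: madm_cst.
under [X in madm X]eq_fun do rewrite big_cons.
apply: madmM => //; case: z => k /=; first exact: madm_cst.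
exact: (madm_lval (true, B n k)).
Qed.

Lemma pair_eval_pval n (U : M n) x : U \is unitarymx ->
  pair_eval U (pval n x) = lval U (inst n (pmx A B x)).
Proof.
move=> uU; rewrite /pval /poly_factor /lval /inst /=.
have comp (f : K -> (K + K)%type) (p : NC) :
    pair_eval U (nceval (fun k => ncvar R (f k)) p) =
    nceval (pair_family (A n) (conj_family U (B n)) \o f) p.
  by apply: nceval_comp => c k; exact: mx_central.
case: x.1 => /=; last exact: (comp inl (x.2 n)).
by rewrite -nceval_conj //; exact: (comp inr (x.2 n)).
Qed.

Lemma pair_eval_pprod n (U : M n) s : U \is unitarymx ->
  pair_eval U (pprod n s) = sword (map (pmx A B) s) U.
Proof.
move=> uU; rewrite /pair_eval /pprod nceval_prod; last first.
  by move=> c k; exact: mx_central.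
elim: s => [|x s IH]; first by rewrite big_nil.
by rewrite big_cons IH -/(pair_eval U _) pair_eval_pval.
Qed.

(** This is where [U v = v] matters: the distribution of [U B U^*] with respect
to [v] is that of [B]. *)
Lemma vstate_conj n (U b : M n) : stabilizer (v n) U ->
  vstate v (U *m b *m U^t*) = vstate v b.
Proof.
move=> [uU Uv]; rewrite /vstate.
have Uv' : U^t* *m v n = v n by rewrite -{1}Uv mulmxA unitary_adj_mul // mul1mx.
rewrite !mulmxA -(mulmxA _ (U^t*)) Uv'.
by rewrite -[(v n)^t* *m U]trmxCK trmxC_mul trmxCK Uv'.
Qed.

Definition letter_seq (w : seq (K + K)) : seq (@pfactor R K) :=
  [seq match z with inl k => (false, fun=> ncvar R k)
                  | inr k => (true, fun=> ncvar R k) end | z <- w].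

Lemma pprod_letter_seq n w : pprod n (letter_seq w) = mono w.
Proof.
rewrite /pprod big_map -mono_prod; apply: eq_bigr => -[k|k] _;
  by rewrite /pval /= /embX /embY nceval_var.
Qed.

Hypothesis hA : forall k, mx_bounded (fun n => A n k).
Hypothesis hB : forall k, mx_bounded (fun n => B n k).

Lemma pbounded_letter_seq w : pbounded A B (letter_seq w).
Proof.
move=> x /mapP[[k|k] _ ->] /=.
- by have [c hc] := hA k; exists c => n; rewrite nceval_var.
- by have [c hc] := hB k; exists c => n; rewrite nceval_var.
Qed.

Variable E : forall n, (M n -> R) -> R.
Hypothesis hE : forall n, haar_mean (v n) (@E n).
Local Notation small := (small E).

Definition trace_defect n (P : NC2) (U : M n) : C :=
  psi_mx (pair_family (A n) (conj_family U (B n))) P -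
  free_product (psi_mx (A n)) (psi_mx (B n)) P.

Definition vector_defect n (P : NC2) (U : M n) : C :=
  phi_mx (v n) (pair_family (A n) (conj_family U (B n))) P -
  cfree_product (psi_mx (A n)) (psi_mx (B n))
    (phi_mx (v n) (A n)) (phi_mx (v n) (B n)) P.

Let freeP n := free_productP (psi_mx_scalar (A n)) (psi_mx_scalar (B n))
  (psi_mx1 (A n)) (psi_mx1 (B n)).
Let cfreeP n := cfree_productP (psi_mx_scalar (A n)) (psi_mx_scalar (B n))
  (phi_mx_scalar (A n)) (phi_mx_scalar (B n))
  (psi_mx1 (A n)) (psi_mx1 (B n)) (phi_mx1 (A n)) (phi_mx1 (B n)).

Lemma free_product_pval n x :
  free_product (psi_mx (A n)) (psi_mx (B n)) (pval n x) = letter_trace (pmx A B x) n.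
Proof.
have [_ fX fY _] := freeP n.
by rewrite /pval /poly_factor /letter_trace /=; case: x.1; [exact: fY | exact: fX].
Qed.

Lemma free_product1 n : free_product (psi_mx (A n)) (psi_mx (B n)) 1 = 1.
Proof.
have [_ fX _ _] := freeP n.
by rewrite -(psi_mx1 (A n)) -fX /embX nceval1.
Qed.

Lemma alternating_poly_factor n s : (0 < size s)%N ->
  sorted (fun x y : @pfactor R K => x.1 != y.1) s ->
  Defs.alternating (map (poly_factor n) s).
Proof.
move=> s0 ss; rewrite /Defs.alternating; apply/andP; split.
  by case: s s0 {ss}.
rewrite sorted_map; apply: sub_sorted ss => x y; rewrite /= /poly_factor.
by case: x.1 y.1 => [] [].
Qed.

Lemma centered_poly_factor n s : pcentered A B s ->
  Defs.centered (free_product (psi_mx (A n)) (psi_mx (B n))) (map (poly_factor n) s).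
Proof.
by move=> cs a /mapP[x xs ->]; rewrite -/(pval n x) free_product_pval cs.
Qed.

Lemma traceless_pmx s : pcentered A B s -> traceless (map (pmx A B) s).
Proof.
move=> cs l /mapP[x /cs h ->] n; have /eqP := h n.
by rewrite /letter_trace mulf_eq0 invr_eq0 pnatr_eq0 => /eqP.
Qed.

Lemma sbounded_pmx s : pbounded A B s -> sbounded (map (pmx A B) s).
Proof. by move=> bs l /mapP[x /bs h ->]. Qed.

Lemma alternating_pmx s : sorted (fun x y : @pfactor R K => x.1 != y.1) s ->
  alternating_letters (map (pmx A B) s).
Proof. by move=> ss; rewrite /alternating_letters sorted_map. Qed.

Lemma adm_trace_defect n P : adm (@trace_defect n P).
Proof.
apply: admB; last exact: adm_cst.
by apply: admZ; apply: adm_tr; exact: madm_pair_eval.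
Qed.

Lemma adm_vector_defect n P : adm (@vector_defect n P).
Proof.
apply: admB; last exact: adm_cst.
under [X in adm X]eq_fun do rewrite phi_mxE.
by apply: adm_vstate; exact: madm_pair_eval.
Qed.

Lemma scalarB (L : choiceType) (f g : ncpoly R L -> C) :
  scalar f -> scalar g -> scalar (fun p => f p - g p).
Proof. by move=> fl gl a p q; rewrite fl gl; ring. Qed.

Lemma trace_defect_scalar n (U : M n) : scalar (fun p => trace_defect p U).
Proof. by have [fl _ _ _] := freeP n; exact: (scalarB (psi_mx_scalar _) fl). Qed.

Lemma vector_defect_scalar n (U : M n) : scalar (fun p => vector_defect p U).
Proof. by have [fl _ _ _] := cfreeP n; exact: (scalarB (phi_mx_scalar _) fl). Qed.

(** On alternating centered products the free product vanishes and the trace is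
small, so the defect is small there, hence on all words. *)
Lemma trace_defect_small w : small (fun n U => trace_defect (mono w) U).
Proof.
apply: (small_ext hE (Z := fun n U => trace_defect (pprod n (letter_seq w)) U)).
- by move=> n U _; rewrite pprod_letter_seq.
- by move=> n; exact: adm_trace_defect.
apply: (@reduction_small R K v E hE A B trace_defect trace_defect_scalar
  _ adm_trace_defect _ (letter_seq w) (@pbounded_letter_seq w))
  => [n U GU|s s0 ss bs cs].
  by rewrite /trace_defect free_product1 psi_mx1 subrr.
have := traceless_trace_small hv hE (s := map (pmx A B) s).
rewrite size_map => /(_ s0 (alternating_pmx ss) (sbounded_pmx bs) (traceless_pmx cs)).
apply: (small_ext hE) => [n U [uU _]|n]; last exact: adm_trace_defect.
rewrite -pair_eval_pprod // /trace_defect.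
have [_ _ _ f0] := freeP n.
have := f0 _ (alternating_poly_factor n s0 ss) (centered_poly_factor (n := n) cs).
rewrite /factor_prod big_map => ->.
by rewrite subr0.
Qed.

(** On alternating centered products the conditionally free product and, up to
a small error, the vector state are both multiplicative. *)
Lemma vector_defect_small w : small (fun n U => vector_defect (mono w) U).
Proof.
apply: (small_ext hE (Z := fun n U => vector_defect (pprod n (letter_seq w)) U)).
- by move=> n U _; rewrite pprod_letter_seq.
- by move=> n; exact: adm_vector_defect.
apply: (@reduction_small R K v E hE A B vector_defect vector_defect_scalar
  _ adm_vector_defect _ (letter_seq w) (@pbounded_letter_seq w))
  => [n U GU|s s0 ss bs cs].
  have [_ fX _ _] := cfreeP n.
  rewrite /vector_defect phi_mx1.
  by rewrite -(nceval1 (fun k => ncvar R (inl k : (K + K)%type))) fX phi_mx1 subrr.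
have := traceless_vstate_small hv hE (s := map (pmx A B) s).
move=> /(_ (alternating_pmx ss) (sbounded_pmx bs) (traceless_pmx cs)).
apply: (small_ext hE) => [n U GU|n]; last exact: adm_vector_defect.
rewrite -pair_eval_pprod ?(GU.1) // /vector_defect phi_mxE; congr (_ - _).
have [_ fX fY f0] := cfreeP n.
have := f0 _ (alternating_poly_factor n s0 ss) (centered_poly_factor (n := n) cs).
rewrite /factor_prod !big_map => ->; apply: eq_bigr => x _.
rewrite /lval /inst /poly_factor /=; case: x.1 => /=.
- by rewrite (vstate_conj _ GU) -phi_mxE; symmetry; exact: fY.
- by rewrite -phi_mxE; symmetry; exact: fX.
Qed.

End Evaluation.

(** * Almost sure convergence *)

Section AlmostSure.
Context {R : realType} {d : measure_display} {T : measurableType d}.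
Local Notation C := R[i].
Local Notation M n := 'M[C]_n.+2.
Variable Pr : probability T R.

(** Comparison with the telescoping series of [1/(n+1) - 1/(n+2)]. *)
Lemma sum_inv_sqr_le (m : nat) :
  \sum_(n < m) (n.+2%:R ^+ 2)^-1 <= 1 - m.+1%:R^-1 :> R.
Proof.
elim: m => [|m IH]; first by rewrite big_ord0 invr1 subrr.
rewrite big_ord_recr /=; apply: le_trans (lerD IH (lexx _)) _.
rewrite -lerBrDl opprB addrCA [X in _ <= _ + X]addrC.
have a0 : (m.+1%:R : R) != 0 by rewrite pnatr_eq0.
have b0 : (m.+2%:R : R) != 0 by rewrite pnatr_eq0.
rewrite [leRHS](_ : _ = (m.+1%:R * m.+2%:R)^-1); last first.
  have -> : (m.+2%:R : R) = m.+1%:R + 1 by rewrite natr1.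
  have c0 : (m.+1%:R : R) + 1 != 0 by rewrite natr1 pnatr_eq0.
  by move: c0 a0; move: (m.+1%:R : R) => x c0 a0; field; apply/andP.
rewrite lef_pV2 ?posrE ?exprn_gt0 ?mulr_gt0 ?ltr0Sn //.
by rewrite expr2 ler_pM2r ?ltr0Sn // ler_nat.
Qed.

(** The series of the [f n] has a finite mean, hence is finite almost
surely, and then its terms tend to zero. *)
Lemma summable_ae_cvg0 (f : nat -> T -> R) (K : R) : 0 <= K ->
  (forall n, measurable_fun [set: T] (f n)) -> (forall n w, 0 <= f n w) ->
  (forall n, Pr.-integrable [set: T] (EFin \o f n)) ->
  (forall n, \int[Pr]_w f n w <= K / n.+2%:R ^+ 2) ->
  {ae Pr, forall w, f n w @[n --> \oo] --> (0 : R)}.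
Proof.
move=> K0 mf f0 intf hK.
have mEf n : measurable_fun [set: T] (EFin \o f n) by exact/measurable_EFinP.
pose g w := (\sum_(n <oo) (f n w)%:E)%E.
have mg : measurable_fun [set: T] g.
  have h0 n w : [set: T] w -> true -> (0 <= (f n w)%:E)%E by rewrite lee_fin.
  exact: (@ge0_emeasurable_sum _ _ _ _ (fun n w => (f n w)%:E) xpredT h0
            (fun n _ => mEf n)).
have g0 w : (0 <= g w)%E by apply: nneseries_ge0 => n _ _; rewrite lee_fin.
have intg : (\int[Pr]_w g w <= K%:E)%E.
  rewrite integral_nneseries //; last by move=> n w _; rewrite lee_fin.
  apply: lime_le.
    by apply: is_cvg_nneseries => n _ _; apply: integral_ge0 => w _; rewrite lee_fin.
  apply: nearW => m.
  have e n : (\int[Pr]_w (f n w)%:E = (\int[Pr]_w f n w)%:E)%E.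
    by rewrite /Rintegral fineK //; apply: integrable_fin_num => //; exact: intf.
  under eq_bigr do rewrite e.
  rewrite sumEFin lee_fin big_mkord.
  apply: (@le_trans _ _ (\sum_(n < m) K * (n.+2%:R ^+ 2)^-1)).
    by apply: ler_sum => n _; exact: hK.
  rewrite -mulr_sumr ler_piMr //; apply: le_trans (sum_inv_sqr_le m) _.
  by rewrite gerBl invr_ge0 ler0n.
have Ig : Pr.-integrable [set: T] g.
  apply/integrableP; split=> //; apply: le_lt_trans (ltry K).
  by under eq_integral do rewrite gee0_abs //.
have := integrable_ae measurableT Ig; apply: filterS => w /(_ I) gfin.
apply: cvg_series_cvg_0; apply: nondecreasing_is_cvgn.
  by apply/nondecreasing_seqP => n; rewrite /series /= big_nat_recr //= lerDl.
exists (fine (g w)) => _ [m _ <-].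
rewrite -lee_fin fineK // /series /= -sumEFin.
by apply: nneseries_lim_ge => n _ _; rewrite lee_fin.
Qed.

Variables (v : forall n, 'cV[C]_n.+2) (U : forall n, T -> M n).
Hypothesis mU : forall n, measurable_fun [set: T] (U n : T -> bmx R n.+2).
Hypothesis GU : forall n w, stabilizer (v n) (U n w).

Lemma small_ae (Z : forall n, M n -> C) :
  small (fun n f => \int[Pr]_w f (U n w)) Z ->
  {ae Pr, forall w, nc (Z n (U n w)) @[n --> \oo] --> (0 : R)}.
Proof.
move=> [aZ [K [K0 hK]]].
have r n : radm (fun V : M n => nc (Z n V) ^+ 4) by exact: radm_nc4.
have mf n : measurable_fun [set: T] (fun w => nc (Z n (U n w)) ^+ 4).
  by apply: (measurableT_comp (f := (fun V => nc (Z n V) ^+ 4) : bmx R n.+2 -> R));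
    [exact: (r n).1 | exact: mU].
have PrT : (Pr [set: T] < +oo)%E by rewrite probability_setT ltry.
have intf n : Pr.-integrable [set: T] (EFin \o (fun w => nc (Z n (U n w)) ^+ 4)).
  apply: measurable_bounded_integrable => //.
  have [_ [k hk]] := r n; exists k; split; rewrite ?num_real // => k' kk' w _ /=.
  by apply: le_trans (ltW kk'); apply: hk; exact: (GU n w).1.
have := summable_ae_cvg0 K0 mf (fun n w => exprn_ge0 4 (nc_ge0 _)) intf hK.
apply: filterS => w h; apply/cvgr0Pnorm_lt => e e0.
have e4 : 0 < e ^+ 4 by exact: exprn_gt0.
move/cvgr0Pnorm_lt: h => /(_ _ e4); apply: filterS => n.
by rewrite normrX ltr_pXn2r // nnegrE ?normr_ge0 // ltW.
Qed.

End AlmostSure.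

Section Vanishing.
Context {R : realType}.
Local Notation C := R[i].

Definition vanishing (x : nat -> C) : Prop := nc (x n) @[n --> \oo] --> (0 : R).

Lemma vanishing0 : vanishing (fun=> 0).
Proof. by rewrite /vanishing nc0; exact: cvg_cst. Qed.

Lemma vanishing_lin c x y : vanishing x -> vanishing y ->
  vanishing (fun n => c * x n + y n).
Proof.
move=> hx hy; have : nc c * nc (x n) + nc (y n) @[n --> \oo] --> (0 : R).
  by rewrite -[X in _ --> X](addr0 0) -{1}(mulr0 (nc c)); apply: cvgD => //;
    exact: cvgMr.
apply: squeeze_cvgr (cvg_cst _); apply: nearW => n; rewrite nc_ge0 /=.
by rewrite -ncM; exact: ncD.
Qed.

Lemma vanishing_ncpoly (L : choiceType) (f : nat -> ncpoly R L -> C) :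
  (forall n, scalar (f n)) -> (forall w, vanishing (fun n => f n (mono w))) ->
  forall p, vanishing (fun n => f n p).
Proof.
move=> fl fw; apply: ncpoly_ind => [|c w p IH].
  by under [X in vanishing X]eq_fun do rewrite (scal0 (fl _)); exact: vanishing0.
under [X in vanishing X]eq_fun do rewrite fl.
exact: vanishing_lin.
Qed.

Lemma vanishing_ncpoly_ae (L : choiceType) (d : measure_display)
    (T : measurableType d) (Pr : probability T R)
    (f : nat -> T -> ncpoly R L -> C) :
  (forall n w, scalar (f n w)) ->
  (forall u, {ae Pr, forall w, vanishing (fun n => f n w (mono u))}) ->
  forall p, {ae Pr, forall w, vanishing (fun n => f n w p)}.
Proof.
move=> fl fw; apply: ncpoly_ind => [|c u p IH].
  apply: aeW => w.
  by under [X in vanishing X]eq_fun do rewrite (scal0 (fl _ _)); exact: vanishing0.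
apply: filterS2 (fw u) IH => w h1 h2.
under [X in vanishing X]eq_fun do rewrite fl.
exact: vanishing_lin.
Qed.

(** Over a countable alphabet there are countably many words, so the exceptional
sets can be collected into one. *)
Lemma ae_all_words (K : choiceType) (d : measure_display)
    (T : measurableType d) (Pr : probability T R) (P : seq (K + K) -> T -> Prop) :
  countable [set: K] -> (forall u, {ae Pr, forall w, P u w}) ->
  {ae Pr, forall w, forall u, P u w}.
Proof.
move=> /countable_injP[f finj] h.
pose code (z : K + K) : nat + nat :=
  match z with inl k => inl (f k) | inr k => inr (f k) end.
have code_inj : injective code.
  by move=> [k|k] [k'|k'] //= [] e; congr (_ _); apply: finj; rewrite ?inE.
pose g (u : seq (K + K)) := pickle (map code u).
have g_inj : injective g.
  move=> u u' /(pcan_inj pickleK); exact: inj_map.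
have : {ae Pr, forall w, forall m u, g u = m -> P u w}.
  apply: ae_foralln => m.
  have [[u um]|no] := pselect (exists u, g u = m).
    by apply: filterS (h u) => w Pu u' um'; have -> : u' = u by apply: g_inj; rewrite um.
  by apply: aeW => w u um; case: no; exists u.
by apply: filterS => w H u; exact: (H (g u)).
Qed.

Lemma psi_mx_conj (K : choiceType) n (U : 'M[C]_n.+2) (B : K -> 'M[C]_n.+2) :
  U \is unitarymx -> psi_mx (conj_family U B) = psi_mx B.
Proof.
move=> uU; apply/funext => p; rewrite /psi_mx nceval_conj //; congr (_ * _).
by rewrite mxtrace_mulC mulmxA unitary_adj_mul // mul1mx.
Qed.

Lemma phi_mx_conj (K : choiceType) (v : forall n, 'cV[C]_n.+2) n
    (U : 'M[C]_n.+2) (B : K -> 'M[C]_n.+2) :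
  stabilizer (v n) U -> phi_mx (v n) (conj_family U B) = phi_mx (v n) B.
Proof.
move=> GU; apply/funext => p; rewrite !(phi_mxE v) nceval_conj ?vstate_conj //.
exact: GU.1.
Qed.

End Vanishing.

(* The index n stands for the dimension N = n + 2. The joint law of the U n is
   arbitrary. In the last conjunct the almost sure event is common to all
   polynomials, which requires a countable index set K. *)
Theorem theorem4p1p3 (R : realType) (K : choiceType)
    (d : measure_display) (T : measurableType d) (Pr : probability T R)
    (A B : forall n : nat, K -> 'M[R[i]]_n.+2)
    (v : forall n : nat, 'cV[R[i]]_n.+2)
    (U : forall n : nat, T -> 'M[R[i]]_n.+2)
    (hA : forall k : K, exists c : R, forall n : nat, opnorm (A n k) <= c)
    (hB : forall k : K, exists c : R, forall n : nat, opnorm (B n k) <= c)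
    (hv : forall n : nat, l2norm (v n) = 1)
    (hU : forall n : nat, haar_distributed Pr (stabilizer (v n)) (U n)) :
  (forall P : ncpoly R (K + K)%type,
     {ae Pr, forall w,
       eq_o1 (fun n => psi_mx (pair_family (A n) (conj_family (U n w) (B n))) P)
             (fun n => free_product (psi_mx (A n)) (psi_mx (B n)) P)}) /\
  (forall P : ncpoly R (K + K)%type,
     {ae Pr, forall w,
       eq_o1 (fun n => phi_mx (v n)
                (pair_family (A n) (conj_family (U n w) (B n))) P)
             (fun n => cfree_product (psi_mx (A n)) (psi_mx (B n))
                (phi_mx (v n) (A n)) (phi_mx (v n) (B n)) P)}) /\
  (countable [set: K] ->
     {ae Pr, forall w,
       asymp_cfree v A (fun n => conj_family (U n w) (B n))}).
Proof.
have bA k : mx_bounded (fun n => A n k).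
  by have [c hc] := hA k; exists c => n; exact: opnorm_bnd.
have bB k : mx_bounded (fun n => B n k).
  by have [c hc] := hB k; exists c => n; exact: opnorm_bnd.
(* U' n is almost surely U n, and lies in the stabilizer everywhere *)
have hE n := cid (haar_mean_exists (hU n)).
pose U' n := projT1 (hE n).
have mU n : measurable_fun [set: T] (U' n : T -> bmx R n.+2).
  by rewrite /U'; case: (hE n) => ? [].
have GU n w : stabilizer (v n) (U' n w) by rewrite /U'; case: (hE n) => ? [].
have meanU n : haar_mean (v n) (fun f => \int[Pr]_w f (U' n w)).
  by rewrite /U'; case: (hE n) => ? [].
have U'U : {ae Pr, forall w, forall n, U' n w = U n w}.
  by apply: ae_foralln => n; rewrite /U'; case: (hE n) => ? [].
have trace_word u : {ae Pr, forall w,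
    vanishing (fun n => trace_defect A B (mono u) (U' n w))}.
  exact: (small_ae mU GU (trace_defect_small hv bA bB meanU u)).
have vector_word u : {ae Pr, forall w,
    vanishing (fun n => vector_defect v A B (mono u) (U' n w))}.
  exact: (small_ae mU GU (vector_defect_small hv bA bB meanU u)).
have trace_lin n w := trace_defect_scalar A B (U' n w).
have vector_lin n w := vector_defect_scalar hv A B (U' n w).
split; [|split].
- move=> P; have := vanishing_ncpoly_ae trace_lin trace_word P.
  by apply: filterS2 U'U => w e h; rewrite /eq_o1; under eq_fun do rewrite -e.
- move=> P; have := vanishing_ncpoly_ae vector_lin vector_word P.
  by apply: filterS2 U'U => w e h; rewrite /eq_o1; under eq_fun do rewrite -e.
- move=> cK.
  have ht := ae_all_words cK trace_word; have hvec := ae_all_words cK vector_word.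
  apply: filterS3 U'U ht hvec => w e h1 h2 P.
  have eU n : psi_mx (conj_family (U n w) (B n)) = psi_mx (B n).
    by rewrite -e; apply: psi_mx_conj; exact: (GU n w).1.
  have eV n : phi_mx (v n) (conj_family (U n w) (B n)) = phi_mx (v n) (B n).
    by rewrite -e; apply: phi_mx_conj.
  split; rewrite /eq_o1.
  + under eq_fun do rewrite eU -e.
    exact: (vanishing_ncpoly (fun n => trace_lin n w) h1 P).
  + under eq_fun do rewrite eU eV -e.
    exact: (vanishing_ncpoly (fun n => vector_lin n w) h2 P).
Qed.
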